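(* Let $(V,\mu)$ be a separable probability space, and let $\mathcal{M}$ be the set of self-adjoint kernel operators $M:V\times V\to\mathbb{C}$ with $\|M\|_\infty\le 1$. Let $\{M_i\}_{i=1}^\infty$ be a sequence in $\mathcal{M}$. Then the following two statements are equivalent. 1. $\{M_i\}_{i=1}^\infty$ is convergent in the $\delta_\square$ distance. 2. There is a decreasing sequence $\{\alpha_j\}_{j=1}^\infty$ of positive reals with $\lim_{j\to\infty}\alpha_j=0$ such that for every $j$ the sequence $\{[M_i]_{\alpha_j}\}_{i=1}^\infty$ is $\delta_1$-convergent. Furthermore, in the situation of statement 2, the $\delta_\square$-limit $M$ of $\{M_i\}_{i=1}^\infty$ can be computed as $$M=\lim_{j\to\infty}\Bigl(\lim_{i\to\infty}[M_i]_{\alpha_j}\Bigr),$$ where both limits are taken in $\delta_1$ (limits being understood up to distance $0$).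
   Context: A (Hilbert–Schmidt) kernel operator is a complex-valued function $M\in L_2(V\times V,\mu\times\mu)$ (up to a.e. equality), acting on $L_2(V,\mu)$ by $(Mf)(x)=\int M(x,y)f(y)\,d\mu(y)$. It is self-adjoint if $M(x,y)=\overline{M(y,x)}$ a.e. $\|M\|_1,\|M\|_2,\|M\|_\infty$ are the norms of $M$ as a function on $V\times V$. The cut norm is $\|M\|_\square=\sup|f^*Mg|$, the supremum over measurable $f,g:V\to\mathbb{C}$ with $\|f\|_\infty,\|g\|_\infty\le 1$, where $f^*Mg=\iint\overline{f(x)}M(x,y)g(y)\,d\mu(x)\,d\mu(y)$. A self-adjoint $M$ has a spectral decomposition $M=\sum_i\lambda_i f_if_i^*$ (convergent in $L_2$) with $\{f_i\}$ orthonormal in $L_2(V)$ and $\lambda_i\in\mathbb{R}$, where $(ff^* )(x,y)=f(x)\overline{f(y)}$. For $\lambda\ge 0$, $[M]_\lambda=\sum_{i:\,|\lambda_i|>\lambda}\lambda_i f_if_i^*$ (independent of the choice of $f_i$). For a measure preserving map $\psi:V\to V$, $W^\psi(x,y)=W(\psi(x),\psi(y))$. For $n\in\{1,\square\}$, $\delta_n(W_1,W_2)=\inf_{\psi_1,\psi_2}\|W_1^{\psi_1}-W_2^{\psi_2}\|_n$ over all measure preserving maps $\psi_1,\psi_2:V\to V$. Standing convention: $V$ is such that this equals $\inf_\psi\|W_1^\psi-W_2\|_n$ over invertible measure preserving maps $\psi:V\to V$ (as is the case for standard probability spaces). A sequence is $\delta_n$-convergent if there is a kernel operator $L$ to which its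 $\delta_n$-distance tends to $0$ (for statement 1 the limit lies in $\mathcal{M}$). *)

(* Defs.v *)
From HB Require Import structures.
From mathcomp Require Import all_boot all_order all_algebra.
From mathcomp Require Import complex.
From mathcomp Require Import all_classical all_reals all_analysis.

Set Implicit Arguments.
Unset Strict Implicit.
Unset Printing Implicit Defensive.

Import Order.TTheory GRing.Theory Num.Theory.
Import numFieldNormedType.Exports.

Local Open Scope classical_set_scope.
Local Open Scope ring_scope.

(* Measurability and integration of complex-valued functions are taken
   componentwise: R[i] carries no sigma-algebra in the library. *)
Definition cmeasurable (R : realType) (d : measure_display)
    (T : measurableType d) (f : T -> R[i]) : Prop :=
  measurable_fun [set: T] (fun x => complex.Re (f x)) /\
  measurable_fun [set: T] (fun x => complex.Im (f x)).

Definition cintegral (R : realType) (d : measure_display)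
    (T : measurableType d) (P : {measure set T -> \bar R}) (f : T -> R[i]) : R[i] :=
  Complex (Rintegral P [set: T] (fun x => complex.Re (f x)))
          (Rintegral P [set: T] (fun x => complex.Im (f x))).

Definition cLnorm (R : realType) (d : measure_display)
    (T : measurableType d) (P : {measure set T -> \bar R}) (p : \bar R)
    (f : T -> R[i]) : \bar R :=
  Lnorm P p (fun x => (ComplexField.Normc.normc (f x))%:E).

Definition inL2 (R : realType) (d : measure_display)
    (T : measurableType d) (P : {measure set T -> \bar R}) (f : T -> R[i]) : Prop :=
  cmeasurable f /\ (cLnorm P 2%:E f < +oo)%E.

(* Separability of the measure algebra, equivalently of L_2(V, mu). *)
Definition separable_measure (R : realType) (d : measure_display)
    (V : measurableType d) (mu : probability V R) : Prop :=
  exists A : nat -> set V, (forall n, measurable (A n)) /\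
    forall B : set V, measurable B -> forall e : R, 0 < e ->
      exists n, (mu (B `+` A n) < e%:E)%E.

(* Kernel operators are represented by their kernels, as honest functions;
   every notion below only depends on them up to a.e. equality. *)
Definition kernel_operator (R : realType) (d : measure_display)
    (V : measurableType d) (mu : probability V R) (M : V * V -> R[i]) : Prop :=
  inL2 (mu \x mu)%E M.

Definition self_adjoint (R : realType) (d : measure_display)
    (V : measurableType d) (mu : probability V R) (M : V * V -> R[i]) : Prop :=
  {ae (mu \x mu)%E, forall z, M z = conjc (M (z.2, z.1))}.

Definition calM (R : realType) (d : measure_display)
    (V : measurableType d) (mu : probability V R) (M : V * V -> R[i]) : Prop :=
  [/\ kernel_operator mu M, self_adjoint mu M &
      (cLnorm (mu \x mu)%E +oo%E M <= 1)%E].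

Definition kernel_norm1 (R : realType) (d : measure_display)
    (V : measurableType d) (mu : probability V R) (M : V * V -> R[i]) : \bar R :=
  cLnorm (mu \x mu)%E 1%:E M.

(* f^* M g *)
Definition kernel_form (R : realType) (d : measure_display)
    (V : measurableType d) (mu : probability V R)
    (f : V -> R[i]) (M : V * V -> R[i]) (g : V -> R[i]) : R[i] :=
  cintegral (mu \x mu)%E (fun z => conjc (f z.1) * M z * g z.2).

Definition cut_norm (R : realType) (d : measure_display)
    (V : measurableType d) (mu : probability V R) (M : V * V -> R[i]) : \bar R :=
  ereal_sup [set r | exists f g : V -> R[i],
    [/\ cmeasurable f /\ (cLnorm mu +oo%E f <= 1)%E,
        cmeasurable g /\ (cLnorm mu +oo%E g <= 1)%E &
        r = (ComplexField.Normc.normc (kernel_form mu f M g))%:E]].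

Definition inner (R : realType) (d : measure_display)
    (V : measurableType d) (mu : probability V R) (f g : V -> R[i]) : R[i] :=
  cintegral mu (fun x => f x * conjc (g x)).

Definition orthonormal_on (R : realType) (d : measure_display)
    (V : measurableType d) (mu : probability V R)
    (D : set nat) (f : nat -> V -> R[i]) : Prop :=
  (forall i, D i -> inL2 mu (f i)) /\
  (forall i j, D i -> D j -> inner mu (f i) (f j) = (i == j)%:R).

(* K is the L_2-sum of lam_i f_i f_i^* over the indices i in D. *)
Definition spectral_sum (R : realType) (d : measure_display)
    (V : measurableType d) (mu : probability V R)
    (D : set nat) (lam : nat -> R) (f : nat -> V -> R[i])
    (K : V * V -> R[i]) : Prop :=
  cLnorm (mu \x mu)%E 2%:E
    (fun z => K z - \sum_(i < n | `[< D i >])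
                      (lam i)%:C%C * (f i z.1 * conjc (f i z.2)))
    @[n --> \oo] --> 0%E.

(* The index set D is an arbitrary (finite or infinite) set of naturals, since
   L_2(V) may be finite-dimensional. *)
Definition spectral_decomposition (R : realType) (d : measure_display)
    (V : measurableType d) (mu : probability V R) (M : V * V -> R[i])
    (D : set nat) (lam : nat -> R) (f : nat -> V -> R[i]) : Prop :=
  orthonormal_on mu D f /\ spectral_sum mu D lam f M.

(* [M]_l, defined up to a.e. equality: some representative of the truncated
   sum, for some spectral decomposition of M (junk value 0 if there is none). *)
Definition truncation (R : realType) (d : measure_display)
    (V : measurableType d) (mu : probability V R)
    (M : V * V -> R[i]) (l : R) : V * V -> R[i] :=
  xget (fun=> 0) [set K | kernel_operator mu K /\
    exists (D : set nat) (lam : nat -> R) (f : nat -> V -> R[i]),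
      spectral_decomposition mu M D lam f /\
      spectral_sum mu (D `&` [set i | l < `|lam i|]) lam f K].

Definition measure_preserving (R : realType) (d : measure_display)
    (V : measurableType d) (mu : probability V R) (psi : V -> V) : Prop :=
  measurable_fun [set: V] psi /\
  forall A, measurable A -> mu (psi @^-1` A) = mu A.

(* Invertibility is modulo null sets. *)
Definition invertible_measure_preserving (R : realType) (d : measure_display)
    (V : measurableType d) (mu : probability V R) (psi : V -> V) : Prop :=
  measure_preserving mu psi /\
  exists phi : V -> V, [/\ measure_preserving mu phi,
    {ae mu, forall x, phi (psi x) = x} & {ae mu, forall x, psi (phi x) = x}].

Definition pullback (R : realType) (d : measure_display)
    (V : measurableType d) (psi : V -> V) (W : V * V -> R[i]) : V * V -> R[i] :=
  fun z => W (psi z.1, psi z.2).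

(* delta_n for a norm nrm on kernels: below nrm is kernel_norm1 mu (n = 1) or
   cut_norm mu (n = square). *)
Definition delta (R : realType) (d : measure_display)
    (V : measurableType d) (mu : probability V R)
    (nrm : (V * V -> R[i]) -> \bar R) (W1 W2 : V * V -> R[i]) : \bar R :=
  ereal_inf [set r | exists psi1 psi2 : V -> V,
    [/\ measure_preserving mu psi1, measure_preserving mu psi2 &
        r = nrm (pullback psi1 W1 \- pullback psi2 W2)]].

Definition delta_by_invertible (R : realType) (d : measure_display)
    (V : measurableType d) (mu : probability V R)
    (nrm : (V * V -> R[i]) -> \bar R) : Prop :=
  forall W1 W2 : V * V -> R[i],
    kernel_operator mu W1 -> kernel_operator mu W2 ->
    delta mu nrm W1 W2 =
      ereal_inf [set r | exists2 psi : V -> V,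
        invertible_measure_preserving mu psi &
        r = nrm (pullback psi W1 \- W2)].

Definition delta_limit (R : realType) (d : measure_display)
    (V : measurableType d) (mu : probability V R)
    (nrm : (V * V -> R[i]) -> \bar R)
    (W : nat -> V * V -> R[i]) (L : V * V -> R[i]) : Prop :=
  kernel_operator mu L /\ delta mu nrm (W i) L @[i --> \oo] --> 0%E.

Definition convergent_truncations (R : realType) (d : measure_display)
    (V : measurableType d) (mu : probability V R)
    (M : nat -> V * V -> R[i]) (alpha : nat -> R) : Prop :=
  [/\ forall j, 0 < alpha j,
      decreasing_seq alpha,
      alpha j @[j --> \oo] --> (0 : R) &
      forall j, exists L, delta_limit mu (kernel_norm1 mu)
                            (fun i => truncation mu (M i) (alpha j)) L].

(* Main.v *)
(** The cut norm is dominated by the operator norm and, on kernels bounded by a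
    constant, conversely: cutting the test functions off at height K shows
    |A| <= K^2 |A|_cut + O(1/K).  So cut convergence of self-adjoint bounded
    kernels is convergence in operator norm, and a perturbation argument
    (an eigenvector of A whose eigenvalue is away from a spectral gap of B lies
    almost in the corresponding spectral subspace of B) shows that truncation
    at a regular level, one that is not the modulus of an eigenvalue, is
    continuous from operator norm to the Hilbert-Schmidt norm, since only
    finitely many eigenvalues exceed the level.  Choosing regular levels of the
    limit gives 1 => 2, and squeezing exceptional levels between regular ones
    gives the formula for the limit.  Conversely [M]_al is within al of M in
    cut norm, so 2 makes (M_i) a delta_cut-Cauchy sequence; after composing
    with invertible maps it is Cauchy in the cut norm itself.  A limit in the
    unit ball of L_oo is found without weak compactness, as the L_2 limit of
    near-minimizers of the norm over decreasing hulls of the tails.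

    The spectral theorem is obtained by splitting off one eigenvector at a
    time; an eigenvector of maximal modulus comes from the limit of the even
    powers of the normalised operator. *)
Require Import Defs.
From HB Require Import structures.
From mathcomp Require Import all_boot all_order all_algebra.
From mathcomp Require Import complex.
From mathcomp Require Import all_classical all_reals all_analysis.
From mathcomp Require Import measurable_realfun ess_sup_inf.
From mathcomp Require Import ring lra zify.

Set Implicit Arguments.
Unset Strict Implicit.
Unset Printing Implicit Defensive.

Import Order.TTheory GRing.Theory Num.Theory.
Import numFieldNormedType.Exports.

Local Open Scope classical_set_scope.
Local Open Scope ring_scope.

(** Eigenvectors do not depend continuously on the operator, so those of A and B are never matched.
    The difference of two truncations is split instead into defects, what is left of an eigenvector
    of one operator after projection onto the selected eigenvectors of the other, and cross terms
    with coefficient (lam_i - mu_j)<f_i, g_j>. The gap makes the defects small, and the cross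
    coefficients are entries of A - B. Since the Hilbert-Schmidt norm is at most 1, the number of
    terms is bounded by powers of 1/al, so the estimate is uniform in B.

    Functions are not identified modulo null sets. Inner products are therefore only semi-definite,
    and exact identities are recovered from a.e. ones by applying an integral operator, which sends
    null functions to 0.

    Completeness of L_2 is needed only for uniformly bounded sequences. Both limits taken are of
    this kind: powers of a bounded kernel, and elements of the unit ball of L_oo. *)

Local Notation nc := ComplexField.Normc.normc.

(** * Inner product spaces *)

Section complex_modulus.
Variable R : realType.
Implicit Types (x y z : R[i]) (r : R).

Lemma normr_nc z : `|z| = (nc z)%:C%C.
Proof. by case: z. Qed.

Lemma nc_ge0 z : 0 <= nc z.
Proof. by rewrite -ler0c -normr_nc. Qed.

Lemma nc0 : nc (0 : R[i]) = 0.
Proof. exact: ComplexField.Normc.normc0. Qed.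

Lemma nc1 : nc (1 : R[i]) = 1.
Proof. exact: ComplexField.Normc.normc1. Qed.

Lemma ncM x y : nc (x * y) = nc x * nc y.
Proof. exact: ComplexField.Normc.normcM. Qed.

Lemma ncD x y : nc (x + y) <= nc x + nc y.
Proof. exact: (@le_normcD _ x y). Qed.

Lemma ncN x : nc (- x) = nc x.
Proof. exact: (@normcN _ x). Qed.

Lemma nc_real r : nc (r%:C%C) = `|r|.
Proof. by rewrite /= expr0n /= addr0 sqrtr_sqr. Qed.

Lemma ncJ z : nc (conjc z) = nc z.
Proof. by case: z => a b /=; rewrite sqrrN. Qed.

Lemma nc_sqr z : nc z ^+ 2 = complex.Re z ^+ 2 + complex.Im z ^+ 2.
Proof. by case: z => a b /=; rewrite sqr_sqrtr ?addr_ge0 ?sqr_ge0. Qed.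

Lemma mulJ_nc z : z * conjc z = (nc z ^+ 2)%:C%C.
Proof.
rewrite nc_sqr; case: z => a b; apply/eqP; rewrite eq_complex /=.
by apply/andP; split; apply/eqP; ring.
Qed.

Lemma Re_le_nc z : complex.Re z <= nc z.
Proof.
rewrite (le_trans (ler_norm _))// -ler_sqr ?nnegrE ?nc_ge0//.
by rewrite real_normK ?num_real// nc_sqr lerDl sqr_ge0.
Qed.

Lemma nc_eq0 z : nc z = 0 -> z = 0.
Proof. exact: ComplexField.Normc.eq0_normc. Qed.

Lemma nc_le_ReIm z : nc z <= `|complex.Re z| + `|complex.Im z|.
Proof.
rewrite -ler_sqr ?nnegrE ?nc_ge0 ?addr_ge0// nc_sqr sqrrD.
rewrite !real_normK ?num_real// -addrA [leRHS]addrCA lerDr; apply: mulrn_wge0.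
by apply: mulr_ge0.
Qed.

Lemma ReD x y : complex.Re (x + y) = complex.Re x + complex.Re y.
Proof. by case: x y => [a b] [c d]. Qed.
Lemma ImD x y : complex.Im (x + y) = complex.Im x + complex.Im y.
Proof. by case: x y => [a b] [c d]. Qed.
Lemma ReN x : complex.Re (- x) = - complex.Re x.
Proof. by case: x. Qed.
Lemma ImN x : complex.Im (- x) = - complex.Im x.
Proof. by case: x. Qed.
Lemma ReM x y : complex.Re (x * y) =
  complex.Re x * complex.Re y - complex.Im x * complex.Im y.
Proof. by case: x y => [a b] [c d]. Qed.
Lemma ImM x y : complex.Im (x * y) =
  complex.Re x * complex.Im y + complex.Im x * complex.Re y.
Proof. by case: x y => [a b] [c d]. Qed.
Lemma ReJ x : complex.Re (conjc x) = complex.Re x.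
Proof. by case: x. Qed.
Lemma ImJ x : complex.Im (conjc x) = - complex.Im x.
Proof. by case: x. Qed.
Lemma ReRM r x : complex.Re (r%:C%C * x) = r * complex.Re x.
Proof. by rewrite ReM /= mul0r subr0. Qed.
Lemma Re_sum I (r : seq I) (P : pred I) (F : I -> R[i]) :
  complex.Re (\sum_(i <- r | P i) F i) = \sum_(i <- r | P i) complex.Re (F i).
Proof. by elim/big_rec2 : _ => // i y x _ <-; rewrite ReD. Qed.

Lemma eqC x y : complex.Re x = complex.Re y -> complex.Im x = complex.Im y -> x = y.
Proof. by case: x y => [a b] [c d] /= -> ->. Qed.

Lemma conjcD x y : conjc (x + y) = conjc x + conjc y.
Proof. exact: rmorphD. Qed.
Lemma conjcM x y : conjc (x * y) = conjc x * conjc y.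
Proof. exact: rmorphM. Qed.
Lemma conjcN x : conjc (- x) = - conjc x.
Proof. exact: rmorphN. Qed.
Lemma conjc_sum I (r : seq I) (P : pred I) (F : I -> R[i]) :
  conjc (\sum_(i <- r | P i) F i) = \sum_(i <- r | P i) conjc (F i).
Proof. exact: rmorph_sum. Qed.
Lemma conjc_realC r : conjc r%:C%C = r%:C%C.
Proof. exact: conjc_real. Qed.

End complex_modulus.

(** Positivity is only semi-definite because the vectors will be functions and not classes modulo
    null sets: [nr u = 0] plays the role of a.e. vanishing. *)
Record semi_inner (R : realType) (H : lmodType R[i]) (ip : H -> H -> R[i]) : Prop :=
  SemiInner {
    siDl : forall u v w, ip (u + v) w = ip u w + ip v w;
    siZl : forall a u v, ip (a *: u) v = a * ip u v;
    siJ : forall u v, ip u v = conjc (ip v u);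
    si_ge0 : forall u, 0 <= complex.Re (ip u u) }.

Section semi_inner_theory.
Variables (R : realType) (H : lmodType R[i]) (ip : H -> H -> R[i]).
Hypothesis hip : semi_inner ip.
Implicit Types (u v w : H) (a : R[i]).

Let ipDl := siDl hip.
Let ipZl := siZl hip.
Let ipJ := siJ hip.
Let ip_ge0 := si_ge0 hip.

Definition sqn u : R := complex.Re (ip u u).
Definition nr u : R := Num.sqrt (sqn u).

Lemma ipDr u v w : ip u (v + w) = ip u v + ip u w.
Proof. by rewrite ipJ ipDl conjcD -(ipJ u v) -(ipJ u w). Qed.
Lemma ipZr a u v : ip u (a *: v) = conjc a * ip u v.
Proof. by rewrite ipJ ipZl conjcM -(ipJ u v). Qed.
Lemma ip0l u : ip 0 u = 0.
Proof. by rewrite -(scale0r u) ipZl mul0r. Qed.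
Lemma ip0r u : ip u 0 = 0.
Proof. by rewrite ipJ ip0l conjc0. Qed.
Lemma ipNl u v : ip (- u) v = - ip u v.
Proof. by rewrite -scaleN1r ipZl mulN1r. Qed.
Lemma ipNr u v : ip u (- v) = - ip u v.
Proof. by rewrite ipJ ipNl conjcN -(ipJ u v). Qed.
Lemma ipBl u v w : ip (u - v) w = ip u w - ip v w.
Proof. by rewrite ipDl ipNl. Qed.
Lemma ipBr u v w : ip u (v - w) = ip u v - ip u w.
Proof. by rewrite ipDr ipNr. Qed.
Lemma ip_suml I (r : seq I) (P : pred I) (F : I -> H) v :
  ip (\sum_(i <- r | P i) F i) v = \sum_(i <- r | P i) ip (F i) v.
Proof. by elim/big_rec2 : _ => [|i y x _ <-]; rewrite ?ip0l ?ipDl. Qed.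
Lemma ip_sumr I (r : seq I) (P : pred I) (F : I -> H) v :
  ip v (\sum_(i <- r | P i) F i) = \sum_(i <- r | P i) ip v (F i).
Proof. by elim/big_rec2 : _ => [|i y x _ <-]; rewrite ?ip0r ?ipDr. Qed.

Lemma ip_sqn u : ip u u = (sqn u)%:C%C.
Proof.
apply: eqC => //=; have := congr1 (@complex.Im R) (ipJ u u); rewrite ImJ => /eqP.
by rewrite -subr_eq0 opprK -mulr2n mulrn_eq0 /= => /eqP.
Qed.

Lemma sqn_ge0 u : 0 <= sqn u. Proof. exact: ip_ge0. Qed.
Lemma nr_ge0 u : 0 <= nr u. Proof. exact: sqrtr_ge0. Qed.
Lemma nr_sqr u : nr u ^+ 2 = sqn u. Proof. by rewrite sqr_sqrtr// sqn_ge0. Qed.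

Lemma sqnZ a u : sqn (a *: u) = nc a ^+ 2 * sqn u.
Proof.
by rewrite /sqn ipZl ipZr mulrA mulJ_nc ReRM.
Qed.

Lemma nrZ a u : nr (a *: u) = nc a * nr u.
Proof. by rewrite /nr sqnZ sqrtrM ?sqr_ge0// sqrtr_sqr ger0_norm ?nc_ge0. Qed.

Lemma nrN u : nr (- u) = nr u.
Proof. by rewrite -scaleN1r nrZ ncN nc1 mul1r. Qed.

Lemma nr0 : nr 0 = 0.
Proof. by rewrite /nr /sqn ip0l /= sqrtr0. Qed.

Lemma nrBC u v : nr (u - v) = nr (v - u).
Proof. by rewrite -nrN opprB. Qed.

Lemma sqnD u v : sqn (u + v) = sqn u + sqn v + 2 * complex.Re (ip u v).
Proof.
rewrite /sqn ipDl !ipDr !ReD (ipJ v u) ReJ; ring.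
Qed.

Lemma sqnB u v : sqn (u - v) = sqn u + sqn v - 2 * complex.Re (ip u v).
Proof.
by rewrite sqnD ipNr ReN mulrN; congr (_ + _ - _); rewrite /sqn ipNl ipNr opprK.
Qed.

(** Cauchy-Schwarz from positivity at [u - t z v] for real [t]; the factor [z] makes the cross term
    real. Since [sqn v] may vanish for nonzero [v], that case is separate: the quadratic in [t]
    becomes an affine function bounded below, which forces [z = 0]. *)
Lemma nc_ip_le u v : nc (ip u v) <= nr u * nr v.
Proof.
set z := ip u v.
have key (t : R) : 0 <= sqn u - 2 * t * nc z ^+ 2 + t ^+ 2 * nc z ^+ 2 * sqn v.
  have := sqn_ge0 (u - (t%:C%C * z) *: v).
  rewrite sqnB sqnZ ipZr conjcM conjc_realC -/z -mulrA ReRM mulrC.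
  rewrite [conjc z * z]mulrC mulJ_nc /= ncM nc_real exprMn real_normK ?num_real//.
  by rewrite mulrA; lra.
rewrite -ler_sqr ?nnegrE ?nc_ge0 ?mulr_ge0 ?nr_ge0// exprMn !nr_sqr.
have := sqn_ge0 v; rewrite le_eqVlt => /predU1P[v0|v0].
  rewrite -v0 mulr0; case: (ltrgtP (nc z ^+ 2) 0) => // zp; last first.
    (* This [t] gives the affine function the value -1. *)
    have /= := key ((sqn u + 1) / (2 * nc z ^+ 2)).
    rewrite -v0 mulr0 addr0.
    have -> : 2 * ((sqn u + 1) / (2 * nc z ^+ 2)) * nc z ^+ 2 = sqn u + 1.
      by field; move: zp; rewrite exprn_even_gt0.
    lra.
have := key (sqn v)^-1.
have -> : (sqn v)^-1 ^+ 2 * nc z ^+ 2 * sqn v = nc z ^+ 2 / sqn v.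
  by field; rewrite gt_eqF.
rewrite -mulrA [_^-1 * _]mulrC => k.
have : nc z ^+ 2 / sqn v <= sqn u by lra.
by rewrite ler_pdivrMr.
Qed.

Lemma nrD u v : nr (u + v) <= nr u + nr v.
Proof.
rewrite -ler_sqr ?nnegrE ?addr_ge0 ?nr_ge0// nr_sqr sqnD sqrrD !nr_sqr.
have := le_trans (Re_le_nc (ip u v)) (nc_ip_le u v); lra.
Qed.

Lemma nrB_trans w u v : nr (u - v) <= nr (u - w) + nr (w - v).
Proof. by apply: le_trans (nrD _ _); rewrite addrA subrK. Qed.

Lemma nr_sum I (r : seq I) (P : pred I) (F : I -> H) :
  nr (\sum_(i <- r | P i) F i) <= \sum_(i <- r | P i) nr (F i).
Proof.
elim/big_rec2 : _ => [|i y x Pi le]; first by rewrite nr0.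
by rewrite (le_trans (nrD _ _))// lerD2l.
Qed.

(** Solved for the difference, so that near-minimizers of the norm over a set closed under midpoints
    are seen to be close to each other. *)
Lemma parallelogram u v :
  sqn (u - v) = 2 * sqn u + 2 * sqn v - 4 * sqn ((2^-1)%:C%C *: (u + v)).
Proof.
rewrite sqnZ nc_real ger0_norm ?invr_ge0// sqnB sqnD; by field.
Qed.

Section orthogonal_family.
Variables (b : pred nat) (f : nat -> H).
Hypothesis orth : forall i j, b i -> b j -> ip (f i) (f j) = (i == j)%:R.

Lemma sqn_orth_sum n (P : pred nat) (c : nat -> R[i]) :
  (forall i, P i -> b i) ->
  sqn (\sum_(i < n | P i) c i *: f i) = \sum_(i < n | P i) nc (c i) ^+ 2.
Proof.
move=> Pb; rewrite /sqn ip_suml Re_sum; apply: eq_bigr => i Pi.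
rewrite ip_sumr (bigD1 i)//= big1 => [|j /andP[Pj ji]].
  by rewrite addr0 ipZl ipZr orth ?Pb// eqxx mulr1 mulJ_nc.
rewrite ipZl ipZr orth ?Pb// (_ : (i : nat) == j = false) ?mulr0 ?mulr0//.
by apply/negbTE; rewrite eq_sym.
Qed.

Lemma bessel n (P : pred nat) u : (forall i, P i -> b i) ->
  \sum_(i < n | P i) nc (ip u (f i)) ^+ 2 <= sqn u.
Proof.
move=> Pb; have := sqn_ge0 (u - \sum_(i < n | P i) ip u (f i) *: f i).
rewrite sqnB (@sqn_orth_sum n P (fun i => ip u (f i)))// ip_sumr Re_sum.
under [X in _ - 2 * X]eq_bigr do rewrite ipZr mulrC mulJ_nc /=.
lra.
Qed.

End orthogonal_family.

End semi_inner_theory.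

(** * Perturbation of spectral truncations *)

Section eigen_expansion.
Variables (R : realType) (H1 H2 : lmodType R[i]).
Variables (ip1 : H1 -> H1 -> R[i]) (ip2 : H2 -> H2 -> R[i]).
Hypotheses (hip1 : semi_inner ip1) (hip2 : semi_inner ip2).
(** [H1] and [H2] stand for L_2(V) and L_2(V x V), and [tens u v] for the rank-one kernel u(x)
    conj(v(y)). Sesquilinearity and [ip_tens] are all that the perturbation theory asks of it. *)
Variable tens : H1 -> H1 -> H2.
Hypothesis tensDl : forall u v w, tens (u + v) w = tens u w + tens v w.
Hypothesis tensZl : forall a u v, tens (a *: u) v = a *: tens u v.
Hypothesis tensDr : forall u v w, tens u (v + w) = tens u v + tens u w.
Hypothesis tensZr : forall a u v, tens u (a *: v) = conjc a *: tens u v.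
Hypothesis ip_tens : forall u v u' v',
  ip2 (tens u v) (tens u' v') = ip1 u u' * conjc (ip1 v v').

Local Notation sqn1 := (sqn ip1).
Local Notation sqn2 := (sqn ip2).
Local Notation nr1 := (nr ip1).
Local Notation nr2 := (nr ip2).

Implicit Types (A B K : H2) (u v : H1) (P : pred nat) (lam : nat -> R).

Lemma tens_suml n (P : pred 'I_n) (F : 'I_n -> H1) v :
  tens (\sum_(i < n | P i) F i) v = \sum_(i < n | P i) tens (F i) v.
Proof.
elim/big_rec2 : _ => [|i y x _ <-]; last by rewrite tensDl.
by rewrite -(scale0r v) tensZl !scale0r.
Qed.

Lemma tens_sumr n (P : pred 'I_n) (F : 'I_n -> H1) v :
  tens v (\sum_(i < n | P i) F i) = \sum_(i < n | P i) tens v (F i).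
Proof.
elim/big_rec2 : _ => [|i y x _ <-]; last by rewrite tensDr.
by rewrite -(scale0r v) tensZr conjc0 !scale0r.
Qed.

Lemma nr_tens u v : nr2 (tens u v) = nr1 u * nr1 v.
Proof.
rewrite /nr /sqn ip_tens (ip_sqn hip1 u) ReRM ReJ sqrtrM//.
exact: sqn_ge0.
Qed.

(* [form A u v] is the paper's [u^* A v]. *)
Definition form A u v : R[i] := ip2 A (tens u v).

Lemma formD A B u v : form (A + B) u v = form A u v + form B u v.
Proof. exact: (siDl hip2). Qed.
Lemma formN A u v : form (- A) u v = - form A u v.
Proof. exact: ipNl. Qed.
Lemma formB A B u v : form (A - B) u v = form A u v - form B u v.
Proof. exact: ipBl. Qed.
Lemma formDr A u v w : form A u (v + w) = form A u v + form A u w.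
Proof. by rewrite /form tensDr ipDr. Qed.
Lemma formZr A u a w : form A u (a *: w) = a * form A u w.
Proof. by rewrite /form tensZr ipZr// conjcK. Qed.
Lemma form_sumr A u n (P : pred 'I_n) (F : 'I_n -> H1) :
  form A u (\sum_(i < n | P i) F i) = \sum_(i < n | P i) form A u (F i).
Proof. by rewrite /form tens_sumr ip_sumr. Qed.
Lemma formDl A u v w : form A (v + w) u = form A v u + form A w u.
Proof. by rewrite /form tensDl ipDr. Qed.

Lemma nc_form A u v : nc (form A u v) <= nr2 A * (nr1 u * nr1 v).
Proof. by rewrite -nr_tens; exact: (nc_ip_le hip2). Qed.

Definition op_bound A (s : R) :=
  forall u v, nc (form A u v) <= s * (nr1 u * nr1 v).

Lemma op_boundB A B s t : op_bound A s -> op_bound B t -> op_bound (A - B) (s + t).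
Proof.
move=> hA hB u v; rewrite formB (le_trans (ncD _ _))// ncN mulrDl.
exact: lerD.
Qed.

Lemma op_boundD A B s t : op_bound A s -> op_bound B t -> op_bound (A + B) (s + t).
Proof.
move=> hA hB u v; rewrite formD (le_trans (ncD _ _))// mulrDl.
exact: lerD.
Qed.

Lemma op_bound_lim A s : (forall e, 0 < e -> op_bound A (s + e)) -> op_bound A s.
Proof.
move=> h u v; have [uv0|uv0] := eqVneq (nr1 u * nr1 v) 0.
  by have := h 1 ltr01 u v; rewrite uv0 !mulr0.
have uvp : 0 < nr1 u * nr1 v by rewrite lt_neqAle eq_sym uv0 mulr_ge0 ?nr_ge0.
rewrite -ler_pdivrMr//; apply/ler_addgt0Pr => e e0.
by rewrite ler_pdivrMr//; exact: h.
Qed.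

Section decomposition.
Variables (b : pred nat) (lam : nat -> R) (f : nat -> H1).

Definition partial P n : H2 :=
  \sum_(i < n | P i) (lam i)%:C%C *: tens (f i) (f i).

Definition sums_to P A :=
  forall e, 0 < e -> exists N, forall n, (N <= n)%N -> nr2 (A - partial P n) < e.

Definition orthonormal_family :=
  forall i j, b i -> b j -> ip1 (f i) (f j) = (i == j)%:R.

Definition eigen_expansion A := orthonormal_family /\ sums_to b A.

Definition above (al : R) : pred nat := fun i => b i && (al < `|lam i|).
Definition below (al : R) : pred nat := fun i => b i && (`|lam i| <= al).

Lemma partial_above_below al n : partial b n = partial (above al) n + partial (below al) n.
Proof.
rewrite /partial (bigID (fun i : 'I_n => al < `|lam i|))/=; congr (_ + _).
by apply: eq_bigl => i; rewrite /below leNgt.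
Qed.

Lemma form_partial P n u v : form (partial P n) u v =
  \sum_(i < n | P i) (lam i)%:C%C * (ip1 (f i) u * conjc (ip1 (f i) v)).
Proof.
rewrite /form ip_suml//; apply: eq_bigr => i _.
by rewrite (siZl hip2) ip_tens.
Qed.

Lemma partialS P n : partial P n.+1 =
  partial P n + (if P n then (lam n)%:C%C *: tens (f n) (f n) else 0).
Proof. by rewrite /partial big_mkcond big_ord_recr /= -big_mkcond. Qed.

Hypothesis orth : orthonormal_family.

Lemma nr_family i : b i -> nr1 (f i) = 1.
Proof. by move=> bi; rewrite /nr /sqn orth// eqxx/= sqrtr1. Qed.

Lemma op_bound_partial P n al : 0 <= al ->
  (forall i, P i -> b i) -> (forall i, P i -> `|lam i| <= al) ->
  op_bound (partial P n) al.
Proof.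
move=> al0 Pb Pal u v.
(* [w] is the image of [u] under the finite-rank operator; Bessel's inequality controls its norm. *)
pose w := \sum_(i < n | P i) ((lam i)%:C%C * ip1 u (f i)) *: f i.
have -> : nc (form (partial P n) u v) = nc (ip1 w v).
  rewrite -ncJ form_partial conjc_sum /w ip_suml//; congr (nc _).
  apply: eq_bigr => i _; rewrite (siZl hip1) !conjcM conjcK.
  by rewrite conjc_realC mulrA -(siJ hip1).
apply: le_trans (nc_ip_le hip1 _ _) _.
rewrite mulrA ler_wpM2r ?nr_ge0// -ler_sqr ?nnegrE ?nr_ge0 ?mulr_ge0 ?nr_ge0//.
rewrite exprMn !nr_sqr// /w (@sqn_orth_sum _ _ _ hip1 b f orth n P (fun i => (lam i)%:C%C * ip1 u (f i)))//.
apply: (@le_trans _ _ (\sum_(i < n | P i) al ^+ 2 * nc (ip1 u (f i)) ^+ 2)).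
  apply: ler_sum => i Pi; rewrite ncM exprMn ler_wpM2r ?sqr_ge0//.
  by rewrite nc_real ler_sqr ?nnegrE//; exact: Pal.
by rewrite -mulr_sumr ler_wpM2l ?sqr_ge0// (bessel hip1 orth).
Qed.

Lemma sqn_partial P n : (forall i, P i -> b i) ->
  sqn2 (partial P n) = \sum_(i < n | P i) lam i ^+ 2.
Proof.
move=> Pb; rewrite /sqn /partial ip_suml// Re_sum; apply: eq_bigr => i Pi.
rewrite ip_sumr// (bigD1 i)//= big1 => [|j /andP[Pj ji]].
  rewrite addr0 (siZl hip2) ipZr// ip_tens conjc_realC orth ?Pb// eqxx.
  by rewrite conjc1 !mulr1 -rmorphM/= expr2.
rewrite (siZl hip2) ipZr// ip_tens orth ?Pb//.
rewrite (_ : (i : nat) == j = false) ?mul0r ?mulr0//.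
by apply/negbTE; rewrite eq_sym.
Qed.

Lemma ip_partial_diff P n m : (forall i, P i -> b i) -> (n <= m)%N ->
  sqn2 (partial P m - partial P n) = sqn2 (partial P m) - sqn2 (partial P n).
Proof.
move=> Pb nm; rewrite !sqn_partial//.
pose Q := fun i => P i && (n <= i)%N.
have -> : partial P m - partial P n = partial Q m.
  apply/eqP; rewrite subr_eq eq_sym addrC; apply/eqP.
  rewrite /partial (@big_ord_widen_cond _ _ _ n m P (fun i => (lam i)%:C%C *: tens (f i) (f i)) nm).
  rewrite (bigID (fun i : 'I_m => (i < n)%N) (fun i : 'I_m => P i))/=.
  by congr (_ + _); apply: eq_bigl => i; rewrite /Q leqNgt.
rewrite sqn_partial; last by move=> i /andP[/Pb].
rewrite (@big_ord_widen_cond _ _ _ n m P (fun i => lam i ^+ 2) nm).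
rewrite [X in _ = X - _](bigID (fun i : 'I_m => (i < n)%N))/=.
rewrite addrC addrK; apply: eq_bigl => i; by rewrite /Q leqNgt.
Qed.

Section expansion_of.
Variable A : H2.
Hypothesis sA : sums_to b A.

Lemma sums_to_nr_le n : nr2 (partial b n) <= nr2 A.
Proof.
apply/ler_addgt0Pr => e e0; have [N hN] := sA e0.
have := hN (maxn N n) (leq_maxl _ _); set m := maxn N n => hm.
apply: (@le_trans _ _ (nr2 (partial b m))).
  apply: ler_wsqrtr.
  rewrite -subr_ge0 -ip_partial_diff ?leq_maxr//; exact: sqn_ge0.
rewrite -[partial b m](subrK A) addrC.
by rewrite (le_trans (nrD hip2 _ _))// addrC [nr2 (_ - A)]nrBC// ltW// addrC ltrD2l.
Qed.

Lemma sum_sqr_eigenvalues n : \sum_(i < n | b i) lam i ^+ 2 <= sqn2 A.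
Proof.
rewrite -sqn_partial// -!nr_sqr// ler_sqr ?nnegrE ?nr_ge0//.
exact: sums_to_nr_le.
Qed.

(** The term of index [i] is the difference of two consecutive partial sums and has norm [|lam i|],
    so convergence of the sums forces the eigenvalues to 0. *)
Lemma eigenvalues_to0 al : 0 < al ->
  exists N, forall i, (N <= i)%N -> b i -> `|lam i| < al.
Proof.
move=> al0; have [|N hN] := sA (e := al / 2); first by rewrite divr_gt0.
exists N => i Ni bi.
have -> : `|lam i| = nr2 (partial b i.+1 - partial b i).
  rewrite partialS bi addrAC subrr add0r nrZ// nr_tens nr_family//.
  by rewrite !mulr1 nc_real.
apply: le_lt_trans (nrB_trans hip2 A _ _) _.
rewrite [ltRHS](splitr al) ltrD ?hN//.
by rewrite nrBC// hN// (leq_trans Ni).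
Qed.

(** Only finitely many indices lie above a positive level, so a truncation can be handled as the
    finite sum of its first [n] terms for any large [n]. *)
Lemma partial_above_stable al : 0 < al ->
  exists N, forall n m, (N <= n)%N -> (N <= m)%N ->
    partial (above al) n = partial (above al) m.
Proof.
move=> al0; have [N hN] := eigenvalues_to0 al0; exists N.
suff h n : (N <= n)%N -> partial (above al) n = partial (above al) N.
  by move=> n m Nn Nm; rewrite !h.
move=> Nn; rewrite /partial (@big_ord_widen_cond _ _ _ N n (above al) (fun i => (lam i)%:C%C *: tens (f i) (f i)) Nn).
apply: eq_bigl => i; have [//|iN] := ltnP i N; first by rewrite andbT.
rewrite andbF /above; apply/negbTE/negP => /andP[bi].
by rewrite ltNge ltW// hN.
Qed.

Lemma op_bound_tail al K : 0 < al -> sums_to (above al) K -> op_bound (A - K) al.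
Proof.
move=> al0 sK; apply: op_bound_lim => e e0.
have [|N hN] := sA (e := e / 2); first by rewrite divr_gt0.
have [|N' hN'] := sK (e / 2); first by rewrite divr_gt0.
pose n := maxn N N'.
(* The two bracketed differences are small in Hilbert-Schmidt norm; the remaining finite sum carries
   only eigenvalues of modulus at most [al]. *)
have -> : A - K = (A - partial b n) - (K - partial (above al) n) + partial (below al) n.
  rewrite (partial_above_below al); set T := partial (above _) _.
  rewrite opprB opprD !addrA (addrAC _ (- K)); congr (_ - _).
  by rewrite (addrAC _ T) !subrK.
rewrite addrC [al + e]addrC {1}(splitr e) addrC.
apply: op_boundD; last first.
  apply: op_bound_partial; [exact: ltW|by move=> i /andP[]|by move=> i /andP[]].
apply: op_boundB.
  move=> u v; rewrite (le_trans (nc_form _ _ _))// ler_wpM2r ?mulr_ge0 ?nr_ge0//.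
  by rewrite ltW// hN// leq_maxl.
move=> u v; rewrite (le_trans (nc_form _ _ _))// ler_wpM2r ?mulr_ge0 ?nr_ge0//.
by rewrite ltW// hN'// leq_maxr.
Qed.

Lemma form_partial_eigenr P n j u : (forall i, P i -> b i) -> (j < n)%N -> P j ->
  form (partial P n) u (f j) = (lam j)%:C%C * ip1 (f j) u.
Proof.
move=> Pb jn Pj; rewrite form_partial (bigD1 (Ordinal jn))//= big1.
  by rewrite addr0 orth ?Pb// eqxx conjc1 mulr1.
move=> i /andP[Pi ij]; rewrite orth ?Pb// (_ : (i : nat) == j = false) ?conjc0 ?mulr0//.
by apply: contra_neqF ij => /eqP ij; apply/val_inj.
Qed.

Lemma form_partial_eigenl P n j u : (forall i, P i -> b i) -> (j < n)%N -> P j ->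
  form (partial P n) (f j) u = (lam j)%:C%C * conjc (ip1 (f j) u).
Proof.
move=> Pb jn Pj; rewrite form_partial (bigD1 (Ordinal jn))//= big1.
  by rewrite addr0 orth ?Pb// eqxx mul1r.
move=> i /andP[Pi ij]; rewrite orth ?Pb// (_ : (i : nat) == j = false) ?mul0r ?mulr0//.
by apply: contra_neqF ij => /eqP ij; apply/val_inj.
Qed.

Lemma form_lim u v c N : (forall n, (N <= n)%N -> form (partial b n) u v = c) ->
  form A u v = c.
Proof.
move=> h; apply/eqP; rewrite -subr_eq0; apply/eqP/nc_eq0/eqP.
rewrite eq_le nc_ge0 andbT; set z := nr1 u * nr1 v.
have z0 : 0 <= z by rewrite mulr_ge0 ?nr_ge0.
apply/ler_addgt0Pr => e e0.
(* The denominator is [z + 1] because [z] may vanish. *)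
have [|N' hN'] := sA (e := e / (z + 1)); first by rewrite divr_gt0// ltr_wpDl.
pose n := maxn N N'.
rewrite -(h n) ?leq_maxl// -formB add0r (le_trans (nc_form _ _ _))//.
apply: (@le_trans _ _ (e / (z + 1) * z)).
  by rewrite ler_wpM2r// ltW// hN' ?leq_maxr.
rewrite mulrAC ler_pdivrMr ?ltr_wpDl// ler_wpM2l ?ltW//.
by rewrite ltrDl.
Qed.

Lemma form_eigenr j u : b j -> form A u (f j) = (lam j)%:C%C * ip1 (f j) u.
Proof.
move=> bj; apply: (@form_lim _ _ _ j.+1) => n jn.
by rewrite form_partial_eigenr.
Qed.

Lemma form_eigenl j u : b j -> form A (f j) u = (lam j)%:C%C * conjc (ip1 (f j) u).
Proof.
move=> bj; apply: (@form_lim _ _ _ j.+1) => n jn.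
by rewrite form_partial_eigenl.
Qed.

(** Each term is at most [lam i ^+ 2 / al], and the squares add up to at most 1. The bound involves
    neither [n] nor the kernel, which is what makes the stability constant uniform. *)
Lemma sum_above_le al n : 0 < al -> nr2 A <= 1 ->
  \sum_(i < n | above al i) `|lam i| <= al^-1.
Proof.
move=> al0 A1; rewrite -[leRHS]mulr1.
apply: (@le_trans _ _ (al^-1 * \sum_(i < n | b i) lam i ^+ 2)).
  rewrite mulr_sumr [leRHS](bigID (fun i : 'I_n => al < `|lam i|))/=.
  rewrite -[leLHS]addr0 lerD//; last first.
    by apply: sumr_ge0 => i _; rewrite mulr_ge0 ?sqr_ge0// invr_ge0 ltW.
  apply: ler_sum => i /andP[_ /ltW ali]; rewrite mulrC ler_pdivlMr//.
  by rewrite -[lam i ^+ 2]real_normK ?num_real// expr2 ler_wpM2l.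
apply: ler_wpM2l; first by rewrite invr_ge0 ltW.
apply: le_trans (sum_sqr_eigenvalues _) _.
by rewrite -nr_sqr// expr_le1 ?nr_ge0.
Qed.

Lemma card_above_le al n : 0 < al -> nr2 A <= 1 ->
  \sum_(i < n | above al i) 1 <= al^-1 ^+ 2.
Proof.
move=> al0 A1; rewrite expr2.
apply: (@le_trans _ _ (al^-1 * \sum_(i < n | above al i) `|lam i|)).
  rewrite mulr_sumr; apply: ler_sum => i /andP[_ /ltW ali].
  by rewrite mulrC ler_pdivlMr// mul1r.
by apply: ler_wpM2l; [rewrite invr_ge0 ltW|exact: sum_above_le].
Qed.

End expansion_of.
End decomposition.

Section spectral_stability.
Variables (b c : pred nat) (lam mu : nat -> R) (f g : nat -> H1) (A B : H2).
Hypotheses (onf : orthonormal_family b f) (ong : orthonormal_family c g).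
Hypotheses (sA : sums_to lam f b A) (sB : sums_to mu g c B).
Hypotheses (A1 : nr2 A <= 1) (B1 : nr2 B <= 1).

Definition proj n P (h : nat -> H1) u : H1 := \sum_(j < n | P j) ip1 u (h j) *: h j.

Lemma proj_defect_orth n P (h : nat -> H1) (d : pred nat) u j :
  orthonormal_family d h -> (forall i, P i -> d i) ->
  (j < n)%N -> P j -> ip1 (u - proj n P h u) (h j) = 0.
Proof.
move=> oh Pd jn Pj; rewrite ipBl// ip_suml// (bigD1 (Ordinal jn))//= big1.
  by rewrite addr0 (siZl hip1) oh ?Pd// eqxx mulr1 subrr.
move=> i /andP[Pi ij]; rewrite (siZl hip1) oh ?Pd//.
rewrite (_ : (i : nat) == j = false) ?mulr0//.
by apply: contra_neqF ij => /eqP ij; apply/val_inj.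
Qed.

Lemma proj_defect_sqn n P (h : nat -> H1) (d : pred nat) u :
  orthonormal_family d h -> (forall i, P i -> d i) ->
  ip1 u (u - proj n P h u) = (sqn1 (u - proj n P h u))%:C%C.
Proof.
move=> oh Pd; rewrite -(ip_sqn hip1) [in RHS]ipBl//.
rewrite (_ : ip1 (proj n P h u) _ = 0) ?subr0// ip_suml// big1// => i Pi.
by rewrite (siZl hip1) (siJ hip1 (h i)) (proj_defect_orth _ oh)// conjc0 mulr0.
Qed.

(* An eigenvector of [A] is almost fixed by the spectral projection of [B] on
   its eigenvalues of modulus [> al], with a defect controlled by the gap. *)
Lemma proj_defect (al d e : R) n i : 0 < al -> 0 < d -> op_bound (A - B) e -> b i ->
  al + d <= `|lam i| -> op_bound (B - partial mu g (above c mu al) n) al ->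
  nr1 (f i - proj n (above c mu al) g (f i)) <= e / d.
Proof.
move=> al0 d0 AB bi ali Btail; set P := above c mu al.
set u := f i - _; set T := partial mu g P n in Btail *.
have Pc j : P j -> c j by case/andP.
have fE : f i = u + proj n P g (f i) by rewrite subrK.
have Tu v : form T u v = 0.
  rewrite form_partial big1// => j Pj.
  by rewrite (siJ hip1 (g j)) (proj_defect_orth _ ong)// conjc0 mul0r mulr0.
(* A vector [g j] with [P j] is an eigenvector of [B] and of [T] for the same eigenvalue, so [B - T]
   does not see the projected part of [f i]. *)
have BTu : form (B - T) u (f i) = form (B - T) u u.
  rewrite {1}fE formDr form_sumr big1 ?addr0// => j Pj.
  rewrite formZr formB (form_eigenr ong sB) ?Pc// (form_partial_eigenr mu ong)//.
  by rewrite subrr mulr0.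
have lamE : form A u (f i) = (lam i * sqn1 u)%:C%C.
  by rewrite (form_eigenr onf sA)// (proj_defect_sqn _ _ ong)// -rmorphM.
(* [A] is split as [A - B], [B - T] and [T], and [T] vanishes on [u]. The gap absorbs the term with
   factor [al] and leaves [d |u|^2 <= e |u|]. *)
have key : `|lam i| * nr1 u ^+ 2 <= e * nr1 u + al * nr1 u ^+ 2.
  rewrite nr_sqr// -{1}[sqn1 u]ger0_norm ?sqn_ge0// -normrM -nc_real -lamE.
  have -> : form A u (f i) = form (A - B) u (f i) + form (B - T) u u.
    by rewrite -BTu !formB Tu subr0 subrK.
  rewrite (le_trans (ncD _ _))// lerD//.
    by have := AB u (f i); rewrite (nr_family onf)// mulr1.
  by rewrite (le_trans (Btail u u))// -expr2 nr_sqr.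
have u0 := nr_ge0 ip1 u; rewrite ler_pdivlMr//.
have [->|un0] := eqVneq (nr1 u) 0.
  by rewrite mul0r; have := le_trans (nc_ge0 _) (AB (f i) (f i));
     rewrite (nr_family onf)// !mulr1.
have up : 0 < nr1 u by rewrite lt_neqAle eq_sym un0.
rewrite -(ler_pM2r up) -mulrA [d * _]mulrC mulrA -expr2 mulrC.
have : (al + d) * nr1 u ^+ 2 <= `|lam i| * nr1 u ^+ 2 by rewrite ler_wpM2r ?sqr_ge0.
lra.
Qed.

End spectral_stability.

Lemma eq_partial lam (f : nat -> H1) P (Q : pred nat) n : P =1 Q ->
  partial lam f P n = partial lam f Q n.
Proof. by move=> PQ; apply: eq_bigl => i; rewrite PQ. Qed.

(** With [u i] and [v j] the projection defects, the difference is a sum of [tens (u i) (f i)]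
    weighted by [lam i], minus one of [tens (g j) (v j)] weighted by [mu j], plus cross terms whose
    coefficient [(lam i - mu j) <f i, g j>] is the form of [A - B] at [g j] and [f i]. Defects are
    at most [e / d] with weights of total modulus at most [al^-1] in each family; the cross terms
    number at most [al^-1 ^+ 4], each at most [e]. *)
Lemma partial_stability (b c : pred nat) lam mu (f g : nat -> H1) A B
    (al d e : R) n :
  orthonormal_family b f -> orthonormal_family c g ->
  sums_to lam f b A -> sums_to mu g c B -> nr2 A <= 1 -> nr2 B <= 1 ->
  0 < d -> d < al -> 0 <= e ->
  (forall i, b i -> al + d <= `|lam i| \/ `|lam i| <= al - d) ->
  op_bound (A - B) e ->
  op_bound (A - partial lam f (above b lam al) n) (al - d) ->
  op_bound (B - partial mu g (above c mu al) n) al ->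
  nr2 (partial lam f (above b lam al) n - partial mu g (above c mu al) n)
    <= (2 * (al^-1 / d) + (al^-1 ^+ 2) ^+ 2) * e.
Proof.
move=> onf ong sA sB A1 B1 d0 dal e0 gap AB Atail Btail.
have al0 : 0 < al := lt_trans d0 dal.
set P := above b lam al; set Q := above c mu al.
have Pb i : P i -> b i by case/andP.
have Qc i : Q i -> c i by case/andP.
pose u (i : 'I_n) := f i - proj n Q g (f i).
pose v (j : 'I_n) := g j - proj n P f (g j).
have uP (i : 'I_n) : P i -> nr1 (u i) <= e / d.
  move=> Pi; apply: (@proj_defect b c lam mu f g A B onf ong sA sB al) => //.
    exact: Pb.
  case/andP: Pi => bi ali; have [//|ali'] := gap _ bi.
  by move: (lt_le_trans ali ali'); rewrite ltrBrDl gtrDr ltNge ltW.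
have vP (j : 'I_n) : Q j -> nr1 (v j) <= e / d.
  (* By the gap, the level [al - d] selects the same eigenvalues of [A] as [al]. Seen from that
     level, the eigenvalues of [B] above [al] have a margin [d], and [proj_defect] applies with [A]
     and [B] exchanged. *)
  have PE : above b lam (al - d) =1 P.
    move=> i; rewrite /P /above; case bi: (b i) => //=.
    have [ali|ali] := gap _ bi.
      rewrite !(lt_le_trans _ ali)//; first by rewrite ltrDl.
      by rewrite ltrD2l gtrN.
    by rewrite !ltNge ali (le_trans ali)// gerBl ltW.
  move=> Qj; rewrite /v.
  have -> : proj n P f (g j) = proj n (above b lam (al - d)) f (g j).
    by apply: eq_bigl => i; rewrite PE.
  apply: (@proj_defect c b mu lam g f B A ong onf sB sA (al - d)) => //.
  - by rewrite subr_gt0.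
  - move=> x y; rewrite -[B - A]opprB formN ncN; exact: AB.
  - exact: Qc.
  - by rewrite subrK; case/andP: Qj => _ /ltW.
  - by rewrite (eq_partial _ _ _ PE).
have cP (i j : 'I_n) : P i -> Q j ->
    nc ((lam i - mu j)%:C%C * ip1 (f i) (g j)) <= e.
  move=> Pi Qj.
  have -> : (lam i - mu j)%:C%C * ip1 (f i) (g j) = form (A - B) (g j) (f i).
    rewrite formB (form_eigenr onf sA (g j) (Pb _ Pi)).
    rewrite (form_eigenl ong sB (f i) (Qc _ Qj)) -(siJ hip1).
    by rewrite rmorphB /= mulrBl.
  have := AB (g j) (f i).
  by rewrite (nr_family onf (Pb _ Pi)) (nr_family ong (Qc _ Qj)) !mulr1.
have -> : partial lam f P n - partial mu g Q n =
    \sum_(i < n | P i) (lam i)%:C%C *: tens (u i) (f i)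
    - \sum_(j < n | Q j) (mu j)%:C%C *: tens (g j) (v j)
    + \sum_(i < n | P i) \sum_(j < n | Q j)
        ((lam i - mu j)%:C%C * ip1 (f i) (g j)) *: tens (g j) (f i).
  have -> : partial lam f P n =
      \sum_(i < n | P i) (lam i)%:C%C *: tens (u i) (f i) +
      \sum_(i < n | P i) \sum_(j < n | Q j)
        ((lam i)%:C%C * ip1 (f i) (g j)) *: tens (g j) (f i).
    rewrite -big_split/=; apply: eq_bigr => i Pi.
    rewrite -[in tens (f i)](subrK (proj n Q g (f i)) (f i)) tensDl scalerDr.
    rewrite -/(u i); congr (_ + _); rewrite tens_suml scaler_sumr.
    by apply: eq_bigr => j Qj; rewrite tensZl scalerA.
  have -> : partial mu g Q n =
      \sum_(j < n | Q j) (mu j)%:C%C *: tens (g j) (v j) +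
      \sum_(i < n | P i) \sum_(j < n | Q j)
        ((mu j)%:C%C * ip1 (f i) (g j)) *: tens (g j) (f i).
    rewrite exchange_big/= -big_split/=; apply: eq_bigr => j Qj.
    rewrite -[in X in tens _ X](subrK (proj n P f (g j)) (g j)) tensDr scalerDr.
    rewrite -/(v j); congr (_ + _); rewrite tens_sumr scaler_sumr.
    by apply: eq_bigr => i Pi; rewrite tensZr -(siJ hip1) scalerA.
  rewrite opprD addrACA; congr (_ + _).
  rewrite -sumrB; apply: eq_bigr => i Pi; rewrite -sumrB.
  by apply: eq_bigr => j Qj; rewrite -scalerBl -mulrBl -rmorphB.
rewrite (le_trans (nrD hip2 _ _))// mulrDl; apply: lerD.
  rewrite (le_trans (nrD hip2 _ _))// nrN// mulr2n mulrDl mul1r mulrDl.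
  have ed : 0 <= e / d by rewrite divr_ge0// ltW.
  have -> : al^-1 / d * e = al^-1 * (e / d) by rewrite -mulrA [d^-1 * e]mulrC.
  apply: lerD.
    apply: le_trans (nr_sum hip2 _ _ _) _.
    apply: (@le_trans _ _ ((\sum_(i < n | P i) `|lam i|) * (e / d))).
      rewrite mulr_suml; apply: ler_sum => i Pi.
      rewrite nrZ// nc_real nr_tens (nr_family onf (Pb _ Pi)) mulr1.
      by rewrite ler_wpM2l// uP.
    by rewrite ler_wpM2r// (sum_above_le onf sA).
  apply: le_trans (nr_sum hip2 _ _ _) _.
  apply: (@le_trans _ _ ((\sum_(i < n | Q i) `|mu i|) * (e / d))).
    rewrite mulr_suml; apply: ler_sum => i Pi.
    rewrite nrZ// nc_real nr_tens (nr_family ong (Qc _ Pi)) mul1r.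
    by rewrite ler_wpM2l// vP.
  by rewrite ler_wpM2r// (sum_above_le ong sB).
apply: le_trans (nr_sum hip2 _ _ _) _.
apply: (@le_trans _ _ ((\sum_(i < n | P i) 1) * (al^-1 ^+ 2 * e))).
  rewrite mulr_suml; apply: ler_sum => i Pi; rewrite mul1r.
  apply: le_trans (nr_sum hip2 _ _ _) _.
  apply: (@le_trans _ _ ((\sum_(i < n | Q i) 1) * e)).
    rewrite mulr_suml; apply: ler_sum => j Qj; rewrite mul1r.
    rewrite nrZ// nr_tens (nr_family onf (Pb _ Pi)) (nr_family ong (Qc _ Qj)).
    by rewrite !mulr1 cP.
  by rewrite ler_wpM2r// (card_above_le ong sB).
rewrite [(_ ^+ 2) ^+ 2]expr2 -mulrA ler_wpM2r ?(card_above_le onf sA)//.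
by rewrite mulr_ge0// sqr_ge0.
Qed.

(** Past some index [N] all moduli are below [x]. The interval from [x] to [y] is halved once for
    each of the first [N] indices so as to leave its modulus out. Then [al] is the midpoint of what
    remains and [d] half its length, whence [al - d >= x > 0]. *)
Lemma gap_exists (b : pred nat) lam (f : nat -> H1) A (x y : R) :
  orthonormal_family b f -> sums_to lam f b A -> 0 < x -> x < y ->
  exists al d : R, [/\ x < al, al < y, 0 < d, d < al &
    forall i, b i -> al + d <= `|lam i| \/ `|lam i| <= al - d].
Proof.
move=> onf sA x0 xy; have [N hN] := eigenvalues_to0 onf sA x0.
suff [x' [y' [xx' xy' yy' h]]] : exists x' y', [/\ x <= x', x' < y', y' <= y &
    forall i, (i < N)%N -> y' <= `|lam i| \/ `|lam i| <= x'].
  exists ((x' + y') / 2), ((y' - x') / 2); split; try lra.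
  move=> i bi; have [iN|Ni] := ltnP i N.
    by have [?|?] := h _ iN; [left|right]; lra.
  by right; have := hN _ Ni bi; lra.
elim: N {hN} => [|N [x' [y' [xx' xy' yy' h]]]]; first by exists x, y; split.
have [lN|lN] := leP `|lam N| ((x' + y') / 2).
  exists ((x' + y') / 2), y'; split; try lra.
  move=> i; rewrite ltnS leq_eqVlt => /predU1P[->|iN]; first by right.
  by have [?|?] := h _ iN; [left|right; lra].
exists x', ((x' + y') / 2); split; try lra.
move=> i; rewrite ltnS leq_eqVlt => /predU1P[->|iN]; first by left; lra.
by have [?|?] := h _ iN; [left; lra|right].
Qed.

Lemma sums_to_ext lam (f : nat -> H1) P A A' : sums_to lam f P A ->
  nr2 (A - A') = 0 -> sums_to lam f P A'.
Proof.
move=> h AA e e0; have [N hN] := h e e0; exists N => n /hN; apply: le_lt_trans.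
by rewrite (le_trans (nrB_trans hip2 A _ _))// nrBC// AA add0r.
Qed.

Section truncations.
Variables (b : pred nat) (lam : nat -> R) (f : nat -> H1) (A : H2).
Hypothesis eA : eigen_expansion b lam f A.

Lemma sums_to_above (al : R) : 0 < al -> exists N, forall n, (N <= n)%N ->
  sums_to lam f (above b lam al) (partial lam f (above b lam al) n).
Proof.
move=> al0; have [N hN] := partial_above_stable eA.1 eA.2 al0.
exists N => n Nn e e0; exists N => m Nm.
by rewrite (hN _ m)// subrr nr0.
Qed.

Lemma sums_to_unique P K K' : sums_to lam f P K -> sums_to lam f P K' ->
  nr2 (K - K') = 0.
Proof.
move=> hK hK'; apply/eqP; rewrite eq_le nr_ge0 andbT; apply/ler_addgt0Pr => e e0.
have e2 : 0 < e / 2 by rewrite divr_gt0.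
have [N hN] := hK _ e2; have [N' hN'] := hK' _ e2.
have h1 := hN (maxn N N') (leq_maxl _ _); have h2 := hN' (maxn N N') (leq_maxr _ _).
rewrite add0r; apply: le_trans (nrB_trans hip2 (partial lam f P (maxn N N')) _ _) _.
by move: h2; rewrite nrBC// => h2; move: h1 h2; lra.
Qed.

Lemma sqn_partial_le P (Q : pred nat) n : (forall i, P i -> Q i) -> (forall i, Q i -> b i) ->
  sqn2 (partial lam f P n) <= sqn2 (partial lam f Q n).
Proof.
move=> PQ Qb; rewrite !(sqn_partial _ eA.1)//; last by move=> i /PQ/Qb.
rewrite big_mkcond [leRHS]big_mkcond /=; apply: ler_sum => i _.
case: ifPn => [/PQ ->//|_]; by case: ifP => // _; exact: sqr_ge0.
Qed.

Lemma partialB P (Q : pred nat) n : (forall i, Q i -> P i) ->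
  partial lam f P n - partial lam f Q n = partial lam f (fun i => P i && ~~ Q i) n.
Proof.
move=> QP; apply/eqP; rewrite subr_eq addrC; apply/eqP.
rewrite /partial (bigID (fun i : 'I_n => Q i))/=; congr (_ + _).
by apply: eq_bigl => i; case: (boolP (Q i)) => [/QP ->//|_]; rewrite andbF.
Qed.

(** The eigenvalues between [al] and [ga] are among those between [be] and [ga], and the squared
    norm of a partial sum is the sum of the squared eigenvalues. *)
Lemma truncation_near_level (al be ga : R) K Kb Kg :
  0 < be -> be < al -> al < ga ->
  sums_to lam f (above b lam al) K -> sums_to lam f (above b lam be) Kb ->
  sums_to lam f (above b lam ga) Kg -> nr2 (K - Kg) <= nr2 (Kb - Kg).
Proof.
move=> be0 beal alga hK hKb hKg.
have al0 := lt_trans be0 beal; have ga0 := lt_trans al0 alga.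
have [N1 h1] := sums_to_above al0; have [N2 h2] := sums_to_above be0.
have [N3 h3] := sums_to_above ga0.
pose n := maxn N1 (maxn N2 N3).
have {}h1 := h1 n (leq_maxl _ _).
have {}h2 := h2 n (leq_trans (leq_maxl _ _) (leq_maxr _ _)).
have {}h3 := h3 n (leq_trans (leq_maxr _ _) (leq_maxr _ _)).
have near0 (u u' v v' : H2) : nr2 (u - u') = 0 -> nr2 (v - v') = 0 ->
    nr2 (u - v) <= nr2 (u' - v').
  move=> uu vv; rewrite (le_trans (nrB_trans hip2 u' _ _))// uu add0r.
  by rewrite (le_trans (nrB_trans hip2 v' _ _))// [nr2 (v' - v)]nrBC// vv addr0.
have eK := sums_to_unique hK h1; have eKb := sums_to_unique h2 hKb.
have eKg := sums_to_unique hKg h3; have eKg' := sums_to_unique h3 hKg.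
apply: le_trans (near0 _ _ _ _ eK eKg) _; apply: le_trans (near0 _ _ _ _ eKb eKg').
have sub (x y : R) i : x <= y -> above b lam y i -> above b lam x i.
  by move=> xy /andP[bi yi]; rewrite /above bi (le_lt_trans xy yi).
rewrite !partialB; [|by move=> i; apply: sub; lra..].
apply: ler_wsqrtr; apply: sqn_partial_le => [i|i /andP[/andP[]]//].
move=> /andP[i1 i2]; apply/andP; split; last exact: i2.
exact: (sub be _ _ (ltW beal) i1).
Qed.

Lemma truncation_to (x : R) : 0 < x -> exists2 al0 : R, 0 < al0 &
  forall al K, 0 < al -> al < al0 -> sums_to lam f (above b lam al) K ->
    nr2 (A - K) <= x.
Proof.
move=> x0; have x4 : 0 < x / 4 by rewrite divr_gt0.
have [N hN] := eA.2 _ x4.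
(* Below the least nonzero modulus among the first [N] indices, a truncation drops only zero
   eigenvalues of these; everything else it drops lies in the tail past [N]. *)
have [al0 al00 hal] : exists2 al0 : R, 0 < al0 & forall i, (i < N)%N -> lam i != 0 ->
    al0 <= `|lam i|.
  elim: N {hN} => [|N [a a0 ha]]; first by exists 1.
  exists (if lam N == 0 then a else Num.min a `|lam N|).
    by case: ifPn => // l0; rewrite lt_min a0 normr_gt0.
  move=> i; rewrite ltnS leq_eqVlt => /predU1P[-> /negbTE ->|iN l0].
    by rewrite ge_min lexx orbT.
  by case: ifPn => _; rewrite ?ge_min ha.
exists al0 => // al K alp alal0 hK.
have [N' hN'] := hK _ x4.
pose n := maxn N N'.
have h1 := hN n (leq_maxl _ _); have h2 := hN' n (leq_maxr _ _).
have E : partial lam f b n - partial lam f (above b lam al) n = partial lam f (below b lam al) n.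
  by rewrite (partial_above_below b lam f al n) addrAC subrr add0r.
have h3 : nr2 (partial lam f (below b lam al) n) <= nr2 (partial lam f b n - partial lam f b N).
  apply: ler_wsqrtr; rewrite (ip_partial_diff lam eA.1)//; last exact: leq_maxl.
  rewrite !(sqn_partial _ eA.1)//; last by move=> i /andP[].
  rewrite (@big_ord_widen_cond _ _ _ N n b (fun i => lam i ^+ 2) (leq_maxl _ _)).
  rewrite [X in _ <= X - _](bigID (fun i : 'I_n => (i < N)%N))/= addrC addrK.
  rewrite big_mkcond [leRHS]big_mkcond /=; apply: ler_sum => i _.
  rewrite /below; case: (b i) => //=; case: ifPn => li; case: ifPn => Ni //.
    rewrite negbK in Ni; have [->|l0] := eqVneq (lam i) 0; first by rewrite expr0n.
    by have := le_trans (hal i Ni l0) li; rewrite leNgt alal0.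
  exact: sqr_ge0.
have h4 : nr2 (partial lam f b n - partial lam f b N) <= x / 2.
  apply: le_trans (nrB_trans hip2 A _ _) _; have := hN N (leqnn _).
  by move: h1; rewrite nrBC// => h1 h1'; move: h1 h1'; lra.
apply: le_trans (nrB_trans hip2 (partial lam f b n) _ _) _.
have : nr2 (partial lam f b n - K) <= x / 2 + x / 4.
  apply: le_trans (nrB_trans hip2 (partial lam f (above b lam al) n) _ _) _.
  rewrite E; apply: lerD; first exact: le_trans h3 h4.
  by rewrite nrBC// ltW.
by move: h1; lra.
Qed.

(** [C] is chosen before [B], so that it serves along a whole sequence converging to [A]. *)
Lemma truncation_lipschitz (al d : R) : nr2 A <= 1 -> 0 < d -> d < al ->
  (forall i, b i -> al + d <= `|lam i| \/ `|lam i| <= al - d) ->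
  exists2 C : R, 0 < C & forall B c mu g K K' e, eigen_expansion c mu g B ->
    nr2 B <= 1 -> 0 <= e -> op_bound (A - B) e ->
    sums_to lam f (above b lam al) K -> sums_to mu g (above c mu al) K' ->
    nr2 (K - K') <= C * e.
Proof.
move=> A1 d0 dal gap; have al0 := lt_trans d0 dal.
exists (2 * (al^-1 / d) + (al^-1 ^+ 2) ^+ 2).
  by rewrite addr_gt0// ?mulr_gt0// ?invr_gt0 ?exprn_gt0 ?invr_gt0.
move=> B c mu g K K' e eB B1 e0 AB hK hK'.
have PE : above b lam (al - d) =1 above b lam al.
  move=> i; rewrite /above; case bi: (b i) => //=.
  have [ali|ali] := gap _ bi.
    rewrite !(lt_le_trans _ ali)//; first by rewrite ltrDl.
    by rewrite ltrD2l gtrN.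
  by rewrite !ltNge ali (le_trans ali)// gerBl ltW.
have ald : 0 < al - d by rewrite subr_gt0.
(* Both truncations are replaced by partial sums with a common number [n] of terms, at distance 0
   from them. *)
have [N1 h1] := sums_to_above al0.
have [N2 h2] := partial_above_stable eB.1 eB.2 al0.
pose n := maxn N1 N2; have {}h1 := h1 n (leq_maxl _ _).
have sB : sums_to mu g (above c mu al) (partial mu g (above c mu al) n).
  move=> x x0; exists N2 => m Nm; rewrite (h2 n m) ?leq_maxr// subrr nr0//.
have e1 := sums_to_unique hK h1.
have e2 : nr2 (K' - partial mu g (above c mu al) n) = 0.
  apply/eqP; rewrite eq_le nr_ge0 andbT; apply/ler_addgt0Pr => x x0.
  have [M hM] := hK' _ x0; have := hM (maxn M N2) (leq_maxl _ _).
  by rewrite (h2 _ n) ?leq_maxr// add0r => /ltW.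
apply: le_trans (nrB_trans hip2 (partial lam f (above b lam al) n) _ _) _.
rewrite e1 add0r; apply: le_trans (nrB_trans hip2 (partial mu g (above c mu al) n) _ _) _.
rewrite [nr2 (_ - K')]nrBC// e2 addr0.
apply: (@partial_stability b c lam mu f g A B al d e n eA.1 eB.1 eA.2 eB.2) => //.
  apply: (op_bound_tail eA.1 eA.2 ald).
  move=> x /h1[M hM]; exists M => m /hM.
  by rewrite (eq_partial _ _ m PE).
exact: (op_bound_tail eB.1 eB.2 al0 sB).
Qed.

End truncations.

(* Exceptional levels [al] (moduli of eigenvalues of [A]) are handled by
   squeezing between two regular ones. *)
Lemma truncation_continuity (b : pred nat) lam (f : nat -> H1) A (x : R) :
  eigen_expansion b lam f A -> nr2 A <= 1 -> 0 < x ->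
  exists2 al0 : R, 0 < al0 & forall al, 0 < al -> al < al0 ->
    exists2 e : R, 0 < e & forall B c mu g K', eigen_expansion c mu g B ->
      nr2 B <= 1 -> op_bound (A - B) e ->
      sums_to mu g (above c mu al) K' -> nr2 (K' - A) <= x.
Proof.
(* Six distances are added at the end: two between [Bg] and [A], and four between [Bb] and [Bg],
   which bound that of [K'] to [Bg]. Each is at most [x / 7]. *)
move=> eA A1 x0; have x7 : 0 < x / 7 by rewrite divr_gt0.
have [al0 al00 hal0] := truncation_to eA x7; exists al0 => // al alp alal0.
have [ga [dg [g1 g2 dg0 dgg gapg]]] := gap_exists eA.1 eA.2 alp alal0.
have al2 : 0 < al / 2 by rewrite divr_gt0.
have al2al : al / 2 < al by lra.
have [be [db [b1 b2 db0 dbb gapb]]] := gap_exists eA.1 eA.2 al2 al2al.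
have be0 := lt_trans al2 b1; have ga0 := lt_trans alp g1.
have [Cg Cg0 hCg] := truncation_lipschitz eA A1 dg0 dgg gapg.
have [Cb Cb0 hCb] := truncation_lipschitz eA A1 db0 dbb gapb.
exists (Num.min (x / 7 / Cg) (x / 7 / Cb)); first by rewrite lt_min !divr_gt0.
set e := Num.min _ _ => B c mu g K' eB B1 AB hK'.
have e0 : 0 <= e by rewrite le_min !divr_ge0// ltW.
have [N1 h1] := sums_to_above eA be0; have {}h1 := h1 N1 (leqnn _).
have [N2 h2] := sums_to_above eA ga0; have {}h2 := h2 N2 (leqnn _).
have [N3 h3] := sums_to_above eB be0; have {}h3 := h3 N3 (leqnn _).
have [N4 h4] := sums_to_above eB ga0; have {}h4 := h4 N4 (leqnn _).
have t1 := hal0 _ _ be0 (lt_trans b2 alal0) h1.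
have t2 := hal0 _ _ ga0 g2 h2.
have t3 : Cb * e <= x / 7 by rewrite mulrC -ler_pdivlMr// ge_min lexx orbT.
have t4 : Cg * e <= x / 7 by rewrite mulrC -ler_pdivlMr// ge_min lexx.
have t5 := le_trans (hCb _ _ _ _ _ _ _ eB B1 e0 AB h1 h3) t3.
have t6 := le_trans (hCg _ _ _ _ _ _ _ eB B1 e0 AB h2 h4) t4.
have t7 := truncation_near_level eB be0 b2 g1 hK' h3 h4.
move: h1 h2 h3 h4 t1 t2 t5 t6 t7.
set Ab := partial _ _ _ _; set Ag := partial _ _ _ _.
set Bb := partial _ _ _ _; set Bg := partial _ _ _ _ => _ _ _ _ t1 t2 t5 t6 t7.
apply: le_trans (nrB_trans hip2 Bg _ _) _.
have s1 : nr2 (Bg - A) <= x / 7 + x / 7.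
  by rewrite (le_trans (nrB_trans hip2 Ag _ _))// lerD// nrBC.
have s2 : nr2 (Bb - Bg) <= x / 7 + (x / 7 + x / 7 + x / 7).
  rewrite (le_trans (nrB_trans hip2 Ab _ _))// lerD//; first by rewrite nrBC.
  rewrite (le_trans (nrB_trans hip2 Ag _ _))// lerD//.
  by rewrite (le_trans (nrB_trans hip2 A _ _))// lerD// nrBC.
by move: t7 s1 s2; lra.
Qed.

End eigen_expansion.

(** * Complex L2 spaces *)

Section real_integral.
Context {d : measure_display} {T : measurableType d} {R : realType}.
Variable P : probability T R.
Implicit Types (f g h : T -> R) (r : R).

Definition rint f := P.-integrable [set: T] (EFin \o f).

Lemma rint_meas f : rint f -> measurable_fun [set: T] f.
Proof. by move=> /integrableP[/measurable_EFinP]. Qed.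

Lemma rint_le g f : measurable_fun [set: T] f -> (forall x, `|f x| <= g x) ->
  rint g -> rint f.
Proof.
move=> mf fg; apply: le_integrable => //; first exact/measurable_EFinP.
by move=> x _ /=; rewrite lee_fin (le_trans (fg x))// ler_norm.
Qed.

Lemma rint_cst r : rint (fun=> r).
Proof.
exact: (@finite_measure_integrable_cst _ T R P [set: T] r).
Qed.

Lemma rint_bound f C : measurable_fun [set: T] f -> (forall x, `|f x| <= C) -> rint f.
Proof. by move=> mf fC; apply: (rint_le mf fC); exact: rint_cst. Qed.

Lemma rintD f g : rint f -> rint g -> rint (fun x => f x + g x).
Proof.
move=> hf hg; have := integrableD measurableT hf hg.
by apply: eq_integrable => // x _ /=.
Qed.

Lemma rintZ r f : rint f -> rint (fun x => r * f x).
Proof.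
by move=> hf; have := integrableZl measurableT r hf; apply: eq_integrable.
Qed.

Lemma rintN f : rint f -> rint (fun x => - f x).
Proof.
by move=> hf; have := integrableN hf; apply: eq_integrable.
Qed.

Lemma rintB f g : rint f -> rint g -> rint (fun x => f x - g x).
Proof. by move=> hf hg; apply: rintD => //; exact: rintN. Qed.

Lemma rint_norm f : rint f -> rint (fun x => `|f x|).
Proof.
move=> hf; apply: (@rint_le (fun x => `|f x|)); last 2 first.
- by move=> x; rewrite normr_id.
- by have := integrable_abse hf; apply: eq_integrable.
- by apply: measurableT_comp => //; exact: rint_meas.
Qed.

Definition Int f : R := Rintegral P [set: T] f.

Lemma eq_Int f g : f =1 g -> Int f = Int g.
Proof. by move=> fg; congr Rintegral; exact/funext. Qed.
Lemma IntD f g : rint f -> rint g -> Int (fun x => f x + g x) = Int f + Int g.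
Proof. by move=> hf hg; rewrite /Int RintegralD. Qed.
Lemma IntB f g : rint f -> rint g -> Int (fun x => f x - g x) = Int f - Int g.
Proof. by move=> hf hg; rewrite /Int RintegralB. Qed.
Lemma IntZ r f : rint f -> Int (fun x => r * f x) = r * Int f.
Proof. by move=> hf; rewrite /Int RintegralZl. Qed.
Lemma IntN f : rint f -> Int (fun x => - f x) = - Int f.
Proof.
move=> hf; rewrite -mulN1r -IntZ//; apply: eq_Int => x.
by rewrite mulN1r.
Qed.
Lemma le_Int f g : rint f -> rint g -> (forall x, f x <= g x) -> Int f <= Int g.
Proof. by move=> hf hg fg; apply: le_Rintegral. Qed.
Lemma Int_ge0 f : (forall x, 0 <= f x) -> 0 <= Int f.
Proof. by move=> h; apply: Rintegral_ge0. Qed.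
Lemma Int_cst r : Int (fun=> r) = r.
Proof.
rewrite /Int Rintegral_cst// -[RHS]mulr1; congr (_ * _).
by have /= := congr1 fine (@probability_setT _ _ _ P).
Qed.
Lemma Int0 : Int (fun=> 0) = 0. Proof. exact: Int_cst. Qed.
Lemma EFin_Int f : rint f -> (Int f)%:E = (\int[P]_x (f x)%:E)%E.
Proof.
move=> hf; rewrite /Int /Rintegral fineK//; exact: integrable_fin_num.
Qed.

Lemma ae_eq_Int f g : measurable_fun [set: T] f -> measurable_fun [set: T] g ->
  {ae P, forall x, f x = g x} -> Int f = Int g.
Proof.
move=> mf mg fg; congr fine; apply: ae_eq_integral => //.
- exact/measurable_EFinP.
- exact/measurable_EFinP.
- by apply: filterS fg => x /= -> _.
Qed.

(** Replacing [f] by the minimum of [f] and [g] changes it on a null set and turns the a.e.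
    inequality into one at every point. *)
Lemma ae_le_Int f g : rint f -> rint g -> {ae P, forall x, f x <= g x} ->
  Int f <= Int g.
Proof.
move=> hf hg fg; have mf := rint_meas hf; have mg := rint_meas hg.
have -> : Int f = Int (fun x => Num.min (f x) (g x)).
  apply: ae_eq_Int => //; first exact: measurable_minr.
  by apply: filterS fg => x /= fgx; rewrite min_l.
apply: le_Int => //; last by move=> x; rewrite ge_min lexx orbT.
apply: (@rint_le (fun x => `|f x| + `|g x|)).
- exact: measurable_minr.
- by move=> x; rewrite /Num.min; case: ifP => _; rewrite ?lerDl ?lerDr.
- by apply: rintD; exact: rint_norm.
Qed.

Lemma Int_eq0 f : rint f -> (forall x, 0 <= f x) -> Int f = 0 ->
  {ae P, forall x, f x = 0}.
Proof.
move=> hf f0 If.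
have /(ae_eq_integral_abs P measurableT (measurable_int _ hf)) :
    (\int[P]_x `|(EFin \o f) x| = 0)%E.
  under eq_integral do rewrite /= ger0_norm//.
  by rewrite -EFin_Int// If.
by apply: filterS => x /= /(_ I) [].
Qed.

End real_integral.

Section complex_integral.
Context {d : measure_display} {T : measurableType d} {R : realType}.
Variable P : probability T R.
Implicit Types (f g h : T -> R[i]) (a : R[i]).

Lemma cmeas_cst a : cmeasurable (fun _ : T => a).
Proof. by split; exact: measurable_cst. Qed.

Lemma cmeasD f g : cmeasurable f -> cmeasurable g -> cmeasurable (fun x => f x + g x).
Proof.
move=> [rf jf] [rg jg]; split.
  by under eq_fun do rewrite ReD; exact: measurable_funD.
by under eq_fun do rewrite ImD; exact: measurable_funD.
Qed.

Lemma cmeasM f g : cmeasurable f -> cmeasurable g -> cmeasurable (fun x => f x * g x).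
Proof.
move=> [rf jf] [rg jg]; split.
  by under eq_fun do rewrite ReM; apply: measurable_funB; exact: measurable_funM.
by under eq_fun do rewrite ImM; apply: measurable_funD; exact: measurable_funM.
Qed.

Lemma cmeasJ f : cmeasurable f -> cmeasurable (fun x => conjc (f x)).
Proof.
move=> [rf jf]; split; first by under eq_fun do rewrite ReJ.
under eq_fun do rewrite ImJ; exact: measurableT_comp.
Qed.

Lemma cmeasZ a f : cmeasurable f -> cmeasurable (fun x => a * f x).
Proof. by move=> mf; apply: cmeasM => //; exact: cmeas_cst. Qed.

Lemma cmeas_real (h : T -> R) : measurable_fun [set: T] h ->
  cmeasurable (fun x => (h x)%:C%C).
Proof. by move=> mh; split => //=; exact: measurable_cst. Qed.

Lemma meas_nc f : cmeasurable f -> measurable_fun [set: T] (fun x => nc (f x)).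
Proof.
move=> [rf jf]; have -> : (fun x => nc (f x)) =
   fun x => Num.sqrt (complex.Re (f x) ^+ 2 + complex.Im (f x) ^+ 2).
  by apply/funext => x; case: (f x).
apply: (@measurableT_comp _ _ _ _ _ _ (@Num.sqrt R)).
  by apply: continuous_measurable_fun; exact: sqrt_continuous.
by apply: measurable_funD; exact: measurable_funX.
Qed.

Definition cint f := cmeasurable f /\ rint P (fun x => nc (f x)).

Lemma Re_norm_le (z : R[i]) : `|complex.Re z| <= nc z.
Proof.
by rewrite -ler_sqr ?nnegrE ?nc_ge0// real_normK ?num_real// nc_sqr lerDl sqr_ge0.
Qed.
Lemma Im_norm_le (z : R[i]) : `|complex.Im z| <= nc z.
Proof.
by rewrite -ler_sqr ?nnegrE ?nc_ge0// real_normK ?num_real// nc_sqr lerDr sqr_ge0.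
Qed.

Lemma cint_Re f : cint f -> rint P (fun x => complex.Re (f x)).
Proof. by move=> [[mr mi] h]; apply: (rint_le mr _ h) => x; exact: Re_norm_le. Qed.
Lemma cint_Im f : cint f -> rint P (fun x => complex.Im (f x)).
Proof. by move=> [[mr mi] h]; apply: (rint_le mi _ h) => x; exact: Im_norm_le. Qed.

Lemma cint_le (g : T -> R) f : cmeasurable f -> (forall x, nc (f x) <= g x) ->
  rint P g -> cint f.
Proof.
move=> mf fg hg; split => //; apply: (rint_le (meas_nc mf) _ hg) => x.
by rewrite ger0_norm ?nc_ge0.
Qed.

Lemma cint_bound f (C : R) : cmeasurable f -> (forall x, nc (f x) <= C) -> cint f.
Proof. by move=> mf fC; apply: (cint_le mf fC); exact: rint_cst. Qed.

Lemma cintD f g : cint f -> cint g -> cint (fun x => f x + g x).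
Proof.
move=> [mf hf] [mg hg].
apply: (@cint_le (fun x => nc (f x) + nc (g x))); first exact: cmeasD.
  by move=> x; exact: ncD.
exact: rintD.
Qed.

Lemma cintZ a f : cint f -> cint (fun x => a * f x).
Proof.
move=> [mf hf]; apply: (@cint_le (fun x => nc a * nc (f x))); first exact: cmeasZ.
  by move=> x; rewrite ncM.
exact: rintZ.
Qed.

Lemma cintJ f : cint f -> cint (fun x => conjc (f x)).
Proof.
move=> [mf hf]; apply: (@cint_le (fun x => nc (f x))) => //; first exact: cmeasJ.
by move=> x; rewrite ncJ.
Qed.

Local Notation CI := (cintegral P).

Lemma eq_CI f g : f =1 g -> CI f = CI g.
Proof. by move=> fg; congr cintegral; exact/funext. Qed.

Lemma CI_D f g : cint f -> cint g -> CI (fun x => f x + g x) = CI f + CI g.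
Proof.
move=> hf hg; apply: eqC; rewrite ?ReD ?ImD /=.
  under eq_Rintegral do rewrite ReD.
  by apply: IntD; exact: cint_Re.
under eq_Rintegral do rewrite ImD.
by apply: IntD; exact: cint_Im.
Qed.

Lemma CI_Z a f : cint f -> CI (fun x => a * f x) = a * CI f.
Proof.
move=> hf; have hr := cint_Re hf; have hi := cint_Im hf.
apply: eqC; rewrite ?ReM ?ImM /=.
  under eq_Rintegral do rewrite ReM.
  by rewrite -!IntZ// -IntB//; exact: rintZ.
under eq_Rintegral do rewrite ImM.
by rewrite -!IntZ// -IntD//; exact: rintZ.
Qed.

Lemma CI_J f : cint f -> CI (fun x => conjc (f x)) = conjc (CI f).
Proof.
move=> hf; apply: eqC; rewrite ?ReJ ?ImJ /=.
  by under eq_Rintegral do rewrite ReJ.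
under eq_Rintegral do rewrite ImJ.
by apply: IntN; exact: cint_Im.
Qed.

Lemma CI_N f : cint f -> CI (fun x => - f x) = - CI f.
Proof.
move=> hf; rewrite -mulN1r -CI_Z//; apply: eq_CI => x; by rewrite mulN1r.
Qed.

Lemma CI_real (h : T -> R) : CI (fun x => (h x)%:C%C) = (Int P h)%:C%C.
Proof. by apply: eqC => //=; exact: Int0. Qed.

Lemma CI_cst a : CI (fun=> a) = a.
Proof. by apply: eqC => /=; exact: Int_cst. Qed.

Lemma nc_CI f : cint f -> nc (CI f) <= Int P (fun x => nc (f x)).
Proof.
move=> hf; set z := CI f.
have [->|z0] := eqVneq z 0; first by rewrite nc0 Int_ge0// => x; exact: nc_ge0.
have zp : 0 < nc z.
  by rewrite lt_neqAle nc_ge0 andbT eq_sym; apply: contra_neq z0 => /nc_eq0.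
rewrite -(ler_pM2l zp) -expr2.
(* Multiplication by the conjugate of [z] rotates the integral onto the real axis, where it is
   compared through the real part of the integrand. *)
have [w [wz nw]] : exists w, w * z = (nc z ^+ 2)%:C%C /\ nc w = nc z.
  by exists (conjc z); rewrite mulrC mulJ_nc ncJ.
rewrite -[nc z ^+ 2]/(complex.Re (nc z ^+ 2)%:C%C) -wz -nw -CI_Z// -IntZ; last by case: hf.
apply: le_Int.
- by apply: cint_Re; exact: cintZ.
- by apply: rintZ; case: hf.
- by move=> x; rewrite (le_trans (Re_le_nc _))// ncM.
Qed.

Lemma ae_eq_CI f g : cmeasurable f -> cmeasurable g ->
  {ae P, forall x, f x = g x} -> CI f = CI g.
Proof.
move=> [mf mf'] [mg mg'] fg; apply: eqC => /=; apply: ae_eq_Int => //;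
  by apply: filterS fg => x /= ->.
Qed.

End complex_integral.

Section L2_membership.
Context {d : measure_display} {T : measurableType d} {R : realType}.
Variable P : probability T R.
Implicit Types (f g h : T -> R[i]) (a : R[i]).

Lemma cLnorm2E f : cLnorm P 2%:E f = ((\int[P]_x (nc (f x) ^+ 2)%:E) `^ 2^-1)%E.
Proof.
rewrite /cLnorm unlock; congr (_ `^ _)%E; apply: eq_integral => x _ /=.
by rewrite powR_mulrn// real_normK ?num_real.
Qed.

Lemma inL2E f : inL2 P f <-> cmeasurable f /\ rint P (fun x => nc (f x) ^+ 2).
Proof.
rewrite /inL2 cLnorm2E; split=> -[mf hf]; split=> //.
  apply/integrableP; split.
    by apply/measurable_EFinP; apply: measurable_funX; exact: meas_nc.
  under eq_integral do rewrite /= ger0_norm ?sqr_ge0//.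
  by apply: lty_poweRy hf; rewrite invr_eq0.
move/integrableP : hf => [_].
under eq_integral do rewrite /= ger0_norm ?sqr_ge0//.
by move=> h; exact: poweR_lty.
Qed.

Lemma cint_mul f g : inL2 P f -> inL2 P g -> cint P (fun x => f x * g x).
Proof.
move=> /inL2E[mf hf] /inL2E[mg hg].
apply: (@cint_le _ _ _ _ (fun x => nc (f x) ^+ 2 + nc (g x) ^+ 2)).
- exact: cmeasM.
- move=> x; rewrite ncM; have := sqr_ge0 (nc (f x) - nc (g x)).
  have := sqr_ge0 (nc (f x)); have := sqr_ge0 (nc (g x)); lra.
- exact: rintD.
Qed.

Lemma inL2J f : inL2 P f -> inL2 P (fun x => conjc (f x)).
Proof.
move=> /inL2E[mf hf]; apply/inL2E; split; first exact: cmeasJ.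
by under eq_fun do rewrite ncJ.
Qed.

Lemma inL2_le (g : T -> R) f : cmeasurable f -> (forall x, nc (f x) ^+ 2 <= g x) ->
  rint P g -> inL2 P f.
Proof.
move=> mf fg hg; apply/inL2E; split => //; apply: (rint_le _ _ hg).
  by apply: measurable_funX; exact: meas_nc.
by move=> x; rewrite ger0_norm ?sqr_ge0.
Qed.

Lemma inL2_bound f (C : R) : cmeasurable f -> (forall x, nc (f x) <= C) -> inL2 P f.
Proof.
move=> mf fC; apply: (@inL2_le (fun=> C ^+ 2)) => //; last exact: rint_cst.
move=> x; have C0 := le_trans (nc_ge0 _) (fC x).
by rewrite ler_sqr ?nnegrE ?nc_ge0.
Qed.

Lemma inL2D f g : inL2 P f -> inL2 P g -> inL2 P (fun x => f x + g x).
Proof.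
move=> /inL2E[mf hf] /inL2E[mg hg].
apply: (@inL2_le (fun x => 2 * nc (f x) ^+ 2 + 2 * nc (g x) ^+ 2)).
- exact: cmeasD.
- move=> x; apply: (@le_trans _ _ ((nc (f x) + nc (g x)) ^+ 2)).
    by rewrite ler_sqr ?nnegrE ?addr_ge0 ?nc_ge0//; exact: ncD.
  have := sqr_ge0 (nc (f x) - nc (g x)); lra.
- by apply: rintD; exact: rintZ.
Qed.

Lemma inL2Z a f : inL2 P f -> inL2 P (fun x => a * f x).
Proof.
move=> /inL2E[mf hf]; apply/inL2E; split; first exact: cmeasZ.
under eq_fun do rewrite ncM exprMn.
exact: rintZ.
Qed.

Lemma inL2N f : inL2 P f -> inL2 P (fun x => - f x).
Proof.
move=> hf; have := inL2Z (-1) hf.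
by congr inL2; apply/funext => x; rewrite mulN1r.
Qed.

Lemma inL2_0 : inL2 P (fun=> 0).
Proof.
by apply: (@inL2_bound _ 0) => [|x]; [exact: cmeas_cst|rewrite nc0].
Qed.

End L2_membership.

(** Elements are honest functions: equality is pointwise, vectors can be evaluated at points, and
    a.e. equality is expressed by [nr (u - v) = 0]. *)
Record L2 {d : measure_display} {T : measurableType d} {R : realType}
  (P : probability T R) := MkL2 { L2f :> T -> R[i]; L2P : inL2 P L2f }.

Section L2_space.
Context {d : measure_display} {T : measurableType d} {R : realType}.
Variable P : probability T R.
Local Notation H := (L2 P).
Implicit Types (f g h : H) (a : R[i]).

HB.instance Definition _ := gen_eqMixin H.
HB.instance Definition _ := gen_choiceMixin H.

Lemma L2_ext f g : (forall x, f x = g x) -> f = g.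
Proof.
case: f g => [f hf] [g hg] /= /funext fg; case: g / fg hg => hg.
by congr MkL2; exact: Prop_irrelevance.
Qed.

Definition L2add f g : H := MkL2 (inL2D (L2P f) (L2P g)).
Definition L2opp f : H := MkL2 (inL2N (L2P f)).
Definition L2zero : H := MkL2 (inL2_0 P).
Definition L2scale a f : H := MkL2 (inL2Z a (L2P f)).

Let L2addA : associative L2add.
Proof. by move=> f g h; apply: L2_ext => x /=; rewrite addrA. Qed.
Let L2addC : commutative L2add.
Proof. by move=> f g; apply: L2_ext => x /=; rewrite addrC. Qed.
Let L2add0 : left_id L2zero L2add.
Proof. by move=> f; apply: L2_ext => x /=; rewrite add0r. Qed.
Let L2addN : left_inverse L2zero L2opp L2add.
Proof. by move=> f; apply: L2_ext => x /=; rewrite addNr. Qed.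

HB.instance Definition _ := GRing.isZmodule.Build H L2addA L2addC L2add0 L2addN.

Let L2scaleA a b f : L2scale a (L2scale b f) = L2scale (a * b) f.
Proof. by apply: L2_ext => x /=; rewrite mulrA. Qed.
Let L2scale1 : left_id 1 L2scale.
Proof. by move=> f; apply: L2_ext => x /=; rewrite mul1r. Qed.
Let L2scaleDr : right_distributive L2scale +%R.
Proof. by move=> a f g; apply: L2_ext => x /=; rewrite mulrDr. Qed.
Let L2scaleDl f : {morph L2scale^~ f : a b / a + b}.
Proof. by move=> a b; apply: L2_ext => x /=; rewrite mulrDl. Qed.

HB.instance Definition _ :=
  GRing.Zmodule_isLmodule.Build R[i] H L2scaleA L2scale1 L2scaleDr L2scaleDl.

Lemma L2D f g x : (f + g) x = f x + g x. Proof. by []. Qed.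
Lemma L2N f x : (- f) x = - f x. Proof. by []. Qed.
Lemma L2B f g x : (f - g) x = f x - g x. Proof. by []. Qed.
Lemma L2Z a f x : (a *: f) x = a * f x. Proof. by []. Qed.
Lemma L20 x : (0 : H) x = 0. Proof. by []. Qed.
Lemma L2_sum I (s : seq I) (Q : pred I) (F : I -> H) x :
  (\sum_(i <- s | Q i) F i) x = \sum_(i <- s | Q i) F i x.
Proof. by elim/big_rec2 : _ => // i y z _ <-. Qed.

Definition ip f g : R[i] := inner P f g.

Lemma ip_cint f g : cint P (fun x => f x * conjc (g x)).
Proof. by apply: cint_mul; [exact: L2P|exact: inL2J (L2P g)]. Qed.

Lemma ip_semi_inner : semi_inner ip.
Proof.
split.
- move=> f g h; rewrite /ip /inner -CI_D; [|exact: ip_cint..].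
  by apply: eq_CI => x /=; rewrite mulrDl.
- move=> a f g; rewrite /ip /inner -CI_Z; last exact: ip_cint.
  by apply: eq_CI => x /=; rewrite mulrA.
- move=> f g; rewrite /ip /inner -CI_J; last exact: ip_cint.
  by apply: eq_CI => x /=; rewrite conjcM conjcK mulrC.
- move=> f; rewrite /ip /inner; under eq_CI do rewrite mulJ_nc.
  by rewrite CI_real/=; apply: Int_ge0 => x; exact: sqr_ge0.
Qed.

Lemma sqnE f : sqn ip f = Int P (fun x => nc (f x) ^+ 2).
Proof.
by rewrite /sqn /ip /inner; under eq_CI do rewrite mulJ_nc; rewrite CI_real.
Qed.

Lemma rint_sqr f : rint P (fun x => nc (f x) ^+ 2).
Proof. by case/inL2E: (L2P f). Qed.

Lemma cLnorm2_nr f : cLnorm P 2%:E f = (nr ip f)%:E.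
Proof.
rewrite cLnorm2E -EFin_Int; last exact: rint_sqr.
rewrite poweR_EFin -sqnE powR12_sqrt//.
exact: sqn_ge0 ip_semi_inner _.
Qed.

Lemma L2_cmeas f : cmeasurable f. Proof. by case/inL2E: (L2P f). Qed.

Lemma cint_L2 f : cint P f.
Proof.
apply: (@cint_le _ _ _ _ (fun x => 1 + nc (f x) ^+ 2)).
- exact: L2_cmeas.
- by move=> x; have := sqr_ge0 (nc (f x) - 1); have := sqr_ge0 (nc (f x)); lra.
- by apply: rintD; [exact: rint_cst|exact: rint_sqr].
Qed.

Lemma cLnorm1E (f : T -> R[i]) : cint P f ->
  cLnorm P 1%:E f = (Int P (fun x => nc (f x)))%:E.
Proof.
move=> [_ hf]; rewrite /cLnorm Lnorm1 EFin_Int//; apply: eq_integral => x _ /=.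
by rewrite ger0_norm ?nc_ge0.
Qed.

(** Cauchy-Schwarz for the modulus against the constant 1, which has norm 1 on a probability
    space. *)
Lemma Int_nc_le_nr f : Int P (fun x => nc (f x)) <= nr ip f.
Proof.
have mabs : inL2 P (fun x => (nc (f x))%:C%C).
  apply/inL2E; split; first exact: cmeas_real (meas_nc (L2_cmeas f)).
  by under eq_fun do rewrite nc_real real_normK ?num_real//; exact: rint_sqr.
have one : inL2 P (fun=> 1%:C%C).
  by apply: (@inL2_bound _ _ _ _ _ 1) => [|x]; [exact: cmeas_cst|rewrite nc1].
have := nc_ip_le ip_semi_inner (MkL2 mabs) (MkL2 one).
have -> : ip (MkL2 mabs) (MkL2 one) = (Int P (fun x => nc (f x)))%:C%C.
  rewrite -CI_real; apply: eq_CI => x /=.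
  by apply: eqC; rewrite /= ?oppr0 ?mulr1 ?mulr0 ?mul0r ?subr0 ?addr0.
rewrite nc_real ger0_norm; last by apply: Int_ge0 => x; exact: nc_ge0.
have -> : nr ip (MkL2 one) = 1.
  by rewrite /nr sqnE/= expr1n expr0n addr0 sqrtr1 expr1n Int_cst sqrtr1.
rewrite mulr1 => /le_trans; apply; rewrite /nr !sqnE le_eqVlt; apply/orP; left.
apply/eqP; congr Num.sqrt; apply: eq_Int => x.
by rewrite [L2f (MkL2 _)]/= nc_real real_normK ?num_real.
Qed.

Lemma cLnorm1_le f : (cLnorm P 1%:E f <= (nr ip f)%:E)%E.
Proof. by rewrite cLnorm1E; [rewrite lee_fin Int_nc_le_nr|exact: cint_L2]. Qed.

Lemma cLnorm_ooP (f : T -> R[i]) (C : R) :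
  (cLnorm P +oo%E f <= C%:E)%E <-> {ae P, forall x, nc (f x) <= C}.
Proof.
rewrite /cLnorm unlock /= probability_setT lte01; split.
  by move/ess_supP; apply: filterS => x /=; rewrite lee_fin ger0_norm ?nc_ge0.
move=> h; apply/ess_supP; apply: filterS h => x /= h.
by rewrite lee_fin ger0_norm ?nc_ge0.
Qed.

End L2_space.

(** * Product measures and rank-one kernels *)

Section product_integral.
Context {d : measure_display} {V : measurableType d} {R : realType}.
Variable mu : probability V R.
Implicit Types (f g : V -> R).

Local Notation mu2 := (mu \x mu)%E.

Lemma rint_prod f g : rint mu f -> rint mu g ->
  rint mu2 (fun z => f z.1 * g z.2).
Proof.
move=> hf hg; have mf := rint_meas hf; have mg := rint_meas hg.
have mfg : measurable_fun [set: V * V] (fun z => f z.1 * g z.2).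
  apply: measurable_funM.
    exact: (measurableT_comp mf measurable_fst).
  exact: (measurableT_comp mg measurable_snd).
apply/integrable12ltyP; first exact/measurable_EFinP.
have E (h : V -> R) (r : R) : rint mu h ->
    (\int[mu]_y `|(r * h y)%:E| = (`|r| * Int mu (fun y => `|h y|))%:E)%E.
  move=> hh; have hn := rint_norm hh.
  rewrite -IntZ// EFin_Int; last exact: rintZ.
  by apply: eq_integral => y _ /=; rewrite normrM.
under eq_integral => x _ do rewrite (E g (f x))// mulrC.
rewrite (_ : (\int[mu]_x _)%E = (`|Int mu (fun y => `|g y|)| * Int mu (fun y => `|f y|))%:E) ?ltry//.
rewrite -E//; apply: eq_integral => x _; rewrite /= normrM.
by rewrite [`|Int _ _|]ger0_norm ?Int_ge0.
Qed.

Lemma Int_prod f g : rint mu f -> rint mu g ->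
  Int mu2 (fun z => f z.1 * g z.2) = Int mu f * Int mu g.
Proof.
move=> hf hg; have hfg := rint_prod hf hg.
apply: EFin_inj; rewrite EFin_Int// -integral12_prod_meas1//.
rewrite (_ : fubini_F mu _ = fun x => (Int mu g * f x)%:E); last first.
  by apply/funext => x; rewrite /fubini_F/= -EFin_Int ?IntZ 1?mulrC//; exact: rintZ.
rewrite -EFin_Int; last exact: rintZ.
by rewrite IntZ// mulrC.
Qed.

Lemma cint_prod (f g : V -> R[i]) : cint mu f -> cint mu g ->
  cint mu2 (fun z => f z.1 * g z.2).
Proof.
move=> [[mfr mfi] hf] [[mgr mgi] hg]; split; last first.
  by under eq_fun do rewrite ncM; exact: (rint_prod hf hg).
apply: cmeasM; split.
- exact: (measurableT_comp mfr measurable_fst).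
- exact: (measurableT_comp mfi measurable_fst).
- exact: (measurableT_comp mgr measurable_snd).
- exact: (measurableT_comp mgi measurable_snd).
Qed.

Lemma CI_prod (f g : V -> R[i]) : cint mu f -> cint mu g ->
  cintegral mu2 (fun z => f z.1 * g z.2) = cintegral mu f * cintegral mu g.
Proof.
move=> hf hg.
have [hfr hfi] := (cint_Re hf, cint_Im hf).
have [hgr hgi] := (cint_Re hg, cint_Im hg).
apply: eqC; rewrite ?ReM ?ImM/=.
  rewrite -!Int_prod// -IntB; [|exact: (rint_prod hfr hgr)|exact: (rint_prod hfi hgi)].
  by apply: eq_Int => z; rewrite ReM.
rewrite -!Int_prod// -IntD; [|exact: (rint_prod hfr hgi)|exact: (rint_prod hfi hgr)].
by apply: eq_Int => z; rewrite ImM.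
Qed.

Lemma inL2_tens (f g : V -> R[i]) : inL2 mu f -> inL2 mu g ->
  inL2 mu2 (fun z => f z.1 * conjc (g z.2)).
Proof.
move=> hf hg; have /inL2E[mf sf] := hf; have /inL2E[mg sg] := hg.
apply/inL2E; split.
  apply: cmeasM.
    case: mf => mr mi; split.
      exact: (measurableT_comp mr measurable_fst).
    exact: (measurableT_comp mi measurable_fst).
  case: (cmeasJ mg) => mr mi; split.
    exact: (measurableT_comp mr measurable_snd).
  exact: (measurableT_comp mi measurable_snd).
by under eq_fun do rewrite ncM ncJ exprMn; exact: (rint_prod sf sg).
Qed.

Definition tens (u v : L2 mu) : L2 (mu \x mu)%E := MkL2 (inL2_tens (L2P u) (L2P v)).

Lemma tensDl u v w : tens (u + v) w = tens u w + tens v w.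
Proof. by apply: L2_ext => z; rewrite /= mulrDl. Qed.
Lemma tensZl a u v : tens (a *: u) v = a *: tens u v.
Proof. by apply: L2_ext => z; rewrite /= mulrA. Qed.
Lemma tensDr u v w : tens u (v + w) = tens u v + tens u w.
Proof. by apply: L2_ext => z; rewrite /= conjcD mulrDr. Qed.
Lemma tensZr a u v : tens u (a *: v) = conjc a *: tens u v.
Proof. by apply: L2_ext => z; rewrite /= conjcM mulrCA. Qed.

Local Notation ip1 := (ip (P := mu)).
Local Notation ip2 := (ip (P := (mu \x mu)%E)).

Lemma ip_tens u v u' v' :
  ip2 (tens u v) (tens u' v') = ip1 u u' * conjc (ip1 v v').
Proof.
rewrite [in RHS]/ip /inner -CI_J; last exact: ip_cint.
rewrite -CI_prod; [|exact: ip_cint|apply: cintJ; exact: ip_cint].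
apply: eq_CI => z /=; rewrite !conjcM !conjcK; ring.
Qed.

Lemma kernel_formE (u v : L2 mu) (M : L2 (mu \x mu)%E) :
  kernel_form mu u M v = form ip2 tens M u v.
Proof.
apply: eq_CI => z /=; rewrite conjcM conjcK; ring.
Qed.

End product_integral.

(** * Completeness for uniformly bounded sequences *)

Section bounded_completeness.
Context {d : measure_display} {T : measurableType d} {R : realType}.
Variable P : probability T R.

Lemma sum_half_pow n : \sum_(k < n) (2^-1 : R) ^+ k = 2 - 2 * (2^-1) ^+ n.
Proof.
elim: n => [|n ih]; first by rewrite big_ord0 expr0; lra.
by rewrite big_ord_recr /= ih exprS; lra.
Qed.

(** The moduli of the increments have summable integrals, so their sum is integrable, hence finite
    a.e., and the telescoping series converges absolutely there. *)
Lemma Int_summable_cvg (h : nat -> T -> R) :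
  (forall n, rint P (h n)) ->
  (forall n, Int P (fun x => `|h n.+1 x - h n x|) <= 2^-1 ^+ n) ->
  {ae P, forall x, cvgn (h ^~ x)}.
Proof.
move=> hh hI.
pose D k x := `|h k.+1 x - h k x|.
have rD k : rint P (D k) by apply: rint_norm; exact: rintB.
have mD k : measurable_fun [set: T] (fun x => (D k x)%:E).
  by apply/measurable_EFinP; exact: (rint_meas (rD k)).
have D0 k x : (0 <= (D k x)%:E)%E by rewrite lee_fin /D.
pose S x : \bar R := (\sum_(k <oo) (D k x)%:E)%E.
have SI : (\int[P]_x S x < +oo)%E.
  rewrite /S integral_nneseries//.
  apply: (@le_lt_trans _ _ (2%:E)); last exact: ltry.
  apply: lime_le; first by apply: is_cvg_nneseries => n _ _; exact: integral_ge0.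
  apply: nearW => n; rewrite big_mkord.
  apply: (@le_trans _ _ (\sum_(k < n) (2^-1 ^+ k)%:E)%E).
    by apply: lee_sum => k _; rewrite -EFin_Int// lee_fin; exact: hI.
  rewrite sumEFin lee_fin sum_half_pow gerBl.
  by rewrite mulr_ge0 ?exprn_ge0 ?invr_ge0.
have iS : P.-integrable [set: T] S.
  apply/integrableP; split; first exact: ge0_emeasurable_sum.
  by under eq_integral do rewrite gee0_abs ?nneseries_ge0//.
have := integrable_ae measurableT iS.
apply: filterS => x /= /(_ I) Sx.
suff : cvgn (series (telescope (h ^~ x))).
  rewrite telescopeK => c.
  rewrite (_ : h ^~ x = (fun n => h n x - h 0%N x) \+ cst (h 0%N x)).
    exact: is_cvgD c (is_cvg_cst _).
  by apply/funext => n; rewrite /= subrK.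
apply: (@normed_cvg R R^o); apply: nondecreasing_is_cvgn.
  apply/nondecreasing_seqP => n.
  by rewrite /normed_series_of /series/= big_nat_recr//= lerDl.
exists (fine (S x)) => _ [n _ <-] /=.
rewrite /normed_series_of -lee_fin fineK// /series/= -sumEFin.
exact: (@nneseries_lim_ge R (fun k => (D k x)%:E) xpredT 0%N n (fun _ _ _ => D0 _ _)).
Qed.

(** A rapidly Cauchy subsequence converges a.e., and by dominated convergence in mean square. Where
    functions are bounded by [C], the square of a difference is at most [2 * C] times its modulus,
    so being Cauchy in L_1 is enough to bring in the whole sequence. *)
Lemma bounded_complete_real (h : nat -> T -> R) (C : R) :
  (forall n, measurable_fun [set: T] (h n)) -> (forall n x, `|h n x| <= C) ->
  (forall e, 0 < e -> exists N, forall n m, (N <= n)%N -> (N <= m)%N ->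
     Int P (fun x => `|h n x - h m x|) < e) ->
  exists g : T -> R, [/\ measurable_fun [set: T] g, (forall x, `|g x| <= C) &
    forall e, 0 < e -> exists N, forall n, (N <= n)%N ->
      Int P (fun x => (h n x - g x) ^+ 2) < e].
Proof.
move=> mh hC hcauchy.
have C0 : 0 <= C := le_trans (normr_ge0 _) (hC 0%N point).
have rh n : rint P (h n) := rint_bound P (mh n) (hC n).
have /choice[N hN] : forall k : nat, exists N, forall n m, (N <= n)%N -> (N <= m)%N ->
    Int P (fun x => `|h n x - h m x|) < 2^-1 ^+ k.
  by move=> k; apply: hcauchy; rewrite exprn_gt0// invr_gt0.
(* The maximum puts [phi m] beyond every [N k] with [k <= m], and the summand [i] gives
   [k <= phi k]. *)
pose phi k := (\max_(i < k.+1) (N i + i))%N.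
have Nphi' k m : (k <= m)%N -> (N k + k <= phi m)%N.
  rewrite -ltnS => km.
  exact: (@leq_bigmax _ (fun i : 'I_m.+1 => (N i + i)%N) (Ordinal km)).
have Nphi k m : (k <= m)%N -> (N k <= phi m)%N.
  by move=> /Nphi'; apply: leq_trans; rewrite leq_addr.
have phi_ge k : (k <= phi k)%N by apply: leq_trans (Nphi' k k (leqnn _)); rewrite leq_addl.
have phiI k : Int P (fun x => `|h (phi k.+1) x - h (phi k) x|) <= 2^-1 ^+ k.
  by apply/ltW/hN; apply: Nphi.
have aecvg := @Int_summable_cvg (fun k => h (phi k)) (fun k => rh _) phiI.
(* The upper limit is measurable and defined at every point, and clipping it in [g] makes the bound
   [C] hold everywhere; at points of convergence both agree with the limit. *)
pose g0 x := limn_sup (fun k => h (phi k) x).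
have mg0 : measurable_fun [set: T] g0.
  apply: measurable_fun_limn_sup => //.
    move=> x _; exists C => _ [n _ <-]; exact: le_trans (ler_norm _) (hC _ _).
  by move=> x _; exists (- C) => _ [n _ <-]; have := hC (phi n) x; rewrite ler_norml => /andP[].
pose g x := Num.max (- C) (Num.min C (g0 x)).
have mg : measurable_fun [set: T] g.
  by apply: measurable_maxr => //; exact: measurable_minr.
have gC x : `|g x| <= C.
  rewrite ler_norml /g le_max lexx/= ge_max ge_min lexx/= andbT.
  by rewrite lerNl (le_trans _ C0)// oppr_le0.
have cvgg : {ae P, forall x, h (phi k) x @[k --> \oo] --> g x}.
  apply: filterS aecvg => x cx.
  have g0E : g0 x = limn (fun k => h (phi k) x) by exact: cvg_limn_supE.
  suff -> : g x = g0 x by rewrite g0E.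
  have : - C <= g0 x <= C.
    rewrite g0E; apply/andP; split.
      apply: limr_ge => //; apply: nearW => n.
      by have := hC (phi n) x; rewrite ler_norml => /andP[].
    apply: limr_le => //; apply: nearW => n.
    by have := hC (phi n) x; rewrite ler_norml => /andP[].
  by rewrite /g => /andP[g1 g2]; rewrite min_r// max_r.
exists g; split => // e e0.
pose f_ k x := ((h (phi k) x - g x) ^+ 2)%:E.
have bsq a b : `|a| <= C -> `|b| <= C -> (a - b) ^+ 2 <= (2 * C) ^+ 2 :> R.
  move=> aC bC; rewrite -real_normK ?num_real// ler_sqr ?nnegrE ?mulr_ge0//.
  by rewrite (le_trans (ler_normB _ _))// mulr2n mulrDl mul1r lerD.
have msq k : measurable_fun [set: T] (fun x => (h k x - g x) ^+ 2).
  by apply: measurable_funX; exact: measurable_funB.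
have dom : (\int[P]_x f_ k x)%E @[k --> \oo] --> (\int[P]_x 0%E)%E.
  suff [] : [/\ P.-integrable [set: T] (cst 0%E),
     (\int[P]_x `|f_ k x - 0|)%E @[k --> \oo] --> 0%E &
     (\int[P]_x f_ k x)%E @[k --> \oo] --> (\int[P]_x 0%E)%E] by [].
  apply: (@dominated_convergence _ _ _ _ _ measurableT f_ (cst 0%E) (cst ((2 * C) ^+ 2)%:E)).
  - by move=> k; apply/measurable_EFinP.
  - exact: measurable_cst.
  - apply: filterS cvgg => x cx _ /=.
    rewrite /f_; apply: cvg_EFin; first by apply: nearW.
    have -> : fine \o (fun k => ((h (phi k) x - g x) ^+ 2)%:E) =
       fun k => (h (phi k) x - g x) * (h (phi k) x - g x).
      by apply/funext => k /=; rewrite expr2.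
    have c1 : (fun k => h (phi k) x - g x) k @[k --> \oo] --> (0 : R).
      by rewrite -(subrr (g x)); apply: cvgB => //; exact: cvg_cst.
    have h2 := cvgM c1 c1; rewrite mulr0 in h2. exact: h2.
  - exact: (rint_cst P ((2 * C) ^+ 2)).
  - apply: nearW => x n _; rewrite /f_ lee_fin ger0_norm ?sqr_ge0//.
    exact: bsq.
have {}dom : Int P (fun x => (h (phi k) x - g x) ^+ 2) @[k --> \oo] --> (0 : R).
  rewrite integral0 in dom; by case/fine_cvgP: dom.
have rsq k : rint P (fun x => (h k x - g x) ^+ 2).
  apply: (@rint_bound _ _ _ _ _ ((2 * C) ^+ 2)) => // x.
  by rewrite ger0_norm ?sqr_ge0// bsq.
have rsq' k m : rint P (fun x => `|h k x - h m x|) by apply: rint_norm; exact: rintB.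
have C8 : 0 < 8 * C + 8 by lra.
have e8 : 0 < e / (8 * C + 8) by rewrite divr_gt0.
have e4 : 0 < e / 4 by rewrite divr_gt0.
have [M1 hM1] := hcauchy _ e8.
have [M2 _ hM2] := (@cvgr0_norm_lt _ _ _ _ _ _ dom _ e4).
exists (maxn M1 M2) => n nM.
pose k := maxn M1 M2.
have := hM2 k (leq_maxr _ _); rewrite /= ger0_norm ?Int_ge0//; last by move=> x; exact: sqr_ge0.
have := hM1 n (phi k) (leq_trans (leq_maxl _ _) nM) (leq_trans (leq_maxl _ _) (phi_ge k)).
set I1 := Int _ _; set I2 := Int _ _ => I1e I2e.
(* This comes from [(a - c)^2 <= 2 (a - b)^2 + 2 (b - c)^2]. The tolerances [e / (8 * C + 8)] and
   [e / 4] bound each of the two parts by half of [e]. *)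
have : Int P (fun x => (h n x - g x) ^+ 2) <= 2 * (2 * C * I1) + 2 * I2.
  rewrite -!IntZ//; last by apply: rintZ; exact: rsq'.
  rewrite -IntD; [|by apply: rintZ; apply: rintZ; exact: rsq'|by apply: rintZ; exact: rsq].
  apply: le_Int => //.
    by apply: rintD; apply: rintZ => //; apply: rintZ; exact: rsq'.
  move=> x; set a := h n x; set b := h (phi k) x; set c := g x.
  have : (a - b) ^+ 2 <= 2 * C * `|a - b|.
    rewrite -real_normK ?num_real// expr2 ler_wpM2r//.
    by rewrite (le_trans (ler_normB _ _))// mulr2n mulrDl mul1r lerD// hC.
  have := sqr_ge0 ((a - b) - (b - c)); lra.
have : C * I1 <= C * (e / (8 * C + 8)) by rewrite ler_wpM2l// ltW.
have : C * (e / (8 * C + 8)) <= e / 8.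
  by rewrite mulrA ler_pdivrMr//; lra.
by move: I2e; lra.
Qed.

End bounded_completeness.

Section L2_completeness.
Context {d : measure_display} {T : measurableType d} {R : realType}.
Variable P : probability T R.
Local Notation H := (L2 P).
Local Notation ipP := (ip (P := P)).
Local Notation nrP := (nr ipP).
Local Notation hip := (ip_semi_inner P).
Implicit Types (u v : H).

Lemma nr_ae_eq0 u : {ae P, forall x, u x = 0} -> nrP u = 0.
Proof.
move=> u0; rewrite /nr sqnE (_ : Int _ _ = 0) ?sqrtr0//.
rewrite -[RHS](Int0 P); apply: ae_eq_Int.
- by apply: measurable_funX; apply: meas_nc; exact: L2_cmeas.
- exact: measurable_cst.
- by apply: filterS u0 => x ->; rewrite nc0 expr0n.
Qed.

Lemma ae_eq0_nr u : nrP u = 0 -> {ae P, forall x, u x = 0}.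
Proof.
move=> u0; have : sqn ipP u = 0 by rewrite -(nr_sqr hip) u0 expr0n.
rewrite sqnE => /Int_eq0 h.
have := h (rint_sqr u) (fun x => sqr_ge0 _).
by apply: filterS => x /eqP; rewrite sqrf_eq0 => /eqP/nc_eq0.
Qed.

Lemma nr_ae_eq u v : {ae P, forall x, u x = v x} -> nrP (u - v) = 0.
Proof.
by move=> uv; apply: nr_ae_eq0; apply: filterS uv => x uvx; rewrite L2B uvx subrr.
Qed.

Lemma inL2_clip u (C : R) : 0 <= C ->
  inL2 P (fun x => if nc (u x) <= C then u x else 0).
Proof.
move=> C0; apply: (@inL2_bound _ _ _ _ _ C); last first.
  by move=> x; case: ifPn => //; rewrite nc0.
have mb : measurable_fun [set: T] (fun x => nc (u x) <= C).
  by apply: measurable_fun_ler => //; apply: meas_nc; exact: L2_cmeas.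
have [mr mi] := L2_cmeas u; split.
  rewrite (_ : (fun x => _) = fun x => if nc (u x) <= C then complex.Re (u x) else 0).
    exact: measurable_fun_ifT.
  by apply/funext => x; case: ifPn.
rewrite (_ : (fun x => _) = fun x => if nc (u x) <= C then complex.Im (u x) else 0).
  exact: measurable_fun_ifT.
by apply/funext => x; case: ifPn.
Qed.

Lemma ae_bounded_repr u (C : R) : 0 <= C -> {ae P, forall x, nc (u x) <= C} ->
  exists2 v : H, nrP (u - v) = 0 & forall x, nc (v x) <= C.
Proof.
move=> C0 uC; exists (MkL2 (inL2_clip u C0)) => [|x /=]; last first.
  by case: ifPn => //; rewrite nc0.
by apply: nr_ae_eq; apply: filterS uC => x /= ->.
Qed.

Lemma nr_sub0 u u' v v' : nrP (u - u') = 0 -> nrP (v - v') = 0 ->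
  nrP (u - v) = nrP (u' - v').
Proof.
move=> uu vv; apply/eqP; rewrite eq_le; apply/andP; split.
  rewrite (le_trans (nrB_trans hip u' _ _))// uu add0r.
  by rewrite (le_trans (nrB_trans hip v' _ _))// [nr _ (v' - v)](nrBC hip) vv addr0.
rewrite (le_trans (nrB_trans hip u _ _))// [nr _ (u' - u)](nrBC hip) uu add0r.
by rewrite (le_trans (nrB_trans hip v _ _))// vv addr0.
Qed.

(** Real and imaginary parts converge separately, which bounds the limit only by [C + C]. The bound
    [C] is recovered from the excess of the modulus of the limit over [C]: it is at most the
    distance to each term of the sequence, so its integral is 0. *)
Lemma L2_bounded_complete (F : nat -> H) (C : R) : 0 <= C ->
  (forall n, {ae P, forall x, nc (F n x) <= C}) ->
  (forall e, 0 < e -> exists N, forall n m, (N <= n)%N -> (N <= m)%N ->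
     nrP (F n - F m) < e) ->
  exists2 G : H, (forall x, nc (G x) <= C) &
    forall e, 0 < e -> exists N, forall n, (N <= n)%N -> nrP (F n - G) < e.
Proof.
move=> C0 FC Fc.
have /choice[F' F'P] : forall n, exists v : H, nrP (F n - v) = 0 /\ forall x, nc (v x) <= C.
  by move=> n; have [v ? ?] := ae_bounded_repr C0 (FC n); exists v.
have FF' n m : nrP (F n - F m) = nrP (F' n - F' m).
  by apply: nr_sub0; [case: (F'P n)|case: (F'P m)].
have F'C n x : nc (F' n x) <= C by case: (F'P n).
have comp (pr : R[i] -> R) : (forall z, `|pr z| <= nc z) ->
    (forall x y, pr (x - y) = pr x - pr y) ->
    (forall n, measurable_fun [set: T] (fun x => pr (F' n x))) ->
    exists g : T -> R, [/\ measurable_fun [set: T] g, (forall x, `|g x| <= C) &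
    forall e, 0 < e -> exists N, forall n, (N <= n)%N ->
      Int P (fun x => (pr (F' n x) - g x) ^+ 2) < e].
  move=> prn prB mpr; apply: (@bounded_complete_real _ _ _ P) => //.
    by move=> n x; exact: le_trans (prn _) (F'C _ _).
  move=> e e0; have [N hN] := Fc _ e0; exists N => n m Nn Nm.
  apply: le_lt_trans (hN n m Nn Nm); rewrite FF'.
  apply: le_trans (Int_nc_le_nr _).
  have rnc : rint P (fun x => nc ((F' n - F' m) x)) by case: (cint_L2 (F' n - F' m)).
  have le1 x : `|pr (F' n x) - pr (F' m x)| <= nc ((F' n - F' m) x).
    by rewrite -prB.
  apply: le_Int => //; apply: (rint_le _ _ rnc).
    by apply: measurableT_comp => //; exact: measurable_funB.
  by move=> x; rewrite normr_id.
have [gr [mgr gr1 gr2]] := comp (@complex.Re R) (@Re_norm_le R)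
  (fun x y => etrans (ReD _ _) (congr1 _ (ReN _))) (fun n => (L2_cmeas (F' n)).1).
have [gi [mgi gi1 gi2]] := comp (@complex.Im R) (@Im_norm_le R)
  (fun x y => etrans (ImD _ _) (congr1 _ (ImN _))) (fun n => (L2_cmeas (F' n)).2).
have G0L2 : inL2 P (fun x => Complex (gr x) (gi x)).
  apply: (@inL2_bound _ _ _ _ _ (C + C)) => // x.
  by rewrite (le_trans (nc_le_ReIm _))//= lerD.
pose G0 : H := MkL2 G0L2.
have cvgG0 e : 0 < e -> exists N, forall n, (N <= n)%N -> nrP (F n - G0) < e.
  move=> e0; have e2 : 0 < e ^+ 2 / 2 by rewrite divr_gt0 ?exprn_gt0.
  have [N1 hN1] := gr2 _ e2; have [N2 hN2] := gi2 _ e2.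
  exists (maxn N1 N2) => n; rewrite geq_max => /andP[n1 n2].
  have -> : nrP (F n - G0) = nrP (F' n - G0).
    apply: nr_sub0; first by case: (F'P n).
    by rewrite subrr (nr0 hip).
  rewrite -ltr_sqr ?nnegrE ?nr_ge0 ?ltW// (nr_sqr hip) sqnE.
  have sqb (h : T -> R) : measurable_fun [set: T] h -> (forall x, `|h x| <= C) ->
      forall k : T -> R, measurable_fun [set: T] k -> (forall x, `|k x| <= C) ->
      rint P (fun x => (h x - k x) ^+ 2).
    move=> mh hC k mk kC; apply: (@rint_bound _ _ _ _ _ ((2 * C) ^+ 2)).
      by apply: measurable_funX; exact: measurable_funB.
    move=> x; rewrite normrX ler_sqr ?nnegrE ?mulr_ge0//.
    by rewrite (le_trans (ler_normB _ _))// mulr2n mulrDl mul1r lerD.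
  have [mFr mFi] := L2_cmeas (F' n).
  have rr := sqb _ mFr (fun x => le_trans (Re_norm_le _) (F'C n x)) _ mgr gr1.
  have ri := sqb _ mFi (fun x => le_trans (Im_norm_le _) (F'C n x)) _ mgi gi1.
  rewrite (eq_Int P (g := fun x => (complex.Re (F' n x) - gr x) ^+ 2 +
      (complex.Im (F' n x) - gi x) ^+ 2)); last first.
    by move=> x; rewrite nc_sqr L2B ReD ImD ReN ImN.
  by rewrite IntD// [ltRHS]splitr ltrD ?hN1 ?hN2.
have G0C : {ae P, forall x, nc (G0 x) <= C}.
  pose k x := Num.max 0 (nc (G0 x) - C).
  have mk : measurable_fun [set: T] k.
    apply: measurable_maxr => //; apply: measurable_funB => //.
    by apply: meas_nc; exact: L2_cmeas.
  have k0 x : 0 <= k x by rewrite le_max lexx.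
  have kle n x : k x <= nc ((F' n - G0) x).
    rewrite ge_max nc_ge0 L2B andTb lerBlDr -[in leLHS](subrK (F' n x) (G0 x)).
    by rewrite (le_trans (ncD _ _))// -[G0 x - _]opprB ncN lerD2l.
  have rk : rint P k.
    apply: (@rint_le _ _ _ _ (fun x => nc ((F' 0%N - G0) x))) => //.
      by move=> x; rewrite ger0_norm.
    by case: (cint_L2 (F' 0%N - G0)).
  have : {ae P, forall x, k x = 0}.
    apply: Int_eq0 => //; apply/eqP; rewrite eq_le Int_ge0// andbT.
    apply/ler_addgt0Pr => e e0; have [N hN] := cvgG0 _ e0; rewrite add0r.
    have : nrP (F' N - G0) < e.
      rewrite (_ : nrP _ = nrP (F N - G0)) ?hN//; apply: nr_sub0.
        by rewrite (nrBC hip); case: (F'P N).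
      by rewrite subrr (nr0 hip).
    move=> /ltW; apply: le_trans; apply: le_trans (Int_nc_le_nr _).
    by apply: le_Int => //; case: (cint_L2 (F' N - G0)).
  by apply: filterS => x kx; rewrite -subr_le0 -kx le_max lexx orbT.
have [G G0G GC] := ae_bounded_repr C0 G0C; exists G => // e e0.
have [N hN] := cvgG0 _ e0; exists N => n /hN.
rewrite (@nr_sub0 (F n) (F n) G0 G)//; by rewrite subrr (nr0 hip).
Qed.

End L2_completeness.

(** * The cut norm and the operator norm *)

Section cut_norm_operator.
Context {d : measure_display} {V : measurableType d} {R : realType}.
Variable mu : probability V R.
Local Notation mu2 := (mu \x mu)%E.
Local Notation ip1 := (ip (P := mu)).
Local Notation ip2 := (ip (P := (mu \x mu)%E)).
Local Notation nr1 := (nr ip1).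
Local Notation nr2 := (nr ip2).
Local Notation hip1 := (ip_semi_inner mu).
Local Notation hip2 := (ip_semi_inner (mu \x mu)%E).
Local Notation tens := (tens (mu := mu)).
Local Notation form := (form ip2 tens).
Implicit Types (M : L2 (mu \x mu)%E) (u v : L2 mu).

Lemma ae_fst (p : V -> Prop) : {ae mu, forall x, p x} -> {ae mu2, forall z, p z.1}.
Proof.
move=> [N [mN N0 pN]]; exists (N `*` setT); split.
- exact: measurableX.
- by rewrite product_measure1E//= [X in (X * _)%E]N0 mul0e.
- by move=> z /= pz; split => //; exact: pN.
Qed.

Lemma ae_snd (p : V -> Prop) : {ae mu, forall x, p x} -> {ae mu2, forall z, p z.2}.
Proof.
move=> [N [mN N0 pN]]; exists (setT `*` N); split.
- exact: measurableX.
- by rewrite product_measure1E//= [X in (_ * X)%E]N0 mule0.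
- by move=> z /= pz; split => //; exact: pN.
Qed.

Lemma inL2_ae_bound {d'} {T : measurableType d'} (P : probability T R)
    (f : T -> R[i]) (C : R) :
  cmeasurable f -> {ae P, forall x, nc (f x) <= C} -> inL2 P f.
Proof.
move=> mf fC; apply/inL2E; split => //; apply/integrableP; split.
  by apply/measurable_EFinP; apply: measurable_funX; exact: meas_nc.
apply: (@le_lt_trans _ _ (\int[P]_x (cst (C ^+ 2)%:E x))%E).
  apply: ae_ge0_le_integral => //.
  - apply/measurable_EFinP; apply: measurableT_comp => //.
    by apply: measurable_funX; exact: meas_nc.
  - by move=> x _ /=; rewrite lee_fin sqr_ge0.
  - apply: filterS fC => x fxC _; rewrite lee_fin ger0_norm ?sqr_ge0//.
    by rewrite ler_sqr ?nnegrE ?nc_ge0// (le_trans (nc_ge0 _) fxC).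
by rewrite -EFin_Int ?ltry//; exact: rint_cst.
Qed.

Lemma nr_ae_bound {d'} {T : measurableType d'} (P : probability T R)
    (u : L2 P) (C : R) : 0 <= C ->
  {ae P, forall x, nc (u x) <= C} -> nr (ip (P := P)) u <= C.
Proof.
move=> C0 uC; rewrite -ler_sqr ?nnegrE ?nr_ge0// (nr_sqr (ip_semi_inner P)) sqnE.
rewrite -(Int_cst P (C ^+ 2)); apply: ae_le_Int; [exact: rint_sqr|exact: rint_cst|].
by apply: filterS uC => x ux; rewrite ler_sqr ?nnegrE ?nc_ge0.
Qed.

Lemma kernel_form_le M (s : R) (f g : V -> R[i]) :
  op_bound ip1 ip2 tens M s -> 0 <= s ->
  cmeasurable f /\ (cLnorm mu +oo%E f <= 1)%E ->
  cmeasurable g /\ (cLnorm mu +oo%E g <= 1)%E ->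
  nc (kernel_form mu f M g) <= s.
Proof.
move=> Ms s0 [mf /cLnorm_ooP f1] [mg /cLnorm_ooP g1].
rewrite (kernel_formE (MkL2 (inL2_ae_bound mf f1)) (MkL2 (inL2_ae_bound mg g1))).
apply: le_trans (Ms _ _) _; rewrite -[leRHS]mulr1 ler_wpM2l// -[leRHS]mulr1.
by apply: ler_pM; rewrite ?nr_ge0//; exact: nr_ae_bound.
Qed.

Lemma cut_norm_le_op M (s : R) : op_bound ip1 ip2 tens M s -> 0 <= s ->
  (cut_norm mu M <= s%:E)%E.
Proof.
move=> Ms s0; apply: ub_ereal_sup => _ [f [g [hf hg ->]]].
by rewrite lee_fin; exact: kernel_form_le.
Qed.

Lemma op_bound_nr M : op_bound ip1 ip2 tens M (nr2 M).
Proof.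
by move=> u v; apply: (nc_form hip1 hip2); exact: ip_tens.
Qed.

Lemma cut_norm_le_nr M : (cut_norm mu M <= (nr2 M)%:E)%E.
Proof. by apply: cut_norm_le_op; [exact: op_bound_nr|exact: nr_ge0]. Qed.

Lemma cut_norm_le_norm1 M : (cut_norm mu M <= kernel_norm1 mu M)%E.
Proof.
rewrite /kernel_norm1 cLnorm1E; last exact: cint_L2.
apply: ub_ereal_sup => _ [f [g [[mf /cLnorm_ooP f1] [mg /cLnorm_ooP g1] ->]]].
set u := MkL2 (inL2_ae_bound mf f1); set v := MkL2 (inL2_ae_bound mg g1).
rewrite lee_fin (kernel_formE u v).
apply: le_trans (nc_CI (ip_cint _ _)) _.
apply: ae_le_Int.
- by case: (ip_cint M (tens u v)).
- by case: (cint_L2 M).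
- near=> z; rewrite ncM ncJ /= ncM ncJ -[leRHS]mulr1 ler_wpM2l ?nc_ge0//.
  rewrite -[leRHS]mulr1 ler_pM ?nc_ge0//.
    by near: z; exact: (ae_fst f1).
  by near: z; exact: (ae_snd g1).
Unshelve. all: by end_near.
Qed.

Lemma form_le_Int M (C : R) u v : 0 <= C -> {ae mu2, forall z, nc (M z) <= C} ->
  nc (form M u v) <= C * (Int mu (fun x => nc (u x)) * Int mu (fun x => nc (v x))).
Proof.
move=> C0 MC; apply: le_trans (nc_CI (ip_cint _ _)) _.
have ru : rint mu (fun x => nc (u x)) by case: (cint_L2 u).
have rv : rint mu (fun x => nc (v x)) by case: (cint_L2 v).
rewrite -Int_prod// -IntZ; last exact: (rint_prod ru rv).
apply: ae_le_Int.
- by case: (ip_cint M (tens u v)).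
- by apply: rintZ; exact: (rint_prod ru rv).
- apply: filterS MC => z Mz.
  by rewrite ncM ncJ /= ncM ncJ ler_wpM2r// mulr_ge0 ?nc_ge0.
Qed.

Lemma Int_clip u (K : R) (K0 : 0 < K) (u' := MkL2 (inL2_clip u (ltW K0))) :
  Int mu (fun x => nc ((u - u') x)) <= K^-1 * nr1 u ^+ 2.
Proof.
rewrite (nr_sqr hip1) sqnE -IntZ; last exact: rint_sqr.
apply: le_Int; [by case: (cint_L2 (u - u'))|apply: rintZ; exact: rint_sqr|].
move=> x; rewrite L2B /=; case: ifPn => [_|].
  by rewrite subrr nc0 mulr_ge0 ?sqr_ge0// invr_ge0 ltW.
rewrite -ltNge subr0 => Kx; rewrite mulrC ler_pdivlMr// expr2.
by rewrite ler_wpM2l ?nc_ge0 ?ltW.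
Qed.

(* Bounded test functions suffice to control the form of a bounded kernel on
   L_2: the part of [u] above height [K] has L_1-norm at most [|u|^2 / K]. *)
Lemma op_bound_cut M (e K : R) : {ae mu2, forall z, nc (M z) <= 2} ->
  0 <= e -> 0 < K -> (cut_norm mu M <= e%:E)%E ->
  op_bound ip1 ip2 tens M (K ^+ 2 * e + 4 / K).
Proof.
move=> M2 e0 K0 cutM.
suff unit u v : nr1 u = 1 -> nr1 v = 1 -> nc (form M u v) <= K ^+ 2 * e + 4 / K.
  move=> u v; have [uv0|uv0] := eqVneq (nr1 u * nr1 v) 0.
    by have := op_bound_nr M u v; rewrite uv0 !mulr0.
  move: uv0; rewrite mulf_eq0 negb_or => /andP[u0 v0].
  have up : 0 < nr1 u by rewrite lt_neqAle eq_sym u0 nr_ge0.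
  have vp : 0 < nr1 v by rewrite lt_neqAle eq_sym v0 nr_ge0.
  have nrn w : 0 < nr1 w -> nr1 ((nr1 w)^-1%:C%C *: w) = 1.
    by move=> wp; rewrite (nrZ hip1) nc_real ger0_norm ?invr_ge0 ?nr_ge0// mulVf// gt_eqF.
  have := unit _ _ (nrn u up) (nrn v vp).
  rewrite /form tensZl tensZr scalerA (ipZr hip2) ncM ncJ ncM ncJ !nc_real.
  rewrite !ger0_norm ?invr_ge0 ?nr_ge0// -invfM mulrC ler_pdivrMr//.
  exact: mulr_gt0.
move=> u1 v1; pose uK := MkL2 (inL2_clip u (ltW K0)); pose vK := MkL2 (inL2_clip v (ltW K0)).
(* In each of the two remainders one argument is a clipped-off part, of L_1 norm at most [K^-1], and
   the other has L_1 norm at most 1. With kernel values at most 2 they add up to [4 / K]. *)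
have -> : form M u v = form M uK vK + form M (u - uK) vK + form M u (v - vK).
  rewrite -(formDl hip2 (@tensDl _ _ _ mu)) [uK + _]addrC subrK.
  by rewrite -(formDr hip2 (@tensDr _ _ _ mu)) [vK + _]addrC subrK.
have clip_le (w : L2 mu) : nr1 w = 1 ->
    Int mu (fun x => nc (MkL2 (inL2_clip w (ltW K0)) x)) <= 1.
  move=> w1; rewrite -[leRHS]w1; apply: le_trans (Int_nc_le_nr w).
  apply: le_Int; [|by case: (cint_L2 w)|].
    by case: (cint_L2 (MkL2 (inL2_clip w (ltW K0)))).
  by move=> x /=; case: ifPn; rewrite ?nc0 ?nc_ge0.
have i0 (w : L2 mu) : 0 <= Int mu (fun x => nc (w x)).
  by apply: Int_ge0 => x; exact: nc_ge0.
have K'0 : 0 <= K^-1 by rewrite invr_ge0 ltW.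
rewrite (le_trans (ncD _ _))//.
apply: le_trans (lerD (ncD _ _) (lexx _)) _.
rewrite -addrA; apply: lerD.
  (* Division by [K] makes a clipped function admissible for the cut norm; undoing it in both
     arguments costs [K ^+ 2]. *)
  have clipK (w : L2 mu) : cmeasurable (fun x => (K^-1)%:C%C * MkL2 (inL2_clip w (ltW K0)) x) /\
      (cLnorm mu +oo%E (fun x => ((K^-1)%:C%C * MkL2 (inL2_clip w (ltW K0)) x)%R) <= 1)%E.
    split; first by apply: cmeasZ; exact: L2_cmeas.
    apply/cLnorm_ooP; apply: nearW => x; rewrite ncM nc_real ger0_norm//= mulrC.
    by rewrite ler_pdivrMr// mul1r; case: ifPn => // _; rewrite nc0 ltW.
  have : nc (form M ((K^-1)%:C%C *: uK) ((K^-1)%:C%C *: vK)) <= e.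
    rewrite -kernel_formE -lee_fin; apply: le_trans cutM; apply: ereal_sup_ubound.
    by exists ((K^-1)%:C%C *: uK), ((K^-1)%:C%C *: vK); split; [exact: clipK|exact: clipK|].
  rewrite /form tensZl tensZr scalerA (ipZr hip2) ncM ncJ ncM ncJ !nc_real.
  by rewrite !ger0_norm// -invfM -expr2 mulrC ler_pdivrMr ?exprn_gt0// [e * _]mulrC.
have -> : 4 / K = 2 * (K^-1 * 1) + 2 * (1 * K^-1) by field; rewrite gt_eqF.
apply: lerD; (apply: le_trans (form_le_Int _ _ _ M2) _ => //).
  rewrite ler_wpM2l// ler_pM//; last exact: clip_le.
  by apply: le_trans (Int_clip _ _) _; rewrite u1 expr1n mulr1.
rewrite ler_wpM2l// ler_pM//; first by rewrite -u1; exact: Int_nc_le_nr.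
by apply: le_trans (Int_clip _ _) _; rewrite v1 expr1n mulr1.
Qed.

End cut_norm_operator.

(** * The distances delta *)

Section measure_preserving_maps.
Context {d : measure_display} {T : measurableType d} {R : realType}.
Variable P : probability T R.
Variable phi : T -> T.
Hypothesis mp : measure_preserving P phi.

Let mphi : measurable_fun [set: T] phi := mp.1.

Lemma mp_ge0_integral (f : T -> \bar R) : measurable_fun [set: T] f ->
  (forall x, (0 <= f x)%E) -> (\int[P]_x f (phi x) = \int[P]_x f x)%E.
Proof.
move=> mf f0.
have := ge0_integral_pushforward mphi P measurableT mf (fun x _ => f0 x).
rewrite preimage_setT /= => <-.
by apply: eq_measure_integral => A mA _; exact: mp.2.
Qed.

Lemma mp_rint (f : T -> R) : rint P f -> rint P (f \o phi).
Proof.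
move=> hf; have mf := rint_meas hf; apply/integrableP; split.
  by apply/measurable_EFinP; exact: measurableT_comp.
rewrite (mp_ge0_integral (f := fun x => `|(f x)%:E|%E))//; first by case/integrableP: hf.
by apply: measurableT_comp => //; exact/measurable_EFinP.
Qed.

Lemma mp_Int (f : T -> R) : rint P f -> Int P (f \o phi) = Int P f.
Proof.
move=> hf; have hf' := mp_rint hf; apply: EFin_inj; rewrite !EFin_Int//.
have mf : measurable_fun [set: T] (EFin \o f) by exact/measurable_EFinP/(rint_meas hf).
have := integral_pushforward mphi (mu := P) (D := setT) mf.
rewrite preimage_setT => /(_ hf' measurableT) /= <-.
by apply: eq_measure_integral => A mA _; exact: mp.2.
Qed.

Lemma cmeas_comp (f : T -> R[i]) : cmeasurable f -> cmeasurable (f \o phi).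
Proof.
by move=> [mr mi]; split; [exact: (measurableT_comp mr mphi)|exact: (measurableT_comp mi mphi)].
Qed.

Lemma mp_cint (f : T -> R[i]) : cint P f -> cint P (f \o phi).
Proof. by move=> [mf hf]; split; [exact: cmeas_comp|exact: (mp_rint hf)]. Qed.

Lemma mp_CI (f : T -> R[i]) : cint P f -> cintegral P (f \o phi) = cintegral P f.
Proof.
move=> hf; apply: eqC => /=; first exact: (mp_Int (cint_Re hf)).
exact: (mp_Int (cint_Im hf)).
Qed.

Lemma mp_ae (p : T -> Prop) : {ae P, forall x, p x} -> {ae P, forall x, p (phi x)}.
Proof.
move=> [N [mN N0 pN]]; exists (phi @^-1` N); split.
- by rewrite -[X in measurable X]setTI; exact: mphi.
- by rewrite mp.2.
- by move=> x px; exact: pN.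
Qed.

Lemma inL2_comp (f : T -> R[i]) : inL2 P f -> inL2 P (f \o phi).
Proof.
move=> /inL2E[mf hf]; apply/inL2E; split; first exact: cmeas_comp.
exact: (mp_rint hf).
Qed.

Definition L2comp (u : L2 P) : L2 P := MkL2 (inL2_comp (L2P u)).

Lemma ip_L2comp u v : ip (L2comp u) (L2comp v) = ip u v.
Proof. by rewrite /ip /inner -(mp_CI (ip_cint u v)). Qed.

Lemma nr_L2comp u : nr (ip (P := P)) (L2comp u) = nr (ip (P := P)) u.
Proof. by rewrite /nr /sqn ip_L2comp. Qed.

End measure_preserving_maps.

Lemma mp_id {d} {T : measurableType d} {R : realType} (P : probability T R) :
  measure_preserving P id.
Proof. by split => //; exact: measurable_id. Qed.

Lemma mp_comp {d} {T : measurableType d} {R : realType} (P : probability T R)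
  (f g : T -> T) : measure_preserving P f -> measure_preserving P g ->
  measure_preserving P (f \o g).
Proof.
move=> [mf pf] [mg pg]; split; first exact: measurableT_comp.
move=> A mA; rewrite comp_preimage pg ?pf//.
by rewrite -[X in measurable X]setTI; exact: mf.
Qed.

Section pullbacks.
Context {d : measure_display} {V : measurableType d} {R : realType}.
Variable mu : probability V R.
Local Notation mu2 := (mu \x mu)%E.
Implicit Types (psi : V -> V).

Definition sqmap psi (z : V * V) := (psi z.1, psi z.2).

(** The image of the product measure under the map agrees with the product measure on rectangles,
    and these determine it. *)
Lemma mp_sqmap psi : measure_preserving mu psi -> measure_preserving mu2 (sqmap psi).
Proof.
move=> [mpsi ppsi].
have ms : measurable_fun [set: V * V] (sqmap psi).
  apply/measurable_fun_pairP; split.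
    exact: (measurableT_comp mpsi measurable_fst).
  exact: (measurableT_comp mpsi measurable_snd).
split => // A mA.
pose nu : {measure set (V * V) -> \bar R} :=
  measure_function_pushforward__canonical__measure_function_Measure mu2 ms.
rewrite [RHS](@product_measure_unique _ _ _ _ _ mu mu nu)// => B C mB mC.
rewrite /nu /= /pushforward.
have -> : sqmap psi @^-1` (B `*` C) = (psi @^-1` B) `*` (psi @^-1` C) by [].
have mpre D : measurable D -> measurable (psi @^-1` D).
  by move=> mD; rewrite -[X in measurable X]setTI; exact: mpsi.
rewrite product_measure1E//; try exact: mpre.
by congr (_ * _)%E; exact: ppsi.
Qed.

Lemma imp_id : invertible_measure_preserving mu id.
Proof.
split; first exact: mp_id; exists id; split; [exact: mp_id|exact: nearW..].
Qed.

Lemma imp_comp f g : invertible_measure_preserving mu f ->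
  invertible_measure_preserving mu g -> invertible_measure_preserving mu (f \o g).
Proof.
move=> [mf [f' [mf' ff' f'f]]] [mg [g' [mg' gg' g'g]]].
split; first exact: mp_comp; exists (g' \o f'); split; first exact: mp_comp.
  by apply: filterS2 gg' (mp_ae mg ff') => x gx fx /=; rewrite fx.
by apply: filterS2 f'f (mp_ae mf' g'g) => x fx gx /=; rewrite gx.
Qed.

Lemma kernel_norm1_pullback psi (W : L2 mu2) : measure_preserving mu psi ->
  kernel_norm1 mu (pullback psi W) = kernel_norm1 mu W.
Proof.
move=> /mp_sqmap mps; have cW := cint_L2 W.
rewrite /kernel_norm1 (cLnorm1E cW) (cLnorm1E (f := pullback psi W)); last exact: (mp_cint mps cW).
by congr EFin; apply: (mp_Int mps); case: cW.
Qed.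

Lemma test_function_comp psi (f : V -> R[i]) : measure_preserving mu psi ->
  cmeasurable f /\ (cLnorm mu +oo%E f <= 1)%E ->
  cmeasurable (f \o psi) /\ (cLnorm mu +oo%E (f \o psi) <= 1)%E.
Proof.
move=> mpsi [mf /cLnorm_ooP f1]; split; first exact: (cmeas_comp mpsi).
apply/cLnorm_ooP; exact: (mp_ae mpsi f1).
Qed.

Lemma cint_kernel_form (f g : V -> R[i]) (W : L2 mu2) :
  cmeasurable f /\ (cLnorm mu +oo%E f <= 1)%E ->
  cmeasurable g /\ (cLnorm mu +oo%E g <= 1)%E ->
  cint mu2 (fun z => conjc (f z.1) * W z * g z.2).
Proof.
move=> [mf /cLnorm_ooP f1] [mg /cLnorm_ooP g1].
have := ip_cint W (tens (MkL2 (inL2_ae_bound mf f1)) (MkL2 (inL2_ae_bound mg g1))).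
congr cint; apply/funext => z /=; rewrite conjcM conjcK; ring.
Qed.

(** Test functions for the pullback are carried to test functions for [W] by the inverse [phi], and
    the form keeps its value because [psi \o phi] is the identity a.e. *)
Lemma cut_norm_pullback psi (W : L2 mu2) : invertible_measure_preserving mu psi ->
  (cut_norm mu (pullback psi W) <= cut_norm mu W)%E.
Proof.
move=> [mpsi [phi [mphi _ psiphi]]].
apply: ub_ereal_sup => _ [f [g [hf hg ->]]].
apply: ereal_sup_ubound; exists (f \o phi), (g \o phi).
split; [exact: test_function_comp|exact: test_function_comp|].
congr (nc _)%:E; rewrite /kernel_form.
have cW := cint_kernel_form (L2comp (mp_sqmap mpsi) W) hf hg.
rewrite -(mp_CI (mp_sqmap mphi) cW); apply: ae_eq_CI.
- by case: (mp_cint (mp_sqmap mphi) cW).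
- by case: (cint_kernel_form W (test_function_comp mphi hf) (test_function_comp mphi hg)).
- apply: filterS2 (ae_fst psiphi) (ae_snd psiphi) => -[x y] /= px py.
  by rewrite /pullback /sqmap/= px py.
Qed.

Lemma kernel_norm1D (A B : L2 mu2) :
  (kernel_norm1 mu (A + B)%R <= kernel_norm1 mu A + kernel_norm1 mu B)%E.
Proof.
rewrite /kernel_norm1 !cLnorm1E; [|exact: cint_L2..].
have [_ rA] := cint_L2 A; have [_ rB] := cint_L2 B.
rewrite -EFinD lee_fin -IntD//; apply: le_Int; [|exact: rintD|].
  by case: (cint_L2 (A + B)).
by move=> z; exact: ncD.
Qed.

Lemma kernel_norm1N (A : L2 mu2) : kernel_norm1 mu (- A)%R = kernel_norm1 mu A.
Proof.
rewrite /kernel_norm1 !cLnorm1E; [|exact: cint_L2..].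
by congr EFin; apply: eq_Int => z /=; rewrite ncN.
Qed.

Lemma cut_normD (A B : L2 mu2) :
  (cut_norm mu (A + B)%R <= cut_norm mu A + cut_norm mu B)%E.
Proof.
apply: ub_ereal_sup => _ [f [g [hf hg ->]]].
have cA := cint_kernel_form A hf hg; have cB := cint_kernel_form B hf hg.
rewrite (_ : kernel_form _ _ _ _ = kernel_form mu f A g + kernel_form mu f B g); last first.
  by rewrite /kernel_form -CI_D//; apply: eq_CI => z; rewrite L2D; ring.
apply: le_trans (_ : ((nc (kernel_form mu f A g))%:E + (nc (kernel_form mu f B g))%:E <= _)%E).
  by rewrite -EFinD lee_fin; exact: ncD.
by apply: leeD; apply: ereal_sup_ubound; exists f, g.
Qed.

Lemma cut_normN (A : L2 mu2) : (cut_norm mu (- A)%R <= cut_norm mu A)%E.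
Proof.
apply: ub_ereal_sup => _ [f [g [hf hg ->]]].
apply: ereal_sup_ubound; exists f, g; split => //.
congr (_)%:E; rewrite -ncN; congr (nc _).
rewrite /kernel_form -CI_N; last exact: cint_kernel_form.
by apply: eq_CI => z; rewrite L2N mulrN mulNr opprK.
Qed.

End pullbacks.

Section delta_distance.
Context {d : measure_display} {V : measurableType d} {R : realType}.
Variable mu : probability V R.
Local Notation mu2 := (mu \x mu)%E.
Local Notation H2 := (L2 (mu \x mu)%E).

(** The properties from which the triangle inequality for [delta] is derived, so that [kernel_norm1]
    and [cut_norm] are treated together. *)
Record invariant_norm (nrm : (V * V -> R[i]) -> \bar R) : Prop := InvariantNorm {
  invn_ge0 : forall A : H2, (0 <= nrm A)%E;
  invnD : forall A B : H2, (nrm (A + B)%R <= nrm A + nrm B)%E;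
  invnN : forall A : H2, (nrm (- A)%R <= nrm A)%E;
  invn_pullback : forall psi (A : H2), invertible_measure_preserving mu psi ->
    (nrm (pullback psi A) <= nrm A)%E }.

Lemma invariant_norm1 : invariant_norm (kernel_norm1 mu).
Proof.
split.
- by move=> A; exact: Lnorm_ge0.
- exact: kernel_norm1D.
- by move=> A; rewrite kernel_norm1N.
- by move=> psi A [mpsi _]; rewrite kernel_norm1_pullback.
Qed.

Lemma invariant_cut : invariant_norm (cut_norm mu).
Proof.
split.
- move=> A; apply: ereal_sup_ubound.
  exists (fun=> 0), (fun=> 0).
  have h : cmeasurable (fun _ : V => 0 : R[i]) /\ (cLnorm mu +oo%E (fun=> (0 : R[i])%R) <= 1)%E.
    split; first exact: cmeas_cst.
    by apply/cLnorm_ooP; apply: nearW => x; rewrite nc0.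
  split => //; congr EFin; rewrite /kernel_form (eq_CI _ (g := fun=> 0)) ?CI_cst ?nc0//.
  by move=> z; rewrite mulr0.
- exact: cut_normD.
- exact: cut_normN.
- by move=> psi A; exact: cut_norm_pullback.
Qed.

Definition pull psi (mpsi : measure_preserving mu psi) : H2 -> H2 :=
  L2comp (mp_sqmap mpsi).

Variable nrm : (V * V -> R[i]) -> \bar R.
Hypothesis hn : invariant_norm nrm.

Lemma delta_le psi1 psi2 (W1 W2 : V * V -> R[i]) :
  measure_preserving mu psi1 -> measure_preserving mu psi2 ->
  (delta mu nrm W1 W2 <= nrm (pullback psi1 W1 \- pullback psi2 W2)%R)%E.
Proof. by move=> m1 m2; apply: ereal_inf_lbound; exists psi1, psi2. Qed.

Lemma delta_ge0 (W1 W2 : H2) : (0 <= delta mu nrm W1 W2)%E.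
Proof.
apply: le_ereal_inf_tmp => _ [psi1 [psi2 [m1 m2 ->]]].
exact: (invn_ge0 hn (pull m1 W1 - pull m2 W2)).
Qed.

Lemma delta_le_nrm (W1 W2 : H2) : (delta mu nrm W1 W2 <= nrm (W1 - W2)%R)%E.
Proof.
apply: le_trans (delta_le W1 W2 (mp_id mu) (mp_id mu)) _.
by rewrite (_ : _ \- _ = (W1 - W2 : H2))//; apply/funext => -[x y].
Qed.

Lemma nrm_sub_sym (A B : H2) : (nrm (A - B)%R <= nrm (B - A)%R)%E.
Proof. by rewrite -opprB; exact: (invnN hn). Qed.

Lemma delta_sym (W1 W2 : H2) : (delta mu nrm W1 W2 <= delta mu nrm W2 W1)%E.
Proof.
apply: le_ereal_inf_tmp => _ [psi1 [psi2 [m1 m2 ->]]].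
apply: le_trans (delta_le W1 W2 m2 m1) _.
exact: (nrm_sub_sym (pull m2 W1) (pull m1 W2)).
Qed.

Hypothesis hV : delta_by_invertible mu nrm.

Lemma delta_lt_invertible (W1 W2 : H2) (x : R) : (delta mu nrm W1 W2 < x%:E)%E ->
  exists2 psi, invertible_measure_preserving mu psi &
    (nrm (pullback psi W1 \- W2)%R < x%:E)%E.
Proof.
rewrite hV; [|exact: L2P..].
by move=> /ereal_inf_lt[_ [psi ipsi ->] h]; exists psi.
Qed.

(** In [delta] both kernels are moved, and two such pairs of maps need not fit together. By [hV] the
    first kernel alone can be moved: [psi] brings [W1] near [W2] and [chi] brings [W2] near [W3], so
    [psi \o chi] brings [W1] near [W3]. *)
Lemma delta_triangle (W1 W2 W3 : H2) (x y : R) :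
  (delta mu nrm W1 W2 < x%:E)%E -> (delta mu nrm W2 W3 < y%:E)%E ->
  (delta mu nrm W1 W3 < (x + y)%:E)%E.
Proof.
move=> /delta_lt_invertible[psi ipsi hpsi] /delta_lt_invertible[chi ichi hchi].
have [mpsi mchi] := (ipsi.1, ichi.1).
apply: le_lt_trans (delta_le W1 W3 (mp_comp mpsi mchi) (mp_id mu)) _.
pose A := pull mpsi W1 - W2; pose B := pull mchi W2 - W3.
have -> : pullback (psi \o chi) W1 \- pullback id W3 = pull mchi A + B.
  apply/funext => -[a b]; rewrite /A /B L2D [LHS]/= [(pull _ _) _]/= !L2B.
  by rewrite addrA subrK.
apply: le_lt_trans (invnD hn _ _) _.
rewrite EFinD; apply: lteD => //.
exact: le_lt_trans (invn_pullback hn A ichi) hpsi.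
Qed.

End delta_distance.

(** * The spectral theorem for bounded kernels *)

Section complex_fubini.
Context {d1 d2 : measure_display} {T1 : measurableType d1} {T2 : measurableType d2}
  {R : realType}.
Variables (P1 : probability T1 R) (P2 : probability T2 R).
Local Notation P12 := (P1 \x P2)%E.
Implicit Types F : T1 * T2 -> R[i].

Lemma Int_fubini_meas (h : T1 * T2 -> R) : rint P12 h ->
  measurable_fun [set: T1] (fun x => Int P2 (fun y => h (x, y))).
Proof.
move=> hh; have mF := measurable_fubini_F hh.
by apply: (measurableT_comp _ mF); exact: fine_measurable.
Qed.

Lemma Int_fubini1 (h : T1 * T2 -> R) : rint P12 h ->
  (forall x, rint P2 (fun y => h (x, y))) ->
  rint P1 (fun x => Int P2 (fun y => h (x, y))) /\
  Int P1 (fun x => Int P2 (fun y => h (x, y))) = Int P12 h.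
Proof.
move=> hh hx.
have E : EFin \o (fun x => Int P2 (fun y => h (x, y))) = fubini_F P2 (EFin \o h).
  by apply/funext => x; rewrite /= EFin_Int.
have hr : rint P1 (fun x => Int P2 (fun y => h (x, y))).
  by rewrite /rint E; exact: (integrable_fubini_F hh).
split => //; apply: EFin_inj; rewrite !EFin_Int// -integral12_prod_meas1//.
by rewrite -E.
Qed.

Lemma Int_fubini2 (h : T1 * T2 -> R) : rint P12 h ->
  (forall y, rint P1 (fun x => h (x, y))) ->
  rint P2 (fun y => Int P1 (fun x => h (x, y))) /\
  Int P2 (fun y => Int P1 (fun x => h (x, y))) = Int P12 h.
Proof.
move=> hh hy.
have E : EFin \o (fun y => Int P1 (fun x => h (x, y))) = fubini_G P1 (EFin \o h).
  by apply/funext => y; rewrite /= EFin_Int.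
have hr : rint P2 (fun y => Int P1 (fun x => h (x, y))).
  have /integrableP[mh hoo] := hh.
  rewrite /rint E; apply/integrableP; split; first exact: (measurable_fubini_G hh).
  apply: le_lt_trans ((integrable21ltyP P1 P2 mh).1 hh).
  apply: ge0_le_integral => //.
  - by apply: measurableT_comp => //; exact: (measurable_fubini_G hh).
  - apply: (@measurable_fun_fubini_tonelli_G _ _ _ _ _ P1 (abse \o (EFin \o h))).
      exact: measurableT_comp.
    by move=> x; exact: abse_ge0.
  - by move=> y _; apply: le_abse_integral => //; case/integrableP: (hy y).
split => //; apply: EFin_inj; rewrite !EFin_Int// -integral21_prod_meas1//.
by rewrite -E.
Qed.

Lemma CI_fubini_meas F : cint P12 F ->
  cmeasurable (fun x => cintegral P2 (fun y => F (x, y))).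
Proof.
move=> hF; split => /=; first exact: (Int_fubini_meas (cint_Re hF)).
exact: (Int_fubini_meas (cint_Im hF)).
Qed.

Lemma CI_fubini1 F : cint P12 F -> (forall x, cint P2 (fun y => F (x, y))) ->
  cintegral P1 (fun x => cintegral P2 (fun y => F (x, y))) = cintegral P12 F.
Proof.
move=> hF hx; apply: eqC => /=.
  exact: (Int_fubini1 (cint_Re hF) (fun x => cint_Re (hx x))).2.
exact: (Int_fubini1 (cint_Im hF) (fun x => cint_Im (hx x))).2.
Qed.

Lemma CI_fubini2 F : cint P12 F -> (forall y, cint P1 (fun x => F (x, y))) ->
  cintegral P2 (fun y => cintegral P1 (fun x => F (x, y))) = cintegral P12 F.
Proof.
move=> hF hy; apply: eqC => /=.
  exact: (Int_fubini2 (cint_Re hF) (fun x => cint_Re (hy x))).2.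
exact: (Int_fubini2 (cint_Im hF) (fun x => cint_Im (hy x))).2.
Qed.

End complex_fubini.

Section measurable_sections.
Context {d1 d2 d3 : measure_display} {T1 : measurableType d1} {T2 : measurableType d2}
  {T3 : measurableType d3} {R : realType}.

Lemma cmeasT_comp (f : T2 -> R[i]) (g : T1 -> T2) :
  cmeasurable f -> measurable_fun [set: T1] g -> cmeasurable (f \o g).
Proof.
by move=> [mr mi] mg; split; [exact: (measurableT_comp mr mg)|exact: (measurableT_comp mi mg)].
Qed.

Lemma meas_pair (f : T1 -> T2) (g : T1 -> T3) : measurable_fun [set: T1] f ->
  measurable_fun [set: T1] g -> measurable_fun [set: T1] (fun x => (f x, g x)).
Proof. by move=> mf mg; apply/measurable_fun_pairP; split. Qed.

End measurable_sections.

(** * Bounded kernels as integral operators *)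

Section bounded_kernels.
Context {d : measure_display} {V : measurableType d} {R : realType}.
Variable mu : probability V R.
Local Notation mu2 := (mu \x mu)%E.
Local Notation H1 := (L2 mu).
Local Notation H2 := (L2 (mu \x mu)%E).
Local Notation ip1 := (ip (P := mu)).
Local Notation ip2 := (ip (P := (mu \x mu)%E)).
Local Notation nr1 := (nr ip1).
Local Notation nr2 := (nr ip2).
Local Notation hip1 := (ip_semi_inner mu).
Local Notation hip2 := (ip_semi_inner (mu \x mu)%E).
Local Notation tens := (tens (mu := mu)).
Local Notation form := (form ip2 tens).
Implicit Types (u v : H1).

(** The bound holds at every point, so that every row and column is square-integrable and the
    integral operator has a value everywhere. *)
Record bkernel := BKernel {
  bk :> V * V -> R[i];
  bk_meas : cmeasurable bk;
  bk_bound : exists C : R, 0 <= C /\ forall z, nc (bk z) <= C }.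

Implicit Types (A K L : bkernel).

Lemma bkL2_subproof K : inL2 mu2 K.
Proof. by case: (bk_bound K) => C [_ hC]; exact: inL2_bound (bk_meas K) hC. Qed.
Definition bkL2 K : H2 := MkL2 (bkL2_subproof K).

Lemma bk_row_meas K x : cmeasurable (fun y => K (x, y)).
Proof.
apply: (@cmeasT_comp _ _ _ _ _ K (fun y => (x, y))); first exact: bk_meas.
by apply: meas_pair.
Qed.
Lemma bk_col_meas K y : cmeasurable (fun x => K (x, y)).
Proof.
apply: (@cmeasT_comp _ _ _ _ _ K (fun x => (x, y))); first exact: bk_meas.
by apply: meas_pair.
Qed.

Lemma col_subproof K y : inL2 mu (fun x => K (x, y)).
Proof. by case: (bk_bound K) => C [_ hC]; apply: (inL2_bound mu (bk_col_meas K y)) => x; exact: hC. Qed.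
Definition col K y : H1 := MkL2 (col_subproof K y).

Lemma row_cint K x u : cint mu (fun y => K (x, y) * u y).
Proof.
have [C [C0 hC]] := bk_bound K.
apply: (@cint_le _ _ _ _ (fun y => C * nc (u y))).
- by apply: cmeasM; [exact: bk_row_meas|exact: L2_cmeas].
- by move=> y; rewrite ncM ler_wpM2r ?nc_ge0.
- by apply: rintZ; case: (cint_L2 u).
Qed.

Definition app_fun K u x := cintegral mu (fun y => K (x, y) * u y).

Lemma cint_snd u : cint mu2 (fun z => u z.2).
Proof.
have := cint_prod (cint_bound mu (@cmeas_cst _ V R 1) (fun x => lexx _)) (cint_L2 u).
by congr cint; apply/funext => z; rewrite mul1r.
Qed.

Lemma app_cint2 K u : cint mu2 (fun z => K z * u z.2).
Proof.
have [C [C0 hC]] := bk_bound K; have [mu' ru] := cint_snd u.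
apply: (@cint_le _ _ _ _ (fun z => C * nc (u z.2))).
- by apply: cmeasM => //; exact: bk_meas.
- by move=> y; rewrite ncM ler_wpM2r ?nc_ge0.
- exact: rintZ.
Qed.

Lemma nc_app_fun K (C : R) u x : 0 <= C -> (forall z, nc (K z) <= C) ->
  nc (app_fun K u x) <= C * nr1 u.
Proof.
move=> C0 hC; apply: le_trans (nc_CI (row_cint K x u)) _.
apply: (@le_trans _ _ (C * Int mu (fun y => nc (u y)))).
  rewrite -IntZ; last by case: (cint_L2 u).
  apply: le_Int; [by case: (row_cint K x u)|by apply: rintZ; case: (cint_L2 u)|].
  by move=> y; rewrite ncM ler_wpM2r ?nc_ge0.
by rewrite ler_wpM2l// Int_nc_le_nr.
Qed.

Lemma app_subproof K u : inL2 mu (app_fun K u).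
Proof.
have [C [C0 hC]] := bk_bound K.
apply: (@inL2_bound _ _ _ _ _ (C * nr1 u)); last by move=> x; exact: nc_app_fun.
have h := app_cint2 K u.
exact: (CI_fubini_meas (P1 := mu) (P2 := mu) h).
Qed.
Definition app K u : H1 := MkL2 (app_subproof K u).

Lemma appD K u v : app K (u + v) = app K u + app K v.
Proof.
apply: L2_ext => x; rewrite L2D /= /app_fun -CI_D; [|exact: row_cint..].
by apply: eq_CI => y; rewrite L2D mulrDr.
Qed.

Lemma appZ K a u : app K (a *: u) = a *: app K u.
Proof.
apply: L2_ext => x; rewrite L2Z /= /app_fun -CI_Z; last exact: row_cint.
by apply: eq_CI => y; rewrite L2Z mulrCA.
Qed.

Lemma appB K u v : app K (u - v) = app K u - app K v.
Proof. by rewrite -scaleN1r appD appZ scaleN1r. Qed.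

(** Integration ignores null sets, so the conclusion is an equality at every point. This is how a.e.
    identities between vectors become exact. *)
Lemma app_eq0 K u : nr1 u = 0 -> app K u = 0.
Proof.
move=> u0; have [C [C0 hC]] := bk_bound K; apply: L2_ext => x; rewrite L20.
apply: nc_eq0; apply/eqP; rewrite eq_le nc_ge0 andbT.
by have := nc_app_fun u x C0 hC; rewrite u0 mulr0.
Qed.

Lemma ip_app K u v : ip1 (app K u) v = form (bkL2 K) v u.
Proof.
rewrite /ip /inner /form /ip /inner.
have h : cint mu2 (fun z => K z * conjc (tens v u z)) by exact: (ip_cint (bkL2 K) (tens v u)).
rewrite -(CI_fubini1 h); last first.
  move=> x; have := cintZ (conjc (v x)) (row_cint K x u).
  by congr cint; apply/funext => y; rewrite /= conjcM conjcK; ring.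
apply: eq_CI => x; rewrite /= mulrC -CI_Z; last exact: row_cint.
by apply: eq_CI => y; rewrite conjcM conjcK; ring.
Qed.

Lemma nr_app_le K u : nr1 (app K u) <= nr2 (bkL2 K) * nr1 u.
Proof.
have [->|n0] := eqVneq (nr1 (app K u)) 0; first by rewrite mulr_ge0 ?nr_ge0.
have np : 0 < nr1 (app K u) by rewrite lt_neqAle eq_sym n0 nr_ge0.
rewrite -(ler_pM2r np) -expr2 (nr_sqr hip1) /sqn ip_app.
apply: le_trans (Re_le_nc _) _; apply: le_trans (op_bound_nr _ _ _) _.
by rewrite [nr1 _ * _]mulrC mulrA.
Qed.

Lemma op_bound_app K (s : R) : 0 <= s -> (forall u, nr1 (app K u) <= s * nr1 u) ->
  op_bound ip1 ip2 tens (bkL2 K) s.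
Proof.
move=> s0 h u v; rewrite -ip_app; apply: le_trans (nc_ip_le hip1 _ _) _.
by rewrite [nr1 u * _]mulrC mulrA ler_wpM2r ?nr_ge0.
Qed.

Lemma ip_col K L : ip2 (bkL2 K) (bkL2 L) =
  cintegral mu (fun y => ip1 (col K y) (col L y)).
Proof.
rewrite {1}/ip /inner -(CI_fubini2 (ip_cint (bkL2 K) (bkL2 L)))//.
by move=> y; exact: (ip_cint (col K y) (col L y)).
Qed.

Lemma sqn_col K : rint mu (fun y => sqn ip1 (col K y)) /\
  sqn ip2 (bkL2 K) = Int mu (fun y => sqn ip1 (col K y)).
Proof.
have -> : (fun y => sqn ip1 (col K y)) = fun y => Int mu (fun x => nc (K (x, y)) ^+ 2).
  by apply/funext => y; rewrite sqnE.
rewrite sqnE.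
by have [? ->] := Int_fubini2 (rint_sqr (bkL2 K)) (fun y => rint_sqr (col K y)).
Qed.

Lemma comp_cint A K : cint (mu2 \x mu)%E (fun w => A (w.1.1, w.2) * K (w.2, w.1.2)).
Proof.
have [C [C0 hC]] := bk_bound A; have [D [D0 hD]] := bk_bound K.
have m1 := @measurable_fst _ _ (V * V)%type V; have m2 := @measurable_snd _ _ (V * V)%type V.
have m11 := measurableT_comp (@measurable_fst _ _ V V) m1.
have m12 := measurableT_comp (@measurable_snd _ _ V V) m1.
apply: (@cint_bound _ _ _ _ _ (C * D)).
  apply: cmeasM.
    exact: (cmeasT_comp (bk_meas A) (meas_pair m11 m2)).
  exact: (cmeasT_comp (bk_meas K) (meas_pair m2 m12)).
by move=> w; rewrite ncM ler_pM ?nc_ge0.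
Qed.

Definition comp_fun A K z := cintegral mu (fun t => A (z.1, t) * K (t, z.2)).

Lemma comp_meas A K : cmeasurable (comp_fun A K).
Proof. exact: (CI_fubini_meas (P1 := mu2) (P2 := mu) (comp_cint A K)). Qed.

Lemma comp_funE A K x y : comp_fun A K (x, y) = app A (col K y) x.
Proof. by []. Qed.

Lemma comp_bound A K : exists C : R, 0 <= C /\ forall z, nc (comp_fun A K z) <= C.
Proof.
have [C [C0 hC]] := bk_bound A; have [D [D0 hD]] := bk_bound K.
exists (C * D); split; first exact: mulr_ge0.
move=> [x y]; apply: le_trans (nc_app_fun (col K y) x C0 hC) _.
rewrite ler_wpM2l//; apply: nr_ae_bound => //; apply: nearW => t; exact: hD.
Qed.

Definition comp A K : bkernel := BKernel (comp_meas A K) (comp_bound A K).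

Lemma col_comp A K y : col (comp A K) y = app A (col K y).
Proof. by apply: L2_ext => x. Qed.

Lemma app_comp A K u : app (comp A K) u = app A (app K u).
Proof.
apply: L2_ext => x /=; rewrite /app_fun.
have [C [C0 hC]] := bk_bound A; have [D [D0 hD]] := bk_bound K.
pose F (z : V * V) := A (x, z.1) * K z * u z.2.
have hF : cint mu2 F.
  have [mu' ru] := cint_snd u.
  apply: (@cint_le _ _ _ _ (fun z => C * D * nc (u z.2))).
  - apply: cmeasM => //; apply: cmeasM; last exact: bk_meas.
    exact: (cmeasT_comp (bk_meas A) (meas_pair (measurable_cst x) measurable_fst)).
  - by move=> z; rewrite !ncM ler_wpM2r ?nc_ge0// ler_pM ?nc_ge0.
  - exact: rintZ.
transitivity (cintegral mu (fun y => cintegral mu (fun t => F (t, y)))).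
  apply: eq_CI => y; rewrite mulrC [LHS]mulrC.
  rewrite /= /comp_fun/= mulrC -CI_Z; last exact: (row_cint A x (col K y)).
  by apply: eq_CI => t; rewrite /F/= mulrC.
rewrite CI_fubini2//; last first.
  move=> y; have := cintZ (u y) (row_cint A x (col K y)).
  by congr cint; apply/funext => t; rewrite /F/=; ring.
rewrite -CI_fubini1//; last first.
  move=> t; have := cintZ (A (x, t)) (row_cint K t u).
  by congr cint; apply/funext => y; rewrite /F/=; ring.
apply: eq_CI => t; rewrite /= /app_fun -CI_Z; last exact: row_cint.
by apply: eq_CI => y; rewrite /F/=; ring.
Qed.

Definition hermitian K := forall x y, K (x, y) = conjc (K (y, x)).

Lemma ip_app_herm A u v : hermitian A -> ip1 (app A u) v = ip1 u (app A v).
Proof.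
move=> hA; rewrite (siJ hip1 u) !ip_app /form /ip /inner.
have h := ip_cint (bkL2 A) (tens u v).
have h1 : cint mu2 (fun z => bkL2 A z * conjc (tens v u z)) by exact: (ip_cint (bkL2 A)).
rewrite -CI_J//.
rewrite -(CI_fubini1 h1); last first.
  move=> x; have := cintZ (conjc (v x)) (row_cint A x u).
  by congr cint; apply/funext => y; rewrite /= conjcM conjcK; ring.
have h2 := cintJ h; rewrite -(CI_fubini2 h2); last first.
  move=> x; have := cintZ (conjc (v x)) (row_cint A x u).
  congr cint; apply/funext => y; rewrite /= !conjcM !conjcK (hA x y); ring.
apply: eq_CI => x; apply: eq_CI => y /=.
by rewrite !conjcM !conjcK (hA x y); ring.
Qed.

Lemma ip_comp_herm A K L : hermitian A ->
  ip2 (bkL2 (comp A K)) (bkL2 L) = ip2 (bkL2 K) (bkL2 (comp A L)).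
Proof.
by move=> hA; rewrite !ip_col; apply: eq_CI => y; rewrite !col_comp ip_app_herm.
Qed.

(** The squared Hilbert-Schmidt norm is the integral of the squared norms of the columns, and
    composition with [A] acts on each column of [K]. *)
Lemma nr_comp_le A K (s : R) : 0 <= s -> (forall u, nr1 (app A u) <= s * nr1 u) ->
  nr2 (bkL2 (comp A K)) <= s * nr2 (bkL2 K).
Proof.
move=> s0 hs; rewrite -ler_sqr ?nnegrE ?mulr_ge0 ?nr_ge0// exprMn !(nr_sqr hip2).
have [r1 ->] := sqn_col (comp A K); have [r2 ->] := sqn_col K.
rewrite -IntZ//; apply: le_Int => //; first exact: rintZ.
move=> y; rewrite col_comp -!(nr_sqr hip1) -exprMn.
by rewrite ler_sqr ?nnegrE ?mulr_ge0 ?nr_ge0.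
Qed.

End bounded_kernels.

Section bounded_kernel_algebra.
Context {d : measure_display} {V : measurableType d} {R : realType}.
Variable mu : probability V R.
Local Notation mu2 := (mu \x mu)%E.
Local Notation H1 := (L2 mu).
Local Notation H2 := (L2 (mu \x mu)%E).
Local Notation ip1 := (ip (P := mu)).
Local Notation ip2 := (ip (P := (mu \x mu)%E)).
Local Notation nr1 := (nr ip1).
Local Notation nr2 := (nr ip2).
Local Notation sqn1 := (sqn ip1).
Local Notation sqn2 := (sqn ip2).
Local Notation hip1 := (ip_semi_inner mu).
Local Notation hip2 := (ip_semi_inner (mu \x mu)%E).
Local Notation bkernel := (@bkernel _ V R).
Local Notation bkL2 := (bkL2 mu).
Local Notation app := (app (mu := mu)).
Local Notation col := (col mu).
Local Notation comp := (comp mu).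
Implicit Types (A K L : bkernel) (u v : H1).

Lemma axpy_bound K (a : R[i]) L :
  exists C : R, 0 <= C /\ forall z, nc (K z + a * L z) <= C.
Proof.
have [C [C0 hC]] := bk_bound K; have [D [D0 hD]] := bk_bound L.
exists (C + nc a * D); split; first by rewrite addr_ge0 ?mulr_ge0 ?nc_ge0.
by move=> z; rewrite (le_trans (ncD _ _))// lerD// ncM ler_wpM2l ?nc_ge0.
Qed.

Definition axpy K (a : R[i]) L : bkernel :=
  BKernel (cmeasD (bk_meas K) (cmeasZ a (bk_meas L))) (axpy_bound K a L).

Lemma bkL2_axpy K a L : bkL2 (axpy K a L) = bkL2 K + a *: bkL2 L.
Proof. exact: L2_ext. Qed.

Lemma col_axpy K a L y : col (axpy K a L) y = col K y + a *: col L y.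
Proof. exact: L2_ext. Qed.

Lemma app_axpy K a L u : app (axpy K a L) u = app K u + a *: app L u.
Proof.
apply: L2_ext => x; rewrite L2D L2Z /= /app_fun -CI_Z; last exact: row_cint.
rewrite -CI_D; [|exact: row_cint|by apply: cintZ; exact: row_cint].
by apply: eq_CI => y /=; ring.
Qed.

Definition opn A : R := sup [set r | exists2 u : H1, nr1 u <= 1 & r = nr1 (app A u)].

Lemma opn_has_sup A : has_sup [set r | exists2 u : H1, nr1 u <= 1 & r = nr1 (app A u)].
Proof.
split; first by exists (nr1 (app A 0)), 0 => //; rewrite nr0 ?ler01//; exact: hip1.
exists (nr2 (bkL2 A)) => _ [u u1 ->]; apply: le_trans (nr_app_le _ _) _.
by rewrite -[leRHS]mulr1 ler_wpM2l ?nr_ge0.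
Qed.

Lemma opn_ge0 A : 0 <= opn A.
Proof.
apply: le_trans (nr_ge0 ip1 (app A 0)) _; apply: sup_upper_bound (opn_has_sup A) _ _.
by exists 0 => //; rewrite (nr0 hip1).
Qed.

Lemma opn_le A u : nr1 (app A u) <= opn A * nr1 u.
Proof.
have [u0|u0] := eqVneq (nr1 u) 0; first by rewrite app_eq0// (nr0 hip1) u0 mulr0.
have up : 0 < nr1 u by rewrite lt_neqAle eq_sym u0 nr_ge0.
have : nr1 (app A ((nr1 u)^-1%:C%C *: u)) <= opn A.
  apply: sup_upper_bound (opn_has_sup A) _ _; eexists; last reflexivity.
  by rewrite (nrZ hip1) nc_real ger0_norm ?invr_ge0 ?nr_ge0// mulVf.
rewrite appZ (nrZ hip1) nc_real ger0_norm ?invr_ge0 ?nr_ge0// mulrC.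
by rewrite ler_pdivrMr.
Qed.

Lemma opn_adherent A e : 0 < e -> exists2 u, nr1 u <= 1 & opn A - e < nr1 (app A u).
Proof.
move=> e0; have [_ [u u1 ->] h] := sup_adherent e0 (opn_has_sup A).
by exists u.
Qed.

(** * Powers of a Hermitian operator of norm one *)

Section contraction_powers.
Variable A : bkernel.
Hypothesis hA : hermitian A.
Hypothesis A_le1 : forall u, nr1 (app A u) <= nr1 u.
Hypothesis A_sup : forall e, 0 < e -> exists2 u, nr1 u <= 1 & 1 - e < nr1 (app A u).

(** [pw n] is the power [n + 1] of [A]. The members [pw n.*2] used below are thus odd powers;
    consecutive ones differ by the square of [A], which therefore fixes their limit. *)
Definition pw n : bkernel := iter n (comp A) A.

Lemma app_pw n u : app (pw n) u = iter n.+1 (app A) u.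
Proof. by elim: n => //= n ih; rewrite app_comp ih. Qed.

Lemma ip_pw_shift k n m :
  ip2 (bkL2 (pw (n + k))) (bkL2 (pw m)) = ip2 (bkL2 (pw n)) (bkL2 (pw (m + k))).
Proof.
elim: k m => [|k ih] m; first by rewrite !addn0.
by rewrite addnS /= (ip_comp_herm mu _ _ hA) -[comp A (pw m)]/(pw m.+1) ih addSnnS.
Qed.

Let e n := sqn2 (bkL2 (pw n)).

(** Factors of [A] can be moved across the inner product, so it depends on the total degree only,
    and this degree is even. Distances between these powers are thereby expressed through the single
    sequence [e]. *)
Lemma ip_pw_even i j : ip2 (bkL2 (pw i.*2)) (bkL2 (pw j.*2)) = (e (i + j))%:C%C.
Proof.
wlog ij : i j / (i <= j)%N.
  move=> h; have [/h//|/ltnW/h] := leqP i j.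
  by move=> E; rewrite (siJ hip2) E conjc_realC addnC.
have -> : pw j.*2 = pw (i + j + (j - i)) by congr pw; lia.
rewrite -ip_pw_shift (_ : (i.*2 + (j - i))%N = (i + j)%N); last by lia.
exact: (ip_sqn hip2).
Qed.

Let nr_pw_le n : nr2 (bkL2 (pw n.+1)) <= nr2 (bkL2 (pw n)).
Proof. by rewrite -[leRHS]mul1r; apply: nr_comp_le => // u; rewrite mul1r. Qed.

Let e_noninc : nonincreasing_seq e.
Proof.
apply/nonincreasing_seqP => n; rewrite /e -!(nr_sqr hip2).
by rewrite ler_sqr ?nnegrE ?nr_ge0.
Qed.

(* Log-convexity of the norms of the iterates [A^n u]. *)
Lemma iter_app_ge u n : nr1 u <= 1 ->
  nr1 (app A u) ^+ n.+1 <= nr1 (iter n.+1 (app A) u).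
Proof.
move=> u1; pose a k := nr1 (iter k (app A) u).
have a0 k : 0 <= a k by exact: nr_ge0.
have lc k : a k.+1 ^+ 2 <= a k * a k.+2.
  rewrite (nr_sqr hip1) /sqn {1}iterS (ip_app_herm _ _ hA) -!iterS.
  by apply: le_trans (Re_le_nc _) (nc_ip_le hip1 _ _).
(* By [lc] the ratios [a k.+1 / a k] do not decrease, and the first one is at least [a 1] because
   [a 0 <= 1]. *)
have st k : a 1%N * a k <= a k.+1.
  elim: k => [|k ih]; first by rewrite -[leRHS]mulr1 ler_wpM2l.
  have [ak|ak] := eqVneq (a k) 0.
    have ak1 : a k.+1 <= 0 by rewrite -ak; exact: A_le1.
    have -> : a k.+1 = 0 by apply/eqP; rewrite eq_le ak1 a0.
    rewrite mulr0; exact: a0.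
  have akp : 0 < a k by rewrite lt_neqAle eq_sym ak a0.
  rewrite -(ler_pM2l akp) (le_trans _ (lc k))// expr2 mulrA.
  by rewrite ler_wpM2r// mulrC.
elim: n => [|n ih]; first by rewrite expr1.
by rewrite exprS (le_trans _ (st n.+1))// ler_wpM2l ?nr_ge0.
Qed.

Lemma bernoulli (x : R) n : 0 <= x <= 1 -> 1 - n%:R * x <= (1 - x) ^+ n.
Proof.
move=> /andP[x0 x1]; elim: n => [|n ih]; first by rewrite mul0r subr0 expr0.
rewrite exprS; apply: (@le_trans _ _ ((1 - x) * (1 - n%:R * x))).
  have : 0 <= n%:R * (x * x) by rewrite !mulr_ge0.
  by rewrite -[n.+1]addn1 natrD; lra.
by rewrite ler_wpM2l// subr_ge0.
Qed.

(** The Hilbert-Schmidt norm dominates the operator norm, and [iter_app_ge] at a near-maximizing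
    vector bounds the latter below by [(1 - y) ^+ n.+1] for arbitrarily small [y]. This keeps the
    limit of the powers from vanishing. *)
Lemma nr_pw_ge1 n : 1 <= nr2 (bkL2 (pw n)).
Proof.
apply/ler_addgt0Pr => x x0.
pose y := Num.min 1 (x / n.+1%:R).
have y0 : 0 < y by rewrite lt_min ltr01 divr_gt0.
have y1 : y <= 1 by rewrite ge_min lexx.
have [u u1 hu] := A_sup y0.
have h1 : nr1 (app A u) ^+ n.+1 <= nr2 (bkL2 (pw n)).
  apply: le_trans (iter_app_ge n u1) _; rewrite -app_pw.
  by apply: le_trans (nr_app_le _ _) _; rewrite -[leRHS]mulr1 ler_wpM2l ?nr_ge0.
have h2 : (1 - y) ^+ n.+1 <= nr1 (app A u) ^+ n.+1.
  by rewrite lerXn2r ?nnegrE ?nr_ge0 ?subr_ge0// ltW.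
have h3 := @bernoulli y n.+1; have h4 : n.+1%:R * y <= x.
  by rewrite mulrC -ler_pdivlMr// ge_min lexx orbT.
have {h3} : 1 - n.+1%:R * y <= (1 - y) ^+ n.+1 by apply: h3; rewrite ltW.
by move: h1 h2 h4; lra.
Qed.

(** The uniform bound required by [L2_bounded_complete]. Columns keep norm at most [C] because [A]
    contracts, and one more application of [A] yields values at most [C * C]; the summand [C] serves
    the case [n = 0]. *)
Lemma pw_bounded : exists2 D : R, 0 <= D & forall n z, nc (pw n z) <= D.
Proof.
have [C [C0 hC]] := bk_bound A.
exists (C + C * C); first by rewrite addr_ge0// mulr_ge0.
have colC n y : nr1 (col (pw n) y) <= C.
  elim: n => [|n ih]; last by rewrite col_comp (le_trans (A_le1 _)).
  by apply: nr_ae_bound => //; apply: nearW => x; exact: hC.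
case=> [|n] [x y]; first by rewrite (le_trans (hC _))// lerDl mulr_ge0.
apply: le_trans (nc_app_fun (col (pw n) y) x C0 hC) _.
by rewrite (@le_trans _ _ (C * C))// ?ler_wpM2l// lerDr.
Qed.

(** The squared distance is [e n.*2 + e m.*2 - 2 * e (n + m)], and [e] converges, being
    nonincreasing and bounded below. *)
Lemma pw_cauchy x : 0 < x -> exists N, forall n m, (N <= n)%N -> (N <= m)%N ->
  nr2 (bkL2 (pw n.*2) - bkL2 (pw m.*2)) < x.
Proof.
move=> x0.
have e0 n : 0 <= e n by exact: (sqn_ge0 hip2).
have lb : has_lbound (range e) by exists 0 => _ [n _ <-].
have ec := nonincreasing_is_cvgn e_noninc lb.
have einf n : limn e <= e n by exact: nonincreasing_cvgn_ge.
have [N _ hN] : \forall n \near \oo, e n < limn e + x ^+ 2 / 2.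
  by apply: (cvgr_lt (limn e)) => //; rewrite ltrDl divr_gt0 ?exprn_gt0.
exists N => n m Nn Nm; rewrite -ltr_sqr ?nnegrE ?nr_ge0 ?ltW// (nr_sqr hip2).
rewrite (sqnB hip2) ip_pw_even /=.
have : e n.*2 < limn e + x ^+ 2 / 2 by apply: hN; rewrite /=; lia.
have : e m.*2 < limn e + x ^+ 2 / 2 by apply: hN; rewrite /=; lia.
have := einf (n + m)%N; rewrite /e; lra.
Qed.

(* The even powers of [A] converge to the projection onto the eigenspaces of
   [1] and [-1]; any nonzero column of the limit is an eigenvector of [A^2]. *)
Lemma square_eigenvector : exists2 u, nr1 u != 0 & app A (app A u) = u.
Proof.
have [D D0 hD] := pw_bounded.
have [G GD cvgG] := L2_bounded_complete (F := fun n => bkL2 (pw n.*2)) D0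
  (fun n => nearW _ (hD n.*2)) pw_cauchy.
pose K : bkernel := BKernel (L2_cmeas G) (ex_intro _ D (conj D0 GD)).
have KG : bkL2 K = G by exact: L2_ext.
have GN0 : sqn2 (bkL2 K) != 0.
  rewrite KG; have [N hN] := cvgG (1 / 2) (divr_gt0 ltr01 (ltr0n _ 2)).
  have := hN N (leqnn _); have := nr_pw_ge1 N.*2.
  have := nrD hip2 (bkL2 (pw N.*2) - G) G; rewrite subrK => h1 h2 h3.
  have : 0 < nr2 G by lra.
  by rewrite -(nr_sqr hip2) => /gt_eqF h; rewrite sqrf_eq0 h.
(* [pw N.+1.*2] is [A] applied twice to [pw N.*2], and both are near the limit, so the square of [A]
   fixes [K] up to a null function. *)
have KK : nr2 (bkL2 (axpy (comp A (comp A K)) (-1) K)) = 0.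
  apply/eqP; rewrite eq_le nr_ge0 andbT; apply/ler_addgt0Pr => x x0.
  have [N hN] := cvgG (x / 2) (divr_gt0 x0 (ltr0n _ 2)).
  have h1 := hN N (leqnn _); have h2 := hN N.+1 (leqnSn _).
  rewrite add0r bkL2_axpy scaleN1r.
  apply: le_trans (nrB_trans hip2 (bkL2 (pw N.+1.*2)) _ _) _.
  rewrite (splitr x) lerD//; last by rewrite KG ltW.
  have -> : bkL2 (comp A (comp A K)) - bkL2 (pw N.+1.*2) =
      bkL2 (comp A (comp A (axpy K (-1) (pw N.*2)))).
    apply: L2_ext => -[z y]; rewrite doubleS L2B /=.
    have E X : comp_fun mu A (comp A X) (z, y) = app A (app A (col X y)) z.
      by rewrite comp_funE col_comp.
    by rewrite !E col_axpy scaleN1r !appB L2B.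
  have le1 X : nr2 (bkL2 (comp A X)) <= nr2 (bkL2 X).
    by rewrite -[leRHS]mul1r; apply: nr_comp_le => // u; rewrite mul1r.
  rewrite (le_trans (le1 _))// (le_trans (le1 _))// bkL2_axpy scaleN1r KG.
  by rewrite (nrBC hip2) ltW.
have [r1 r2] := sqn_col mu (axpy (comp A (comp A K)) (-1) K).
have [r3 r4] := sqn_col mu K.
have aeK : {ae mu, forall y, sqn1 (col (axpy (comp A (comp A K)) (-1) K) y) = 0}.
  apply: (Int_eq0 r1); first by move=> y; exact: (sqn_ge0 hip1).
  by rewrite -r2 -(nr_sqr hip2) KK expr0n.
(* Almost every column is fixed up to a null function, and not almost every column is null, so some
   column has both properties. *)
have [y [y1 y2]] : exists y, sqn1 (col (axpy (comp A (comp A K)) (-1) K) y) = 0 /\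
    sqn1 (col K y) != 0.
  apply: contrapT => /forallNP h; move/eqP: GN0; apply.
  rewrite r4 -(Int0 mu); apply: ae_eq_Int; [exact: rint_meas r3|exact: measurable_cst|].
  apply: filterS aeK => y hy; apply/eqP/negP => /negP yn; exact: (h y).
pose g := col K y; have gAA : nr1 (app A (app A g) - g) = 0.
  have : col (axpy (comp A (comp A K)) (-1) K) y = app A (app A g) - g.
    by rewrite col_axpy !col_comp scaleN1r.
  by move=> E; rewrite /nr -E y1 sqrtr0.
(* For [g] itself the identity holds only a.e.; its image under the square of [A] satisfies it
   exactly, by [app_eq0]. *)
exists (app A (app A g)).
  apply: contra_neq y2 => g0; rewrite -(nr_sqr hip1).
  suff -> : nr1 (col K y) = 0 by rewrite expr0n.
  apply/eqP; rewrite eq_le nr_ge0 andbT -/g -{1}[g](subrK (app A (app A g))).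
  by apply: le_trans (nrD hip1 _ _) _; rewrite (nrBC hip1) gAA g0 addr0.
have := app_eq0 A gAA; rewrite appB => /eqP; rewrite subr_eq0 => /eqP E.
by rewrite E.
Qed.

(** When the square of [A] fixes [u], the vector [A u + u] is an eigenvector for 1 unless it is
    null, and then [u] is one for -1. *)
Lemma unit_eigenvector : exists (s : R) u, [/\ `|s| = 1, nr1 u != 0 & app A u = s%:C%C *: u].
Proof.
have [u u0 Au] := square_eigenvector.
have [h|h] := eqVneq (nr1 (app A u + u)) 0.
  exists (- 1), u; split => //; first by rewrite normrN1.
  have := app_eq0 A h; rewrite appD Au => /eqP; rewrite addr_eq0 => /eqP E.
  by rewrite rmorphN1 scaleN1r {2}E opprK.
exists 1, (app A u + u); split => //; first by rewrite normr1.
by rewrite appD Au scale1r addrC.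
Qed.

End contraction_powers.

Lemma top_eigenvector A : hermitian A -> 0 < opn A ->
  exists (lam : R) u, [/\ `|lam| = opn A, nr1 u = 1 & app A u = lam%:C%C *: u].
Proof.
move=> hA; move: (opn A) (opn_le A) (fun e => @opn_adherent A e) => s hle hadh s0.
have z0 : exists C : R, 0 <= C /\ forall z : V * V, nc (0 : R[i]) <= C.
  by exists 0; split => // _; rewrite nc0.
pose Z : bkernel := BKernel (@cmeas_cst _ (V * V)%type R 0) z0.
pose A' := axpy Z (s^-1)%:C%C A.
have appA' u : app A' u = (s^-1)%:C%C *: app A u.
  rewrite app_axpy (_ : app Z u = 0) ?add0r//; apply: L2_ext => x.
  by rewrite L20 /= /app_fun (eq_CI _ (g := fun=> 0)) ?CI_cst// => y; rewrite mul0r.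
have nA' u : nr1 (app A' u) = s^-1 * nr1 (app A u).
  by rewrite appA' (nrZ hip1) nc_real ger0_norm// invr_ge0 ltW.
have hA' : hermitian A'.
  by move=> x y; rewrite /= !add0r (hA x y) conjcM conjc_realC.
have A'1 u : nr1 (app A' u) <= nr1 u.
  by rewrite nA' mulrC ler_pdivrMr// mulrC; exact: hle.
have A'2 e : 0 < e -> exists2 u, nr1 u <= 1 & 1 - e < nr1 (app A' u).
  move=> e0; have [u u1 hu] := hadh _ (mulr_gt0 e0 s0).
  exists u; first exact: u1.
  by rewrite nA' mulrC ltr_pdivlMr// mulrBl mul1r.
have [t [u [t1 u0 Au]]] := unit_eigenvector hA' A'1 A'2.
exists (s * t), ((nr1 u)^-1%:C%C *: u); split.
- by rewrite normrM t1 mulr1 ger0_norm// ltW.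
- by rewrite (nrZ hip1) nc_real ger0_norm ?invr_ge0 ?nr_ge0// mulVf.
- rewrite appZ scalerA mulrC -scalerA; congr (_ *: _).
  have /(congr1 (fun w => s%:C%C *: w)) := Au.
  rewrite appA' !scalerA -!rmorphM mulfV ?gt_eqF// => <-.
  by rewrite scale1r.
Qed.

End bounded_kernel_algebra.

(** * Weak convergence to zero of bounded sequences *)

Section weakly_null.
Context {d : measure_display} {T : measurableType d} {R : realType}.
Variable P : probability T R.
Local Notation H := (L2 P).
Local Notation ipP := (ip (P := P)).
Local Notation nrP := (nr ipP).
Local Notation hip := (ip_semi_inner P).

Lemma cmeas_indic (E : set T) : measurable E -> cmeasurable (fun x => (\1_E x : R)%:C%C).
Proof. by move=> mE; apply: cmeas_real; exact: measurable_indic. Qed.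

Lemma inL2_indic (E : set T) : measurable E -> inL2 P (fun x => (\1_E x : R)%:C%C).
Proof.
move=> mE; apply: (@inL2_bound _ _ _ _ _ 1); first exact: cmeas_indic.
by move=> x; rewrite nc_real indicE; case: (_ \in _); rewrite ?normr1 ?normr0.
Qed.

Definition indL2 (E : set T) (mE : measurable E) : H := MkL2 (inL2_indic mE).

Lemma indL2E (E : set T) (mE : measurable E) x : indL2 mE x = (\1_E x : R)%:C%C.
Proof. by []. Qed.

Lemma Int_indic (E : set T) : measurable E -> (Int P (\1_E : T -> R))%:E = P E.
Proof.
move=> mE; rewrite EFin_Int; first by rewrite integral_indic// setIT.
apply: (@rint_bound _ _ _ _ _ 1); first exact: measurable_indic.
by move=> x; rewrite indicE; case: (_ \in _); rewrite ?normr1 ?normr0.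
Qed.

Variables (X : nat -> H) (c : R).
Hypothesis Xc : forall n, nrP (X n) <= c.

Definition weakly_null_on (D : H) :=
  forall e, 0 < e -> exists N, forall n, (N <= n)%N -> nc (ipP (X n) D) < e.

Local Notation W := weakly_null_on.

Let c0 : 0 <= c := le_trans (nr_ge0 _ _) (Xc 0).

Lemma weakly_nullD D D' : W D -> W D' -> W (D + D').
Proof.
move=> h h' e e0; have e2 : 0 < e / 2 by rewrite divr_gt0.
have [N {}h] := h _ e2; have [N' {}h'] := h' _ e2.
exists (maxn N N') => n; rewrite geq_max => /andP[/h {}h /h' {}h'].
rewrite (ipDr hip); apply: le_lt_trans (ncD _ _) _.
by move: h h'; lra.
Qed.

Lemma weakly_nullZ a D : W D -> W (a *: D).
Proof.
move=> h e e0; have a1 : 0 < nc a + 1 by rewrite ltr_wpDl ?nc_ge0.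
have [N {}h] := h _ (divr_gt0 e0 a1); exists N => n /h {}h.
rewrite (ipZr hip) ncM ncJ; apply: (@le_lt_trans _ _ ((nc a + 1) * nc (ipP (X n) D))).
  by rewrite ler_wpM2r ?nc_ge0// lerDl.
by rewrite mulrC -ltr_pdivlMr.
Qed.

(** The norms of the [X n] are bounded by [c], so a small change of the test vector changes all the
    inner products little. *)
Lemma weakly_null_lim D :
  (forall e, 0 < e -> exists2 D', W D' & nrP (D - D') < e) -> W D.
Proof.
move=> h e e0; have c1 : 0 < c + 1 by rewrite ltr_wpDl.
have e2 : 0 < e / 2 by rewrite divr_gt0.
have [D' hD' DD'] := h _ (divr_gt0 e2 c1).
have [N {}h] := hD' _ e2; exists N => n /h {}h {hD'}.
rewrite -[D](subrK D') (ipDr hip); apply: le_lt_trans (ncD _ _) _.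
rewrite (splitr e); apply: ltrD; last exact: h.
apply: le_lt_trans (nc_ip_le hip _ _) _.
apply: (@le_lt_trans _ _ ((c + 1) * nrP (D - D'))).
  by rewrite ler_wpM2r ?nr_ge0// (le_trans (Xc n))// lerDl.
by rewrite mulrC -ltr_pdivlMr.
Qed.

Lemma weakly_null_sum m (F : 'I_m -> H) : (forall i, W (F i)) -> W (\sum_(i < m) F i).
Proof.
move=> hF; elim/big_rec : _ => [e e0|i D _ hD]; last exact: weakly_nullD.
by exists 0%N => n _; rewrite (ip0r hip) nc0.
Qed.

(** The good test sets form a lambda-system: proper differences by linearity, increasing unions
    because the indicators converge in norm. It contains the pi-system [G], hence the sigma-algebra
    that [G] generates. *)
Lemma weakly_null_measurable (G : set (set T)) :
  @measurable _ T = <<s G >> -> setI_closed G ->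
  W (indL2 measurableT) ->
  (forall E (mE : measurable E), G E -> W (indL2 mE)) ->
  forall E (mE : measurable E), W (indL2 mE).
Proof.
move=> GE GI WT WG.
(* [indL2] takes a proof of measurability, so membership in [Q] quantifies over one; proof
   irrelevance removes the dependence in [QI]. *)
pose Q := [set E : set T | exists mE : measurable E, W (indL2 mE)].
have QI E (mE : measurable E) : Q E -> W (indL2 mE).
  by move=> [mE']; rewrite (Prop_irrelevance mE mE').
suff QG : <<s G >> `<=` Q by move=> E mE; apply: QI; apply: QG; rewrite -GE.
apply: lambda_system_subset => //; last first.
  move=> E GE'; have mE : measurable E by rewrite GE; exact: sub_gen_smallest.
  by exists mE; exact: WG.
split => //.
- by exists measurableT.
- move=> A B BA [mA WA] [mB WB]; have mAB := measurableD mA mB; exists mAB.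
  have -> : indL2 mAB = indL2 mA + (-1) *: indL2 mB.
    apply: L2_ext => x; rewrite L2D L2Z /= mulN1r !indicE in_setD.
    have [xA|xA] := boolP (x \in A); have [xB|xB] := boolP (x \in B) => /=;
      apply: eqC => /=; rewrite ?oppr0 ?subrr ?subr0 ?addr0//.
    by exfalso; move/negP: xA; apply; apply/mem_set/BA/set_mem.
  by apply: weakly_nullD => //; exact: weakly_nullZ.
- move=> F ndF QF; have mF i : measurable (F i) by case: (QF i).
  have mU := bigcupT_measurable F mF; exists mU.
  apply: weakly_null_lim => e e0.
  have hcv : (Int P (\1_(F i) : T -> R))%:E @[i --> \oo] -->
      (Int P (\1_(\bigcup_k F k) : T -> R))%:E.
    rewrite (Int_indic mU) (_ : (fun i => _) = P \o F).
      exact: nondecreasing_cvg_mu.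
    by apply/funext => i; rewrite /= Int_indic.
  move: hcv => /fine_cvgP[_] /cvgrPdist_lt /(_ _ (exprn_gt0 2 e0)).
  move=> [N _ /(_ N (leqnn _))] /= hN; exists (indL2 (mF N)); first exact: QI.
  rewrite -ltr_sqr ?nnegrE ?nr_ge0 ?ltW// (nr_sqr hip) sqnE.
  apply: le_lt_trans hN; apply: le_trans (ler_norm _).
  have ri E : measurable E -> rint P (\1_E : T -> R).
    move=> mE; apply: (@rint_bound _ _ _ _ _ 1); first exact: measurable_indic.
    by move=> x; rewrite indicE; case: (_ \in _); rewrite ?normr1 ?normr0.
  rewrite -IntB ?ri//; apply: le_Int; [exact: rint_sqr|exact: rintB (ri _ mU) (ri _ (mF N))|].
  move=> x; rewrite L2B !indL2E -rmorphB nc_real real_normK ?num_real// !indicE.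
  have [xN|xN] := boolP (x \in F N).
    have -> : x \in \bigcup_k F k by apply/mem_set; exists N => //; exact: set_mem.
    by rewrite subrr expr0n.
  by rewrite subr0; case: (_ \in _); rewrite ?expr1n ?expr0n.
Qed.

Hypothesis W_indic : forall E (mE : measurable E), W (indL2 mE).

(** The sum counts the integers from 1 to [m] that are at most [y]: for nonnegative [y] it is the
    integer part of [y], capped at [m]. *)
Lemma staircase_ge (y : R) m : m%:R <= y ->
  \sum_(k < m) ((k.+1%:R <= y)%R%:R : R) = m%:R.
Proof.
elim: m => [|m ih] my; first by rewrite big_ord0.
rewrite big_ord_recr /= my ih; last by rewrite (le_trans _ my)// ler_nat.
by rewrite -natr1.
Qed.

Lemma staircase_le (y : R) m : 0 <= y -> \sum_(k < m) ((k.+1%:R <= y)%R%:R : R) <= y.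
Proof.
move=> y0; elim: m => [|m ih]; first by rewrite big_ord0.
rewrite big_ord_recr /=; have [my|my] := leP m.+1%:R y; last by rewrite addr0.
rewrite staircase_ge; first by rewrite natr1.
by rewrite (le_trans _ my)// ler_nat.
Qed.

Lemma staircase_approx (y : R) m : 0 <= y -> y <= m%:R ->
  y - 1 <= \sum_(k < m) ((k.+1%:R <= y)%R%:R : R).
Proof.
move=> y0; elim: m => [|m ih] my; first by rewrite big_ord0; move: my; lra.
rewrite big_ord_recr /=; have [ym|ym] := leP y m%:R.
  by rewrite (le_trans (ih ym))// lerDl.
rewrite staircase_ge; last exact: ltW.
move: my; rewrite -natr1 => my.
by apply: (@le_trans _ _ m%:R); [rewrite lerBlDr|rewrite lerDl].
Qed.

(** The average of the indicators of the [m] level sets [k + 1 <= m h] differs from [h] by at most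
    [1 / m] everywhere, since it is the integer part of [m h] divided by [m]. *)
Lemma weakly_null_unit (D : H) (h : T -> R) : measurable_fun [set: T] h ->
  (forall x, 0 <= h x <= 1) -> (forall x, D x = (h x)%:C%C) -> W D.
Proof.
move=> mh h01 Dh; apply: weakly_null_lim => e e0.
pose m := (Num.truncn (e^-1)).+1.
have em : e^-1 < m%:R by rewrite /m truncnS_gt.
have m0 : 0 < m%:R :> R by [].
have mE (k : nat) : measurable [set x | k.+1%:R <= m%:R * h x].
  rewrite -[X in measurable X]setTI; apply: measurable_fun_le => //.
  exact: measurable_funM.
exists ((m%:R^-1)%:C%C *: \sum_(k < m) indL2 (mE k)).
  by apply: weakly_nullZ; apply: weakly_null_sum => k; exact: W_indic.
apply: (@le_lt_trans _ _ m%:R^-1); last first.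
  by rewrite -[ltRHS]invrK ltf_pV2 ?posrE ?invr_gt0.
apply: nr_ae_bound; first by rewrite invr_ge0.
apply: nearW => x; rewrite L2B L2Z L2_sum Dh.
have -> : \sum_(i < m) indL2 (mE i) x = (\sum_(k < m) ((k.+1%:R <= m%:R * h x)%R%:R : R))%:C%C.
  rewrite rmorph_sum; apply: eq_bigr => k _ /=; rewrite indicE; congr ((nat_of_bool _)%:R%:C)%C.
  by apply/idP/idP; [move/set_mem|move=> ?; apply/mem_set].
rewrite -rmorphM -rmorphB nc_real; have /andP[h0 h1] := h01 x.
have y0 : 0 <= m%:R * h x by rewrite mulr_ge0.
have ym : m%:R * h x <= m%:R by rewrite -[leRHS]mulr1 ler_wpM2l.
have s1 := staircase_le m y0; have s2 := staircase_approx y0 ym.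
set S := \sum_(k < m) _ in s1 s2 *.
have hE : h x = m%:R^-1 * (m%:R * h x) by rewrite mulKf// gt_eqF.
rewrite {1}hE -mulrBr normrM ger0_norm ?invr_ge0// -[leRHS]mulr1 ler_wpM2l ?invr_ge0//.
by rewrite ler_norml; apply/andP; split; move: s1 s2; lra.
Qed.

Lemma weakly_null_bounded (D : H) (C : R) : (forall x, nc (D x) <= C) -> W D.
Proof.
move=> DC; have [mr mi] := L2_cmeas D.
have C0 : 0 <= C by apply: le_trans (nc_ge0 _) (DC point).
have C1 : 0 < 2 * (C + 1) by lra.
have part (g : T -> R) : measurable_fun [set: T] g -> (forall x, `|g x| <= C) ->
    exists2 D' : H, W D' & forall x, D' x = (g x)%:C%C.
  (* An affine change brings the values of [g] into the unit interval; [C + 1] keeps the denominator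
     positive when [C = 0]. *)
  move=> mg gC; pose h x := (g x + (C + 1)) / (2 * (C + 1)).
  have mh : measurable_fun [set: T] h.
    by apply: measurable_funM => //; exact: measurable_funD.
  have h01 x : 0 <= h x <= 1.
    rewrite /h; have := gC x; rewrite ler_norml => /andP[g1 g2].
    by apply/andP; split; [rewrite divr_ge0//; lra|rewrite ler_pdivrMr//; lra].
  have hL2 : inL2 P (fun x => (h x)%:C%C).
    apply: (@inL2_bound _ _ _ _ _ 1); first exact: cmeas_real.
    by move=> x; rewrite nc_real; have /andP[h0 h1] := h01 x; rewrite ger0_norm.
  exists ((2 * (C + 1))%:C%C *: MkL2 hL2 + (- (C + 1))%:C%C *: indL2 measurableT).
    apply: weakly_nullD; apply: weakly_nullZ => //.
    exact: (@weakly_null_unit _ h).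
  move=> x; rewrite L2D !L2Z /= indicT /= -!rmorphM -rmorphD; congr (_%:C)%C.
  by rewrite /h mulr1; field; lra.
have [D1 W1 E1] := part _ mr (fun x => le_trans (Re_norm_le _) (DC x)).
have [D2 W2 E2] := part _ mi (fun x => le_trans (Im_norm_le _) (DC x)).
have -> : D = D1 + (Complex 0 1) *: D2.
  apply: L2_ext => x; rewrite L2D L2Z E1 E2.
  by apply: eqC; rewrite ?ReD ?ImD ?ReM ?ImM /=; ring.
by apply: weakly_nullD => //; exact: weakly_nullZ.
Qed.

End weakly_null.

(** * Deflation and the spectral theorem *)

Section spectral_theorem.
Context {d : measure_display} {V : measurableType d} {R : realType}.
Variable mu : probability V R.
Local Notation mu2 := (mu \x mu)%E.
Local Notation H1 := (L2 mu).
Local Notation H2 := (L2 (mu \x mu)%E).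
Local Notation ip1 := (ip (P := mu)).
Local Notation ip2 := (ip (P := (mu \x mu)%E)).
Local Notation nr1 := (nr ip1).
Local Notation nr2 := (nr ip2).
Local Notation sqn1 := (sqn ip1).
Local Notation sqn2 := (sqn ip2).
Local Notation hip1 := (ip_semi_inner mu).
Local Notation hip2 := (ip_semi_inner (mu \x mu)%E).
Local Notation tens := (tens (mu := mu)).
Local Notation bkernel := (@bkernel _ V R).
Local Notation bkL2 := (bkL2 mu).
Local Notation app := (app (mu := mu)).
Local Notation opn := (opn mu).
Implicit Types (A : bkernel) (u v : H1).

(** The boolean is false once the operator norm is 0: the index then stays out of the expansion and
    the kernel is passed on unchanged, which covers finite rank. Choosing an eigenvalue of maximal
    modulus ties the operator norms to the summable squares of the eigenvalues. *)
Record deflation_step A (lam : R) (u : H1) (bb : bool) (A' : bkernel) : Prop := {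
  ds_herm : hermitian A';
  ds_true : bb -> [/\ 0 < opn A, `|lam| = opn A, nr1 u = 1 & app A u = lam%:C%C *: u];
  ds_false : ~~ bb -> opn A = 0;
  ds_ker : bkL2 A' = bkL2 A - (if bb then lam%:C%C *: tens u u else 0);
  ds_app : forall v, app A' v = app A v - (if bb then (lam%:C%C * ip1 v u) *: u else 0) }.

Lemma deflation_exists A : hermitian A ->
  exists (s : R * H1 * bool) (A' : bkernel), deflation_step A s.1.1 s.1.2 s.2 A'.
Proof.
move=> hA; have [A0|A0] := eqVneq (opn A) 0.
  exists (0, 0, false), A; split => //=; first by rewrite subr0.
  by move=> v; rewrite subr0.
have Ap : 0 < opn A by rewrite lt_neqAle eq_sym A0 opn_ge0.
have [lam [u [ln u1 Au]]] := top_eigenvector hA Ap.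
have l0 : lam != 0 by rewrite -normr_gt0 ln.
have [C [C0 hC]] := bk_bound A.
pose D := `|lam|^-1 * C.
have D0 : 0 <= D by rewrite mulr_ge0// invr_ge0.
(* An eigenfunction is [lam^-1] times its image under [A], hence bounded, so subtracting its
   rank-one kernel gives a bounded kernel again. *)
have uD x : nc (u x) <= D.
  have -> : u = (lam^-1)%:C%C *: app A u.
    by rewrite Au scalerA -rmorphM mulVf// scale1r.
  rewrite L2Z ncM nc_real normfV ler_wpM2l ?invr_ge0//.
  by apply: le_trans (nc_app_fun u x C0 hC) _; rewrite u1 mulr1.
have TD : exists E : R, 0 <= E /\ forall z, nc (tens u u z) <= E.
  exists (D * D); split; first by rewrite mulr_ge0.
  by move=> z; rewrite /= ncM ncJ ler_pM ?nc_ge0.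
pose Tk : bkernel := BKernel (L2_cmeas (tens u u)) TD.
have appT v : app Tk v = ip1 v u *: u.
  apply: L2_ext => x; rewrite L2Z /= /app_fun mulrC /ip /inner.
  rewrite -CI_Z; last exact: ip_cint.
  by apply: eq_CI => y /=; ring.
exists (lam, u, true), (axpy A (- lam)%:C%C Tk); split => //=.
- move=> x y /=; rewrite conjcD (hA x y) !conjcM conjcK conjc_realC; congr (_ + _).
  by ring.
- rewrite bkL2_axpy; congr (_ + _); rewrite rmorphN scaleNr; congr (- (_ *: _)).
  exact: L2_ext.
- by move=> v; rewrite app_axpy appT scalerA rmorphN mulNr scaleNr.
Qed.

Section deflation_sequence.
Variables (A : nat -> bkernel) (lam : nat -> R) (f : nat -> H1) (b : pred nat).
Hypothesis hA0 : hermitian (A 0%N).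
Hypothesis step : forall n, deflation_step (A n) (lam n) (f n) (b n) (A n.+1).

Lemma deflated_hermitian n : hermitian (A n).
Proof. by case: n => [//|n]; exact: (ds_herm (step n)). Qed.

(** The two claims support each other in the induction. If [A n] kills [f m], symmetry makes its
    eigenvector [f n] orthogonal to [f m]; and subtracting the rank-one kernel of a vector
    orthogonal to [f m] keeps [f m] killed. *)
Lemma deflated_kills n : (forall m, (m < n)%N -> b m -> app (A n) (f m) = 0) /\
  (forall m, (m < n)%N -> b m -> b n -> ip1 (f n) (f m) = 0).
Proof.
have orth n' : (forall m, (m < n')%N -> b m -> app (A n') (f m) = 0) ->
    forall m, (m < n')%N -> b m -> b n' -> ip1 (f n') (f m) = 0.
  move=> kill m mn bm bn; have [op0 ln _ An] := ds_true (step n') bn.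
  have l0 : (lam n')%:C%C != 0 :> R[i].
    by rewrite (fmorph_eq0 (real_complex R)) -normr_gt0 ln.
  apply: (mulfI l0); rewrite mulr0 -(siZl hip1) -An.
  rewrite ip_app_herm; last exact: deflated_hermitian.
  by rewrite kill// (ip0r hip1).
elim: n => [|n [kill on]]; first by split.
have kill' m : (m < n.+1)%N -> b m -> app (A n.+1) (f m) = 0.
  rewrite ltnS leq_eqVlt => /predU1P[->|mn] bm; rewrite (ds_app (step n)).
    rewrite bm; have [_ _ n1 ->] := ds_true (step n) bm.
    rewrite (ip_sqn hip1) -(nr_sqr hip1) n1 expr1n.
    by rewrite (rmorph1 (real_complex R)) mulr1 subrr.
  rewrite kill// sub0r; case: ifPn => [bn|_]; last by rewrite oppr0.
  by rewrite (siJ hip1) on// conjc0 mulr0 scale0r oppr0.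
by split => //; exact: orth.
Qed.

Lemma deflated_orthonormal : orthonormal_family ip1 b f.
Proof.
move=> i j bi bj; have [ij|ij|->] := ltngtP i j.
- by rewrite (siJ hip1) (deflated_kills j).2// conjc0.
- by rewrite (deflated_kills i).2.
- rewrite (ip_sqn hip1) -(nr_sqr hip1); have [_ _ -> _] := ds_true (step j) bj.
  by rewrite expr1n.
Qed.

Lemma deflated_kernel n : bkL2 (A n) = bkL2 (A 0%N) - partial tens lam f b n.
Proof.
elim: n => [|n ih]; first by rewrite /partial big_ord0 subr0.
by rewrite (ds_ker (step n)) ih partialS opprD addrA.
Qed.

Lemma ip_deflated_partial n : ip2 (bkL2 (A n)) (partial tens lam f b n) = 0.
Proof.
rewrite (ip_sumr hip2) big1// => i bi; rewrite (ipZr hip2).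
have -> : ip2 (bkL2 (A n)) (tens (f i) (f i)) = ip1 (app (A n) (f i)) (f i).
  by rewrite ip_app.
by rewrite (deflated_kills n).1// (ip0l hip1) mulr0.
Qed.

Lemma sqn_deflated n : sqn2 (bkL2 (A 0%N)) =
  sqn2 (bkL2 (A n)) + \sum_(i < n | b i) lam i ^+ 2.
Proof.
have E : bkL2 (A 0%N) = bkL2 (A n) + partial tens lam f b n.
  by rewrite (deflated_kernel n) subrK.
rewrite {1}E (sqnD hip2) ip_deflated_partial mulr0 addr0; congr (_ + _).
by apply: (sqn_partial hip2 (ip_tens (mu := mu)) _ deflated_orthonormal).
Qed.

Lemma sqn_deflated_ip n : (sqn2 (bkL2 (A n)))%:C%C = ip2 (bkL2 (A n)) (bkL2 (A 0%N)).
Proof.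
rewrite -(ip_sqn hip2) {2}(deflated_kernel n) (ipBr hip2).
by rewrite ip_deflated_partial subr0.
Qed.

Lemma opn_deflated n : opn (A n) ^+ 2 = if b n then lam n ^+ 2 else 0.
Proof.
case: ifPn => [bn|bn]; last by rewrite (ds_false (step n) bn) expr0n.
by have [_ <- _ _] := ds_true (step n) bn; rewrite real_normK ?num_real.
Qed.

(** The operator norm of [A n] is the modulus of the next eigenvalue, and by [sqn_deflated] the
    squares of the eigenvalues have bounded sums. *)
Lemma opn_deflated_to0 e : 0 < e -> exists N, forall n, (N <= n)%N -> opn (A n) < e.
Proof.
move=> e0.
have c : cvgn (series (fun n => opn (A n) ^+ 2)).
  apply: nondecreasing_is_cvgn.
    apply/nondecreasing_seqP => n.
    by rewrite /series/= big_nat_recr//= lerDl sqr_ge0.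
  exists (sqn2 (bkL2 (A 0%N))) => _ [n _ <-].
  rewrite (sqn_deflated n) /series/= big_mkord.
  rewrite (eq_bigr (fun i : 'I_n => if b i then lam i ^+ 2 else 0)).
    by rewrite -big_mkcond/= lerDr; exact: (sqn_ge0 hip2).
  by move=> i _; exact: opn_deflated.
have /cvgrPdist_lt /(_ _ (exprn_gt0 2 e0)) [N _ hN] := cvg_series_cvg_0 c.
exists N => n Nn; have := hN n Nn.
rewrite /= sub0r normrN ger0_norm ?sqr_ge0// ltr_sqr// nnegrE; last exact: ltW.
exact: opn_ge0.
Qed.

Lemma nr_deflated_le n : nr2 (bkL2 (A n)) <= nr2 (bkL2 (A 0%N)).
Proof.
apply: ler_wsqrtr; rewrite (sqn_deflated n) lerDl.
by apply: sumr_ge0 => i _; exact: sqr_ge0.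
Qed.

Lemma form_deflated n u v : nc (ip2 (bkL2 (A n)) (tens u v)) <=
  opn (A n) * (nr1 u * nr1 v).
Proof. exact: (op_bound_app (opn_ge0 mu (A n)) (opn_le (A n)) u v). Qed.

(* The remainders tend to 0 weakly, by testing them against rectangles; since
   [|A_n|^2 = <A_n, A_0>], this suffices for strong convergence. *)
Lemma deflated_to0 e : 0 < e -> exists N, forall n, (N <= n)%N -> nr2 (bkL2 (A n)) < e.
Proof.
move=> e0; pose X n := bkL2 (A n); pose c := nr2 (bkL2 (A 0%N)).
have Xc n : nr2 (X n) <= c by exact: nr_deflated_le.
pose G := [set B `*` C | B in @measurable _ V & C in @measurable _ V].
have Wrect (B C : set V) (mB : measurable B) (mC : measurable C)
    (mBC : measurable (B `*` C)) : weakly_null_on X (indL2 mu2 mBC).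
  move=> e' e'0; have [N hN] := opn_deflated_to0 e'0; exists N => n /hN.
  apply: le_lt_trans.
  (* The indicator of a rectangle is a rank-one kernel, so testing against it is controlled by the
     operator norm. *)
  have -> : indL2 mu2 mBC = tens (indL2 mu mB) (indL2 mu mC).
    apply: L2_ext => -[x y].
    rewrite -[RHS]/((\1_B x : R)%:C%C * conjc (\1_C y : R)%:C%C) indL2E conjc_realC -rmorphM.
    by rewrite !indicE in_setX -natrM mulnb.
  apply: le_trans (form_deflated n _ _) _; rewrite -[leRHS]mulr1.
  apply: ler_wpM2l; first exact: opn_ge0.
  have ind1 E (mE : measurable E) : nr1 (indL2 mu mE) <= 1.
    apply: nr_ae_bound => //; apply: nearW => x; rewrite indL2E nc_real indicE.
    by case: (_ \in _); rewrite ?normr1 ?normr0.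
  by rewrite -[leRHS]mulr1; apply: ler_pM; rewrite ?nr_ge0.
have GI : setI_closed G.
  move=> _ _ [B1 mB1 [C1 mC1 <-]] [B2 mB2 [C2 mC2 <-]].
  rewrite -setXI; exists (B1 `&` B2); first exact: measurableI.
  by exists (C1 `&` C2) => //; exact: measurableI.
have WT : weakly_null_on X (indL2 mu2 measurableT).
  have -> : indL2 mu2 measurableT = indL2 mu2 (measurableX measurableT measurableT).
    by apply: L2_ext => x; rewrite !indL2E !indicE setXTT.
  exact: Wrect.
have WG E (mE : measurable E) : G E -> weakly_null_on X (indL2 mu2 mE).
  by move=> [B mB [C mC BC]]; move: mE; rewrite -BC => mE; exact: Wrect.
have W_ind := weakly_null_measurable Xc (measurable_prod_measurableType V V) GI WT WG.
have [C [C0 hC]] := bk_bound (A 0%N).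
have W0 := weakly_null_bounded Xc W_ind (D := bkL2 (A 0%N)) hC.
have [N hN] := W0 _ (exprn_gt0 2 e0); exists N => n /hN.
rewrite -sqn_deflated_ip nc_real ger0_norm; last exact: (sqn_ge0 hip2).
by rewrite -(nr_sqr hip2) ltr_sqr// nnegrE ?nr_ge0// ltW.
Qed.

End deflation_sequence.

Lemma hermitian_eigen_expansion A : hermitian A ->
  exists (b : pred nat) (lam : nat -> R) (f : nat -> H1),
    eigen_expansion ip1 ip2 tens b lam f (bkL2 A).
Proof.
(* With hermiticity packed into a subtype every kernel has a successor, and the deflation sequence
   is the iteration of one choice function. *)
move=> hA; pose hbk := {B : bkernel | hermitian B}.
have next (B : hbk) : exists s : R * H1 * bool * hbk,
    deflation_step (sval B) s.1.1.1 s.1.1.2 s.1.2 (sval s.2).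
  have [s [B' sB]] := deflation_exists (svalP B).
  by exists (s, exist _ B' (ds_herm sB)).
have [g gP] := choice next.
pose S n : hbk := iter n (fun B => (g B).2) (exist _ A hA).
pose A_ n := sval (S n).
have st n : deflation_step (A_ n) (g (S n)).1.1.1 (g (S n)).1.1.2 (g (S n)).1.2 (A_ n.+1).
  exact: gP.
exists (fun n => (g (S n)).1.2), (fun n => (g (S n)).1.1.1), (fun n => (g (S n)).1.1.2).
have h0 : hermitian (A_ 0%N) by [].
split; first exact: (deflated_orthonormal h0 st).
move=> e e0; have [N hN] := deflated_to0 h0 st e0; exists N => n /hN.
by rewrite (deflated_kernel st).
Qed.

End spectral_theorem.

Lemma ecvg0P (R : realType) (u : nat -> \bar R) : (forall n, (0 <= u n)%E) ->
  u n @[n --> \oo] --> 0%E <->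
  forall e : R, 0 < e -> exists N, forall n, (N <= n)%N -> (u n < e%:E)%E.
Proof.
move=> u0; split=> [/fine_cvgP[[M _ hM]] /cvgrPdist_lt h e e0|h].
  have [N _ hN] := h e e0; exists (maxn M N) => n; rewrite geq_max => /andP[nM nN].
  have := hN n nN; rewrite /= sub0r normrN ger0_norm; last exact: fine_ge0.
  by rewrite -lte_fin fineK//; exact: hM.
have fin n (e : R) : (u n < e%:E)%E -> u n \is a fin_num.
  by move=> une; rewrite ge0_fin_numE// (lt_trans une)// ltry.
apply/fine_cvgP; split.
  by have [N hN] := h 1 ltr01; exists N => // n /hN /fin.
apply/cvgrPdist_lt => e e0; have [N hN] := h e e0; exists N => // n /hN une.
rewrite /= sub0r normrN ger0_norm; last exact: fine_ge0.
by rewrite -lte_fin fineK//; exact: fin une.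
Qed.

(** * Completeness in the cut norm *)

Section class_M.
Context {d : measure_display} {V : measurableType d} {R : realType}.
Variable mu : probability V R.
Local Notation mu2 := (mu \x mu)%E.
Local Notation H1 := (L2 mu).
Local Notation H2 := (L2 (mu \x mu)%E).
Local Notation ip1 := (ip (P := mu)).
Local Notation ip2 := (ip (P := (mu \x mu)%E)).
Local Notation nr1 := (nr ip1).
Local Notation nr2 := (nr ip2).
Local Notation hip1 := (ip_semi_inner mu).
Local Notation hip2 := (ip_semi_inner (mu \x mu)%E).
Local Notation tens := (tens (mu := mu)).
Local Notation bkL2 := (bkL2 mu).
Local Notation expansion := (eigen_expansion ip1 ip2 tens).
Implicit Types (u : H2).

Lemma mp_swap : measure_preserving mu2 (fun z : V * V => (z.2, z.1)).
Proof.
have ms : measurable_fun [set: V * V] (fun z : V * V => (z.2, z.1)).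
  by apply: meas_pair; [exact: measurable_snd|exact: measurable_fst].
split => // A mA.
pose nu : {measure set (V * V) -> \bar R} :=
  measure_function_pushforward__canonical__measure_function_Measure mu2 ms.
rewrite [RHS](@product_measure_unique _ _ _ _ _ mu mu nu)// => B C mB mC.
rewrite /nu /= /pushforward.
have -> : (fun z : V * V => (z.2, z.1)) @^-1` (B `*` C) = C `*` B.
  by apply/seteqP; split => -[x y] [].
by rewrite product_measure1E//= muleC.
Qed.

Lemma adjoint_subproof u : inL2 mu2 (fun z => conjc (u (z.2, z.1))).
Proof. exact: inL2J (inL2_comp mp_swap (L2P u)). Qed.
Definition adjoint u : H2 := MkL2 (adjoint_subproof u).

Lemma adjointB u v : adjoint (u - v) = adjoint u - adjoint v.
Proof. by apply: L2_ext => z; rewrite /= -conjcN -conjcD. Qed.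

Lemma nr_adjoint u : nr2 (adjoint u) = nr2 u.
Proof.
rewrite -(nr_L2comp mp_swap u) /nr !sqnE; congr Num.sqrt.
by apply: eq_Int => z /=; rewrite ncJ.
Qed.

Lemma self_adjointP u : self_adjoint mu u <-> nr2 (u - adjoint u) = 0.
Proof.
split=> [h|h]; first by apply: nr_ae_eq; exact: h.
by apply: filterS (ae_eq0_nr h) => z; rewrite L2B => /eqP; rewrite subr_eq0 => /eqP.
Qed.

Definition contraction u := {ae mu2, forall z, nc (u z) <= 1}.

Lemma calMP u : calM mu u <-> nr2 (u - adjoint u) = 0 /\ contraction u.
Proof.
split=> [[_ /self_adjointP ? /cLnorm_ooP ?]//|[? ?]].
by split; [exact: L2P|apply/self_adjointP|apply/cLnorm_ooP].
Qed.

(** The kernel is set to 0 off the points where both the bound and the symmetry hold. This set is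
    invariant under swapping the coordinates, so the result is Hermitian at every point. *)
Lemma hermitian_repr u : calM mu u -> exists A, hermitian A /\ nr2 (u - bkL2 A) = 0.
Proof.
move=> [_ usa /cLnorm_ooP u1].
pose swap (z : V * V) := (z.2, z.1).
pose good z := (nc (u z) <= 1) && (u z == conjc (u (swap z))).
have goodS z : good (swap z) = good z.
  suff h w : good w -> good (swap w).
    by apply/idP/idP => [/h|/h//]; case: z.
  move=> /andP[w1 /eqP w2]; apply/andP; split; first by rewrite -ncJ -w2.
  by rewrite -[in X in _ == X]/w; case: w w1 w2 => x y w1 w2; rewrite [u (x, y)]w2 conjcK.
have mswap : measurable_fun [set: V * V] swap := mp_swap.1.
have [mr mi] := L2_cmeas u.
have mgood : measurable_fun [set: V * V] good.
  apply: measurable_and.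
    by apply: measurable_fun_ler => //; apply: meas_nc; exact: L2_cmeas.
  rewrite (_ : (fun z => _) = fun z =>
      (complex.Re (u z) == complex.Re (u (swap z))) &&
      (complex.Im (u z) == - complex.Im (u (swap z)))); last first.
    by apply/funext => z; rewrite eq_complex ReJ ImJ.
  apply: measurable_and; apply: measurable_fun_eqr => //.
    exact: (measurableT_comp mr mswap).
  by apply: measurableT_comp => //; exact: (measurableT_comp mi mswap).
have mA : cmeasurable (fun z => if good z then u z else 0).
  split.
    rewrite (_ : (fun z => _) = fun z => if good z then complex.Re (u z) else 0).
      exact: measurable_fun_ifT.
    by apply/funext => z; case: ifPn.
  rewrite (_ : (fun z => _) = fun z => if good z then complex.Im (u z) else 0).
    exact: measurable_fun_ifT.
  by apply/funext => z; case: ifPn.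
have bA : exists C : R, 0 <= C /\ forall z, nc (if good z then u z else 0) <= C.
  exists 1; split => // z; case: ifPn => [/andP[]//|_]; by rewrite nc0.
exists (BKernel mA bA); split.
  move=> x y /=; rewrite -(goodS (x, y)) /swap/=; case: ifPn => [g|_]; last by rewrite conjc0.
  by have /andP[_ /eqP ->] := g; rewrite conjcK.
apply: nr_ae_eq; apply: filterS2 usa u1 => z /= z1 z2.
by rewrite /good z2 -z1 eqxx.
Qed.

Lemma calM_expansion u : calM mu u -> exists b lam f, expansion b lam f u.
Proof.
move=> /hermitian_repr[A [hA uA]].
have [b [lam [f [onf sA]]]] := hermitian_eigen_expansion mu hA.
exists b, lam, f; split => //; apply: (sums_to_ext hip2 sA).
by rewrite (nrBC hip2).
Qed.

Lemma contraction_nr u : contraction u -> nr2 u <= 1.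
Proof. exact: nr_ae_bound. Qed.

(** Passage from sums over a set of indices of bare functions to sums in [H2]. Off [D] the functions
    [f i] need not be square-integrable, hence a family [F] that agrees with them on [D] only. *)
Lemma spectral_sumP (D : set nat) (lam : nat -> R) (f : nat -> V -> R[i])
    (F : nat -> H1) (K : H2) :
  (forall i, D i -> f i = F i :> (V -> R[i])) ->
  spectral_sum mu D lam f K <-> sums_to ip2 tens lam F (fun i => `[< D i >]) K.
Proof.
move=> fF; rewrite /spectral_sum.
have E n : cLnorm mu2 2%:E (fun z => K z - \sum_(i < n | `[< D i >])
      (lam i)%:C%C * (f i z.1 * conjc (f i z.2))) =
    (nr2 (K - partial tens lam F (fun i => `[< D i >]) n))%:E.
  rewrite -cLnorm2_nr; congr (cLnorm _ _ _); apply/funext => z.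
  rewrite L2B /partial L2_sum; congr (_ - _); apply: eq_bigr => i /asboolP Di.
  by rewrite L2Z fF.
under eq_cvg do rewrite E.
split.
  move/ecvg0P => h e e0; have [|N hN] := h _ e e0; first by move=> n; rewrite lee_fin nr_ge0.
  by exists N => n /hN; rewrite lte_fin.
move=> h; apply/ecvg0P => [n|e e0]; first by rewrite lee_fin nr_ge0.
by have [N hN] := h e e0; exists N => n /hN; rewrite lte_fin.
Qed.

(** A relation, because the expansion of [u] is not unique; the estimates below hold for every
    choice of it. *)
Definition is_truncation u (al : R) (K : H2) := exists b lam f,
  expansion b lam f u /\ sums_to ip2 tens lam f (above b lam al) K.

Lemma truncationP u (al : R) : calM mu u -> 0 < al ->
  exists2 K : H2, truncation mu u al = K & is_truncation u al K.
Proof.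
move=> uM al0.
pose S := [set K | kernel_operator mu K /\
    exists (D : set nat) (lam : nat -> R) (f : nat -> V -> R[i]),
      spectral_decomposition mu u D lam f /\
      spectral_sum mu (D `&` [set i | al < `|lam i|]) lam f K].
have S0 : exists K, S K.
  have [b [lam [f [onf su]]]] := calM_expansion uM.
  have [N hN] := sums_to_above hip1 hip2 (ip_tens (mu := mu)) (conj onf su) al0.
  have hK := hN N (leqnn _).
  exists (partial tens lam f (above b lam al) N); split; first exact: L2P.
  exists [set i | b i], lam, (fun i => L2f (f i)); split.
    split; last first.
      apply/(spectral_sumP _ _ (F := f)) => //.
      rewrite (_ : (fun i => _) = b)//.
      by apply/funext => i /=; apply/idP/idP => [/asboolP|/asboolP].
    split; first by move=> i _; exact: L2P.
    by move=> i j bi bj; exact: onf.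
  apply/(spectral_sumP _ _ (F := f)) => //.
  rewrite (_ : (fun i => _) = above b lam al)//.
  apply/funext => i /=; rewrite /above; apply/idP/idP.
    by move=> /asboolP[/= -> ->].
  by move=> /andP[bi li]; apply/asboolP.
(* The set of candidates is inhabited, so [xget] does not fall back on its default value 0. *)
have /(xgetPex (fun=> 0)) : exists K, S K by [].
rewrite -/(truncation mu u al) => -[hK [D [lam [f [[[fL2 onf] su] sK]]]]].
pose F i : H1 := match pselect (D i) with left h => MkL2 (fL2 i h) | right _ => 0 end.
have fF i : D i -> f i = F i :> (V -> R[i]).
  by move=> Di; rewrite /F; case: pselect.
exists (MkL2 hK) => //; exists (fun i => `[< D i >]), lam, F; split.
  split; last exact/(spectral_sumP _ _ fF).
  move=> i j /asboolP Di /asboolP Dj.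
  by rewrite -(onf i j Di Dj) /ip (fF i Di) (fF j Dj).
have -> : above (fun i => `[< D i >]) lam al = (fun i => `[< (D `&` [set i | al < `|lam i|]) i >]).
  apply/funext => i; rewrite /above; apply/idP/idP.
    by move=> /andP[/asboolP Di li]; apply/asboolP.
  by move=> /asboolP[Di /= ->]; rewrite andbT; apply/asboolP.
by apply/(spectral_sumP lam (MkL2 hK) (f := f)) => // i [/fF].
Qed.

Lemma op_bound_of_cut (e : R) : 0 < e -> exists2 x : R, 0 < x &
  forall u v, contraction u -> contraction v -> (cut_norm mu (u - v)%R <= x%:E)%E ->
    op_bound ip1 ip2 tens (u - v) e.
Proof.
(* This [K] makes the error [4 / K] of [op_bound_cut] equal to [e / 2]; the tolerance
   [e / 2 / K ^+ 2] makes its other term the second half. *)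
move=> e0; pose K := 8 / e; have K0 : 0 < K by rewrite divr_gt0.
exists (e / 2 / K ^+ 2); first by rewrite !divr_gt0// exprn_gt0.
move=> u v u1 v1 h.
have uv2 : {ae mu2, forall z, nc ((u - v) z) <= 2}.
  apply: filterS2 u1 v1 => z u1 v1; rewrite L2B (le_trans (ncD _ _))// ncN.
  by rewrite (_ : 2 = 1 + 1)// lerD.
have e1 : 0 <= e / 2 / K ^+ 2 by rewrite !divr_ge0 ?exprn_ge0 ?ltW.
have := op_bound_cut uv2 e1 K0 h.
have -> // : K ^+ 2 * (e / 2 / K ^+ 2) + 4 / K = e.
rewrite mulrC divfK ?expf_neq0 ?gt_eqF// /K.
by field; rewrite gt_eqF.
Qed.

Lemma calM_pull psi (mpsi : measure_preserving mu psi) u :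
  calM mu u -> calM mu (pull mpsi u).
Proof.
move=> [_ usa /cLnorm_ooP u1]; split; first exact: L2P.
  exact: (mp_ae (mp_sqmap mpsi) usa).
by apply/cLnorm_ooP; exact: (mp_ae (mp_sqmap mpsi) u1).
Qed.

(** Composition with [psi] preserves inner products, so it carries an expansion to one with the same
    eigenvalues. *)
Lemma is_truncation_pull psi (mpsi : measure_preserving mu psi) u al K :
  is_truncation u al K -> is_truncation (pull mpsi u) al (pull mpsi K).
Proof.
move=> [b [lam [f [[onf su] sK]]]].
have tr P A : sums_to ip2 tens lam f P A ->
    sums_to ip2 tens lam (fun i => L2comp mpsi (f i)) P (pull mpsi A).
  move=> h e e0; have [N hN] := h e e0; exists N => n /hN.
  rewrite -(nr_L2comp (mp_sqmap mpsi)).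
  suff -> : L2comp (mp_sqmap mpsi) (A - partial tens lam f P n) =
      pull mpsi A - partial tens lam (fun i => L2comp mpsi (f i)) P n by [].
  apply: L2_ext => z; rewrite L2B [LHS]/= /partial !L2_sum; congr (_ - _).
exists b, lam, (fun i => L2comp mpsi (f i)); split; last exact: tr.
split; last exact: tr.
by move=> i j bi bj; rewrite ip_L2comp; exact: onf.
Qed.

End class_M.

(** * Minimizing sequences in midpoint hulls *)

Section cut_completeness.
Context {d : measure_display} {V : measurableType d} {R : realType}.
Variable mu : probability V R.
Local Notation mu2 := (mu \x mu)%E.
Local Notation H2 := (L2 (mu \x mu)%E).
Local Notation ip2 := (ip (P := (mu \x mu)%E)).
Local Notation nr2 := (nr ip2).
Local Notation sqn2 := (sqn ip2).
Local Notation hip2 := (ip_semi_inner (mu \x mu)%E).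

Definition midpoint (u v : H2) : H2 := (2^-1)%:C%C *: (u + v).

(** Midpoints are all that the parallelogram law calls for, and induction on this type carries
    [calM] and bounds on the cut distance from a tail of [X] to its hull. *)
Inductive midpoint_hull (X : nat -> H2) (n : nat) : H2 -> Prop :=
| hull_base k : (n <= k)%N -> midpoint_hull X n (X k)
| hull_mid u v : midpoint_hull X n u -> midpoint_hull X n v ->
    midpoint_hull X n (midpoint u v).

Variable X : nat -> H2.
Local Notation hull := (midpoint_hull X).

Lemma hull_le n m u : (n <= m)%N -> hull m u -> hull n u.
Proof.
move=> nm; elim=> [k mk|v w _ hv _ hw]; last exact: hull_mid.
by apply: hull_base; exact: leq_trans mk.
Qed.

Lemma midpoint_subl u v w : midpoint u v - w = midpoint (u - w) (v - w).
Proof.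
rewrite /midpoint addrACA -opprD scalerBr [_ *: (w + w)]scalerDr -scalerDl -rmorphD.
by rewrite (_ : 2^-1 + 2^-1 = 1) ?scale1r//; lra.
Qed.

Lemma hull_cut_le n (w : H2) (x : R) u : hull n u ->
  (forall k, (n <= k)%N -> (cut_norm mu (X k - w)%R <= x%:E)%E) ->
  (cut_norm mu (u - w)%R <= x%:E)%E.
Proof.
move=> hu hX; elim: hu => [k nk|v v' _ hv _ hv']; first exact: hX.
rewrite midpoint_subl; apply: ub_ereal_sup => _ [f [g [hf hg ->]]].
have cA := cint_kernel_form (v - w) hf hg; have cB := cint_kernel_form (v' - w) hf hg.
have bound (A : H2) : (cut_norm mu A <= x%:E)%E -> nc (kernel_form mu f A g) <= x.
  by move=> Ax; rewrite -lee_fin (le_trans _ Ax)//; apply: ereal_sup_ubound; exists f, g.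
have -> : kernel_form mu f (midpoint (v - w) (v' - w)) g =
    (2^-1)%:C%C * (kernel_form mu f (v - w) g + kernel_form mu f (v' - w) g).
  rewrite /kernel_form -CI_D// -CI_Z; last exact: cintD.
  by apply: eq_CI => z; rewrite /midpoint L2Z L2D; ring.
rewrite lee_fin ncM nc_real ger0_norm ?invr_ge0//.
have b1 := bound _ hv; have b2 := bound _ hv'.
have := ncD (kernel_form mu f (v - w) g) (kernel_form mu f (v' - w) g).
by move: b1 b2; lra.
Qed.

Hypothesis X_calM : forall k, calM mu (X k).

Lemma hull_calM n u : hull n u -> calM mu u.
Proof.
elim=> [k _|v w _ /calMP[v1 v2] _ /calMP[w1 w2]]; first exact: X_calM.
apply/calMP; split.
  have -> : midpoint v w - adjoint (midpoint v w) =
      midpoint (v - adjoint v) (w - adjoint w).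
    by apply: L2_ext => z; rewrite L2B /midpoint !L2Z !L2D /= !conjcM conjcD conjc_realC; ring.
  apply/eqP; rewrite eq_le nr_ge0 andbT /midpoint (nrZ hip2).
  have := nrD hip2 (v - adjoint v) (w - adjoint w).
  rewrite v1 w1 addr0 => h; rewrite mulr_ge0_le0 ?nc_ge0//.
apply: filterS2 v2 w2 => z z1 z2.
rewrite /midpoint L2Z L2D ncM nc_real ger0_norm ?invr_ge0//.
by have := ncD (v z) (w z); move: z1 z2; lra.
Qed.

Let D n : set R := [set r | exists2 u, hull n u & r = sqn2 u].

Let D_inf n : has_inf (D n).
Proof.
split; first by exists (sqn2 (X n)), (X n) => //; exact: hull_base.
by exists 0 => _ [u _ ->]; exact: (sqn_ge0 hip2).
Qed.

Let s n := inf (D n).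

Let s_le n u : hull n u -> s n <= sqn2 u.
Proof. by move=> hu; apply: ge_inf; [exact: (D_inf n).2|exists u]. Qed.

Let s_nondec : nondecreasing_seq s.
Proof.
move=> n m nm; apply: lb_le_inf; first exact: (D_inf m).1.
by move=> _ [u hu ->]; apply: s_le; exact: hull_le hu.
Qed.

Let s_le1 n : s n <= 1.
Proof.
have hn : hull n (X n) by exact: hull_base.
apply: le_trans (s_le hn) _; have /calMP[_ c] := X_calM n.
by rewrite -(nr_sqr hip2) expr_le1// ?nr_ge0// contraction_nr.
Qed.

(* Near-minimizers of the norm over the decreasing midpoint hulls form an
   L_2-Cauchy sequence, by the parallelogram law. *)
Lemma hull_minimizers : exists2 y : nat -> H2, (forall n, hull n (y n)) &
  forall e, 0 < e -> exists N, forall n m, (N <= n)%N -> (N <= m)%N ->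
    nr2 (y n - y m) < e.
Proof.
have /choice[y yP] : forall n, exists u, hull n u /\ sqn2 u < s n + n.+1%:R^-1.
  move=> n; have n0 : 0 < n.+1%:R^-1 :> R by rewrite invr_gt0.
  by have [_ [u hu ->] h] := inf_adherent n0 (D_inf n); exists u.
exists y => [n|e e0]; first by case: (yP n).
have e8 : 0 < e ^+ 2 / 8 by rewrite divr_gt0 ?exprn_gt0.
have sub : has_ubound (range s) by exists 1 => _ [n _ <-]; exact: s_le1.
have sc := nondecreasing_is_cvgn s_nondec sub.
have ssup n : s n <= limn s by exact: nondecreasing_cvgn_le.
have [N1 _ hN1] : \forall n \near \oo, limn s - e ^+ 2 / 8 < s n.
  by apply: (cvgr_gt (limn s)) => //; rewrite gtrBl.
pose N2 := Num.truncn ((e ^+ 2 / 8)^-1).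
exists (maxn N1 N2) => n m nN mN.
wlog nm : n m nN mN / (n <= m)%N.
  move=> h; have [nm|/ltnW nm] := leqP n m; first exact: h.
  by rewrite (nrBC hip2); exact: h.
move: nN mN; rewrite !geq_max => /andP[n1 n2] /andP[m1 m2].
have [hn yn] := yP n; have [hm ym] := yP m.
have inv k : (N2 <= k)%N -> k.+1%:R^-1 < e ^+ 2 / 8 :> R.
  move=> Nk; rewrite -[ltRHS]invrK ltf_pV2 ?posrE ?invr_gt0//.
  by rewrite (lt_le_trans (truncnS_gt _))// ler_nat ltnS.
have hmid : s n <= sqn2 (midpoint (y n) (y m)).
  by apply: s_le; apply: hull_mid => //; exact: hull_le hm.
rewrite -ltr_sqr ?nnegrE ?nr_ge0 ?ltW// (nr_sqr hip2) (parallelogram hip2).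
rewrite -/(midpoint (y n) (y m)).
have i1 := inv n n2; have i2 := inv m m2; have i3 := ssup m; have i4 := hN1 n n1.
have i5 : 0 < e ^+ 2 by rewrite exprn_gt0.
(* Of the eighths of [E], two come from [s m - s n] and two from the slack of each near-minimizer,
   six in all. *)
have arith (a a' m' t t' l p p' E : R) : a < t + p -> a' < t' + p' -> t <= m' ->
    p < E / 8 -> p' < E / 8 -> t' <= l -> l - E / 8 < t -> 0 < E ->
    2 * a + 2 * a' - 4 * m' < E by lra.
exact: (arith _ _ _ _ _ _ _ _ _ yn ym hmid i1 i2 i3 i4 i5).
Qed.

(** [X n] is close in cut norm to a tail of the sequence, hence to the hull of that tail, which
    contains the late near-minimizers. These converge in L_2, whose norm dominates the cut norm. *)
Lemma cut_cauchy_limit :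
  (forall e : R, 0 < e -> exists N, forall n m, (N <= n)%N -> (N <= m)%N ->
     (cut_norm mu (X n - X m)%R <= e%:E)%E) ->
  exists2 Y : H2, calM mu Y & forall e : R, 0 < e -> exists N, forall n, (N <= n)%N ->
    (cut_norm mu (X n - Y)%R < e%:E)%E.
Proof.
move=> Xc; have [y yh yc] := hull_minimizers.
have yM n : calM mu (y n) by exact: hull_calM (yh n).
have y1 n : {ae mu2, forall z, nc (y n z) <= 1} by have /calMP[_] := yM n.
have [Y Y1 yY] := L2_bounded_complete (@ler01 R) y1 yc.
have YM : calM mu Y.
  apply/calMP; split; last by apply: nearW => z; exact: Y1.
  apply/eqP; rewrite eq_le nr_ge0 andbT; apply/ler_addgt0Pr => e e0.
  have e2 : 0 < e / 2 by rewrite divr_gt0.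
  have [N hN] := yY _ e2; have h := hN N (leqnn _).
  have /calMP[yN _] := yM N.
  rewrite add0r; apply: le_trans (nrB_trans hip2 (y N) _ _) _.
  rewrite (splitr e) lerD//; first by rewrite (nrBC hip2) ltW.
  apply: le_trans (nrB_trans hip2 (adjoint (y N)) _ _) _.
  by rewrite yN add0r -adjointB nr_adjoint ltW.
exists Y => // e e0.
have e2 : 0 < e / 2 by rewrite divr_gt0.
have [N hN] := Xc _ e2; have [N' hN'] := yY _ e2.
exists N => n Nn; pose k := maxn N N'.
have hk : hull N (y k) by apply: hull_le (yh k); exact: leq_maxl.
have h1 : (cut_norm mu (X n - y k)%R <= (e / 2)%:E)%E.
  apply: le_trans (nrm_sub_sym (invariant_cut mu) _ _) _.
  by apply: (hull_cut_le hk) => j Nj; exact: hN.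
have h2 : (cut_norm mu (y k - Y)%R < (e / 2)%:E)%E.
  by apply: le_lt_trans (cut_norm_le_nr _) _; rewrite lte_fin hN'// leq_maxr.
have -> : X n - Y = (X n - y k) + (y k - Y) by rewrite addrA subrK.
apply: le_lt_trans (cut_normD _ _) _.
apply: le_lt_trans (leeD h1 (lexx _)) _.
by rewrite (_ : e%:E = (e / 2)%:E + (e / 2)%:E)%E ?lteD2lE// -EFinD -splitr.
Qed.

End cut_completeness.

(** * The equivalence *)

Section main.
Context {d : measure_display} {V : measurableType d} {R : realType}.
Variable mu : probability V R.
Local Notation mu2 := (mu \x mu)%E.
Local Notation H2 := (L2 (mu \x mu)%E).
Local Notation ip1 := (ip (P := mu)).
Local Notation ip2 := (ip (P := (mu \x mu)%E)).
Local Notation nr2 := (nr ip2).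
Local Notation hip1 := (ip_semi_inner mu).
Local Notation hip2 := (ip_semi_inner (mu \x mu)%E).
Local Notation tens := (tens (mu := mu)).
Local Notation expansion := (eigen_expansion ip1 ip2 tens).
Local Notation delta1 := (delta mu (kernel_norm1 mu)).
Local Notation deltac := (delta mu (cut_norm mu)).
Local Notation inv1 := (invariant_norm1 mu).
Local Notation invc := (invariant_cut mu).
Hypothesis V_delta_cut : delta_by_invertible mu (cut_norm mu).
Implicit Types (u K L N : H2).

Lemma delta1_lt_nr psi (mpsi : measure_preserving mu psi) K L (e : R) :
  nr2 (pull mpsi K - L) < e -> (delta1 K L < e%:E)%E.
Proof.
move=> h; apply: le_lt_trans (delta_le _ K L mpsi (mp_id mu)) _.
rewrite (_ : _ \- _ = (pull mpsi K - L : H2)); last by apply/funext => -[x y].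
by apply: le_lt_trans (cLnorm1_le _) _; rewrite lte_fin.
Qed.

(** A small cut distance is realized by moving [u] alone, and for kernels bounded by 1 a small cut
    norm means a small operator norm. *)
Lemma op_bound_alignment N (e : R) : calM mu N -> 0 < e ->
  exists2 x : R, 0 < x & forall u, calM mu u -> (deltac u N < x%:E)%E ->
    exists psi (mpsi : measure_preserving mu psi),
      op_bound ip1 ip2 tens (N - pull mpsi u) e.
Proof.
move=> /calMP[_ N1] e0; have [x x0 h] := op_bound_of_cut mu e0.
exists x => // u uM /(delta_lt_invertible V_delta_cut)[psi ipsi hpsi].
exists psi, ipsi.1; have /calMP[_ u1] := calM_pull ipsi.1 uM.
apply: h => //; apply: le_trans (nrm_sub_sym invc _ _) _.
exact: ltW.
Qed.

Lemma nr_calM u : calM mu u -> nr2 u <= 1.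
Proof. by move=> /calMP[_]; exact: contraction_nr. Qed.

Lemma delta1_truncation_regular b lam f N (al dl : R) K (e : R) :
  calM mu N -> expansion b lam f N -> 0 < dl -> dl < al ->
  (forall i, b i -> al + dl <= `|lam i| \/ `|lam i| <= al - dl) ->
  sums_to ip2 tens lam f (above b lam al) K -> 0 < e ->
  exists2 x : R, 0 < x & forall u K', calM mu u -> is_truncation u al K' ->
    (deltac u N < x%:E)%E -> (delta1 K' K < e%:E)%E.
Proof.
move=> NM eN dl0 dlal gap hK e0.
have [C C0 hC] := truncation_lipschitz hip1 hip2 (@tensDl _ _ _ mu) (@tensZl _ _ _ mu)
  (@tensDr _ _ _ mu) (@tensZr _ _ _ mu) (ip_tens (mu := mu)) eN (nr_calM NM) dl0 dlal gap.
have e'0 : 0 < e / (2 * C) by rewrite divr_gt0 ?mulr_gt0.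
have [x x0 h] := op_bound_alignment NM e'0; exists x => // u K' uM uK' uN.
have [psi [mpsi ob]] := h u uM uN.
have [c [nu [g [eu su]]]] := is_truncation_pull mpsi uK'.
apply: (@delta1_lt_nr psi mpsi); rewrite (nrBC hip2).
apply: le_lt_trans (hC _ _ _ _ _ _ _ eu (nr_calM (calM_pull mpsi uM)) (ltW e'0) ob hK su) _.
have -> : C * (e / (2 * C)) = e / 2 by field; rewrite gt_eqF.
by lra.
Qed.

(** The order of the choices matters: the level is restricted in terms of [e], and only then the
    tolerance [x], which may shrink with the level. Every level below [al0] is allowed because the
    limit formula concerns arbitrary sequences of levels. *)
Lemma delta1_truncation_limit N (e : R) : calM mu N -> 0 < e ->
  exists2 al0 : R, 0 < al0 & forall al, 0 < al -> al < al0 ->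
    exists2 x : R, 0 < x & forall u K', calM mu u -> is_truncation u al K' ->
      (deltac u N < x%:E)%E -> (delta1 K' N < e%:E)%E.
Proof.
move=> NM e0; have [b [lam [f eN]]] := calM_expansion NM.
have e2 : 0 < e / 2 by rewrite divr_gt0.
have [al0 al00 hal] := truncation_continuity hip1 hip2 (@tensDl _ _ _ mu) (@tensZl _ _ _ mu)
  (@tensDr _ _ _ mu) (@tensZr _ _ _ mu) (ip_tens (mu := mu)) eN (nr_calM NM) e2.
exists al0 => // al alp alal0; have [e' e'0 he] := hal al alp alal0.
have [x x0 h] := op_bound_alignment NM e'0; exists x => // u K' uM uK' uN.
have [psi [mpsi ob]] := h u uM uN.
have [c [nu [g [eu su]]]] := is_truncation_pull mpsi uK'.
apply: (@delta1_lt_nr psi mpsi).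
apply: le_lt_trans (he _ _ _ _ _ eu (nr_calM (calM_pull mpsi uM)) ob su) _.
by lra.
Qed.

(** The discarded part has operator norm at most [al], whatever its Hilbert-Schmidt norm. *)
Lemma deltac_truncation u K (al : R) : 0 < al -> is_truncation u al K ->
  (deltac u K <= al%:E)%E.
Proof.
move=> al0 [b [lam [f [[onf su] sK]]]].
apply: le_trans (@delta_le_nrm _ _ _ mu (cut_norm mu) u K) _.
apply: cut_norm_le_op; last exact: ltW.
exact: (op_bound_tail hip1 hip2 (ip_tens (mu := mu)) onf su al0 sK).
Qed.

Lemma deltac_le_delta1 K L : (deltac K L <= delta1 K L)%E.
Proof.
apply: le_ereal_inf_tmp => _ [psi1 [psi2 [m1 m2 ->]]].
apply: le_trans (delta_le _ K L m1 m2) _.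
exact: (cut_norm_le_norm1 (pull m1 K - pull m2 L)).
Qed.

Variable M : nat -> H2.
Hypothesis M_calM : forall i, calM mu (M i).

Definition delta_cvg (nrm : (V * V -> R[i]) -> \bar R) (W : nat -> H2) (L : H2) :=
  forall e : R, 0 < e -> exists n, forall i, (n <= i)%N ->
    (delta mu nrm (W i) L < e%:E)%E.

Lemma delta_limitP nrm (hn : invariant_norm mu nrm) (W : nat -> H2) (L : H2) :
  delta_limit mu nrm (fun i => W i) L <-> delta_cvg nrm W L.
Proof.
split=> [[_ /ecvg0P h]|h].
  by apply: h => n; exact: delta_ge0.
by split; [exact: L2P|apply/ecvg0P => // n; exact: delta_ge0].
Qed.

(** One level is taken in each of the disjoint intervals from [j.+2%:R^-1] to [j.+1%:R^-1], so the
    levels decrease to 0. They are regular for [N], and the limit [K] is the truncation of [N] at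
    that level. *)
Lemma regular_levels N : calM mu N -> exists2 al : nat -> R,
  [/\ forall j, 0 < al j, decreasing_seq al & al j @[j --> \oo] --> (0 : R)] &
  forall j, exists K : H2, forall e : R, 0 < e -> exists2 x : R, 0 < x &
    forall u K', calM mu u -> is_truncation u (al j) K' ->
      (deltac u N < x%:E)%E -> (delta1 K' K < e%:E)%E.
Proof.
move=> NM; have [b [lam [f eN]]] := calM_expansion NM.
have /choice[al alP] : forall j : nat, exists al : R, [/\ j.+2%:R^-1 < al, al < j.+1%:R^-1 &
    exists2 dl : R, 0 < dl & dl < al /\
      (forall i, b i -> al + dl <= `|lam i| \/ `|lam i| <= al - dl)].
  move=> j; have j0 : 0 < j.+2%:R^-1 :> R by rewrite invr_gt0.
  have jj : j.+2%:R^-1 < j.+1%:R^-1 :> R by rewrite ltf_pV2 ?posrE// ltr_nat.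
  have [al [dl [h1 h2 h3 h4 h5]]] := gap_exists hip1 hip2 (ip_tens (mu := mu)) eN.1 eN.2 j0 jj.
  by exists al; split => //; exists dl.
have al0 j : 0 < al j.
  by have [h _ _] := alP j; apply: lt_trans h; rewrite invr_gt0.
exists al.
  split => //.
    apply/decreasing_seqP => j; have [_ h1 _] := alP j.+1; have [h2 _ _] := alP j.
    exact: lt_trans h1 h2.
  apply/cvgrPdist_lt => e e0; exists (Num.truncn e^-1) => // j /= hj.
  rewrite sub0r normrN gtr0_norm//; have [_ h _] := alP j; apply: lt_trans h _.
  rewrite -[ltRHS]invrK ltf_pV2 ?posrE ?invr_gt0//.
  by rewrite (lt_le_trans (truncnS_gt _))// ler_nat ltnS.
move=> j; have [_ _ [dl dl0 [dlal gap]]] := alP j.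
have [n hn] := sums_to_above hip1 hip2 (ip_tens (mu := mu)) eN (al0 j).
exists (partial tens lam f (above b lam (al j)) n) => e e0.
exact: (delta1_truncation_regular NM eN dl0 dlal gap (hn n (leqnn _)) e0).
Qed.

Lemma cut_limit_of_cauchy :
  (forall e : R, 0 < e -> exists n, forall i k, (n <= i)%N -> (n <= k)%N ->
    (deltac (M i) (M k) < e%:E)%E) ->
  exists2 N : H2, calM mu N & delta_cvg (cut_norm mu) M N.
Proof.
move=> Mc.
have /choice[p pP] : forall k : nat, exists n, forall i j, (n <= i)%N -> (n <= j)%N ->
    (deltac (M i) (M j) < (2^-1 ^+ k)%:E)%E.
  by move=> k; apply: Mc; rewrite exprn_gt0// invr_gt0.
(* The sum dominates [p i] for every [i <= k], and the last summand gives [k <= q k]. *)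
pose q k := (\sum_(i < k.+1) p i + k)%N.
have pq k m : (k <= m)%N -> (p k <= q m)%N.
  rewrite -ltnS => km; rewrite /q (bigD1 (Ordinal km))//=.
  by rewrite -!addnA leq_addr.
have kq k : (k <= q k)%N by rewrite /q leq_addl.
have /choice[ps psP] : forall k, exists psi, invertible_measure_preserving mu psi /\
    (cut_norm mu (pullback psi (M (q k.+1)) \- M (q k))%R < (2^-1 ^+ k)%:E)%E.
  move=> k; have h := pP k _ _ (pq k k.+1 (leqnSn _)) (pq k k (leqnn _)).
  by have [psi ? ?] := delta_lt_invertible V_delta_cut h; exists psi.
(* Each [ps k] aligns a term with its predecessor; the compositions align all terms with the first
   one. *)
have chi_ex : exists chi : nat -> V -> V, chi 0%N = id /\
    forall k, chi k.+1 = ps k \o chi k.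
  exists (fix chi k := if k is k'.+1 then ps k' \o chi k' else id); by split.
have [chi [chi0 chiS]] := chi_ex.
have ichi k : invertible_measure_preserving mu (chi k).
  elim: k => [|k ih]; first by rewrite chi0; exact: imp_id.
  by rewrite chiS; apply: imp_comp => //; case: (psP k).
pose X k := pull (ichi k).1 (M (q k)).
have XM k : calM mu (X k) by exact: calM_pull.
have Xstep k : (cut_norm mu (X k.+1 - X k)%R <= (2^-1 ^+ k)%:E)%E.
  have [ips hk] := psP k; apply: le_trans _ (ltW hk).
  (* Both terms factor through [chi k], so the step is the pullback of a difference already known to
     be small. *)
  have -> : (X k.+1 - X k : H2) = pull (ichi k).1 (pull ips.1 (M (q k.+1)) - M (q k)).
    by apply: L2_ext => -[x y]; rewrite L2B /= /sqmap /= chiS.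
  exact: (invn_pullback invc (pull ips.1 (M (q k.+1)) - M (q k)) (ichi k)).
have Xgeo n k : (cut_norm mu (X (n + k)%N - X n)%R <= (2 * 2^-1 ^+ n)%:E)%E.
  (* The subtracted term makes the geometric sum exact, so that the induction on [k] closes. *)
  suff h : (cut_norm mu (X (n + k)%N - X n)%R <= (2 * 2^-1 ^+ n - 2 * 2^-1 ^+ (n + k))%:E)%E.
    by apply: le_trans h _; rewrite lee_fin gerBl mulr_ge0// exprn_ge0// invr_ge0.
  elim: k => [|k ih].
    rewrite addn0 subrr; apply: le_trans (cut_norm_le_nr _) _.
    by rewrite ?subrr (nr0 hip2) ?subrr.
  rewrite addnS; have -> : X (n + k).+1 - X n = (X (n + k).+1 - X (n + k)%N) + (X (n + k)%N - X n).
    by rewrite addrA subrK.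
  apply: le_trans (cut_normD _ _) _; apply: le_trans (leeD (Xstep _) ih) _.
  by rewrite -EFinD lee_fin exprS; lra.
have half_small (e : R) : 0 < e -> exists n, 2 * 2^-1 ^+ n < e.
  move=> e0; have : (2^-1 : R) ^+ n @[n --> \oo] --> (0 : R).
    by apply: cvg_expr; rewrite ger0_norm ?invr_ge0// invf_lt1// ltr1n.
  have e2 : 0 < e / 2 by rewrite divr_gt0.
  move=> /cvgrPdist_lt /(_ _ e2) [n _ /(_ n (leqnn _))] /=.
  rewrite sub0r normrN ger0_norm ?exprn_ge0 ?invr_ge0// => h; exists n.
  by move: h; rewrite ltr_pdivlMr// mulrC.
have Xc (e : R) : 0 < e -> exists N : nat, forall n m : nat, (N <= n)%N -> (N <= m)%N ->
     (cut_norm mu (X n - X m)%R <= e%:E)%E.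
  move=> e0; have e2 : 0 < e / 2 by rewrite divr_gt0.
  have [N hN] := half_small _ e2; exists N => n m Nn Nm.
  have -> : X n - X m = (X n - X N) + (X N - X m) by rewrite addrA subrK.
  apply: le_trans (cut_normD _ _) _; rewrite (_ : e%:E = (e / 2)%:E + (e / 2)%:E)%E; last by rewrite -EFinD -splitr.
  apply: leeD.
    by rewrite -(subnKC Nn); apply: le_trans (Xgeo _ _) _; rewrite lee_fin ltW.
  apply: le_trans (nrm_sub_sym invc _ _) _.
  by rewrite -(subnKC Nm); apply: le_trans (Xgeo _ _) _; rewrite lee_fin ltW.
have [Y YM hY] := cut_cauchy_limit XM Xc; exists Y => // e e0.
have e2 : 0 < e / 2 by rewrite divr_gt0.
have [n1 h1] := Mc _ e2; have [n2 h2] := hY _ e2.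
exists n1 => i ni; pose k := maxn n1 n2.
have d1 : (deltac (M i) (M (q k)) < (e / 2)%:E)%E.
  by apply: h1 => //; apply: leq_trans (kq k); exact: leq_maxl.
have d2 : (deltac (M (q k)) Y < (e / 2)%:E)%E.
  apply: le_lt_trans (delta_le _ (M (q k)) Y (ichi k).1 (mp_id mu)) _.
  rewrite (_ : _ \- _ = (X k - Y : H2)); last by apply/funext => -[x y].
  by apply: h2; exact: leq_maxr.
by rewrite (splitr e); exact: (delta_triangle invc V_delta_cut d1 d2).
Qed.

(** At a level below [e / 4] the chain goes from [M i] to its truncation, to [L j], to the
    truncation of [M k] and to [M k], with four links below [e / 4]. *)
Lemma deltac_cauchy_of_truncations (al : nat -> R) (K : nat -> nat -> H2) (L : nat -> H2) :
  (forall j, 0 < al j) -> al j @[j --> \oo] --> (0 : R) ->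
  (forall j i, is_truncation (M i) (al j) (K j i)) ->
  (forall j, delta_cvg (kernel_norm1 mu) (K j) (L j)) ->
  forall e : R, 0 < e -> exists n, forall i k, (n <= i)%N -> (n <= k)%N ->
    (deltac (M i) (M k) < e%:E)%E.
Proof.
move=> al0 alc MK KL e e0.
have e4 : 0 < e / 4 by rewrite divr_gt0.
have /cvgrPdist_lt /(_ _ e4) [j _ /(_ j (leqnn _))] := alc.
rewrite /= sub0r normrN gtr0_norm// => alj.
have [n hn] := KL j _ e4; exists n => i k ni nk.
have a1 m : (deltac (M m) (K j m) < (e / 4)%:E)%E.
  by apply: le_lt_trans (deltac_truncation (al0 j) (MK j m)) _; rewrite lte_fin.
have a2 m : (n <= m)%N -> (deltac (K j m) (L j) < (e / 4)%:E)%E.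
  by move=> /hn; apply: le_lt_trans; exact: deltac_le_delta1.
have sym (u v : H2) x : (deltac u v < x)%E -> (deltac v u < x)%E.
  by apply: le_lt_trans; exact: (delta_sym invc).
have tri := delta_triangle invc V_delta_cut.
have b1 := tri _ _ _ _ _ (a1 i) (a2 i ni).
have b2 := tri _ _ _ _ _ (a1 k) (a2 k nk).
have := tri _ _ _ _ _ b1 (sym _ _ _ b2).
by congr (_ < _%:E)%E; lra.
Qed.

End main.

Theorem proposition1p2 (R : realType) (d : measure_display)
    (V : measurableType d) (mu : probability V R)
    (V_separable : separable_measure mu)
    (V_delta1 : delta_by_invertible mu (kernel_norm1 mu))
    (V_delta_cut : delta_by_invertible mu (cut_norm mu))
    (M : nat -> V * V -> complex R)
    (M_calM : forall i, calM mu (M i)) :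
  ((exists N, calM mu N /\ delta_limit mu (cut_norm mu) M N) <->
   (exists alpha : nat -> R, convergent_truncations mu M alpha)) /\
  (forall alpha : nat -> R, convergent_truncations mu M alpha ->
   forall (L : nat -> V * V -> complex R) (N : V * V -> complex R),
     (forall j, delta_limit mu (kernel_norm1 mu)
                  (fun i => truncation mu (M i) (alpha j)) (L j)) ->
     calM mu N -> delta_limit mu (cut_norm mu) M N ->
     delta_limit mu (kernel_norm1 mu) L N).
Proof.
have ML2 i : inL2 (mu \x mu)%E (M i) by case: (M_calM i).
pose M' i : L2 (mu \x mu)%E := MkL2 (ML2 i).
have M'M i : calM mu (M' i) by exact: M_calM.
have inv1 := invariant_norm1 mu; have invc := invariant_cut mu.
(* The chosen representatives are packed as elements of [L2] for all [i] at once, together with the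
   expansions they come from. *)
have trunc (al : R) : 0 < al -> exists K : nat -> L2 (mu \x mu)%E,
    (fun i => truncation mu (M i) al) = (fun i => K i) /\
    forall i, is_truncation (M' i) al (K i).
  move=> al0; have /choice[K KP] : forall i, exists K : L2 (mu \x mu)%E,
      truncation mu (M i) al = K /\ is_truncation (M' i) al K.
    by move=> i; have [K ? ?] := truncationP (M'M i) al0; exists K.
  exists K; split; last by move=> i; case: (KP i).
  by apply/funext => i; case: (KP i).
split; last first.
  move=> al [al0 _ alc _] L N hL NM hN.
  have LL2 j : inL2 (mu \x mu)%E (L j) by case: (hL j).
  pose L' j : L2 (mu \x mu)%E := MkL2 (LL2 j); have NL2 := hN.1; pose N' := MkL2 NL2.
  apply/(delta_limitP inv1 L' N') => e e0.
  have {}hN : delta_cvg (cut_norm mu) M' N' by apply/delta_limitP.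
  have e2 : 0 < e / 2 by rewrite divr_gt0.
  have [a0 a00 ha] := delta1_truncation_limit V_delta_cut (N := N') NM e2.
  have /cvgrPdist_lt /(_ _ a00) [n _ hn] := alc.
  exists n => j nj; have := hn j nj; rewrite /= sub0r normrN gtr0_norm// => alj.
  have [x x0 hx] := ha _ (al0 j) alj.
  have [K [KE KT]] := trunc _ (al0 j).
  have {}hL : delta_cvg (kernel_norm1 mu) K (L' j).
    by apply/delta_limitP => //; rewrite -KE; exact: hL.
  have [n1 h1] := hL _ e2; have [n2 h2] := hN _ x0.
  (* For the given [j] one large [i] suffices: the truncation of [M i] is then near [L j] by
     hypothesis and near [N] by [delta1_truncation_limit]. *)
  pose i := maxn n1 n2.
  have d1 := h1 i (leq_maxl _ _).
  have d2 := hx _ _ (M'M i) (KT i) (h2 i (leq_maxr _ _)).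
  have d1' := le_lt_trans (delta_sym inv1 _ _) d1.
  by rewrite (splitr e); exact: (delta_triangle inv1 V_delta1 d1' d2).
split.
  move=> [N [NM hN]]; have NL2 := hN.1; pose N' := MkL2 NL2.
  have {}hN : delta_cvg (cut_norm mu) M' N' by apply/delta_limitP.
  have [al [al0 aldec alc] hal] := regular_levels V_delta_cut (N := N') NM.
  exists al; split => // j; have [K hK] := hal j; exists K.
  have [T [TE TT]] := trunc _ (al0 j); rewrite TE.
  apply/delta_limitP => // e e0; have [x x0 hx] := hK _ e0.
  by have [n hn] := hN _ x0; exists n => i /hn; apply: hx.
move=> [al [al0 aldec alc hal]].
have /choice[T TP] : forall j, exists K : nat -> L2 (mu \x mu)%E,
    (fun i => truncation mu (M i) (al j)) = (fun i => K i) /\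
    forall i, is_truncation (M' i) (al j) (K i).
  by move=> j; exact: trunc.
have /choice[L LP] : forall j, exists L' : L2 (mu \x mu)%E,
    delta_cvg (kernel_norm1 mu) (T j) L'.
  move=> j; have [L hL] := hal j; exists (MkL2 hL.1).
  by apply/delta_limitP => //; have [<- _] := TP j.
have Mc := deltac_cauchy_of_truncations V_delta_cut al0 alc (fun j => (TP j).2) LP.
have [N NM hN] := cut_limit_of_cauchy V_delta_cut M'M Mc.
exists N; split => //.
by apply/(delta_limitP invc M' N).
Qed.
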